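(* Let $s:=\sqrt{\sigma-i\varepsilon}$, where the complex square root is taken with positive real part, and let $C$ be the real constant $$C:=\Re\,\frac{s\big((p_b+s)(p_a+s)-(s-p_b)(s-p_a)e^{-4sL}\big)}{\big((s-p_a)e^{-2sL}+s+p_a\big)\big((s-p_b)e^{-2sL}+s+p_b\big)},$$ where $p_a$ and $p_b$ are the Robin parameters at the outer boundaries. Consider the optimized Schwarz method with two subdomains, overlap $\delta$, and smallest frequency $\tilde k_{\min}=0$. (i) If $p_1^+=p_2^-=:p$, the asymptotically optimized parameter $p$ for small overlap $\delta$ and the associated convergence factor are $$p=2^{-1/3}C^{2/3}\delta^{-1/3},\qquad \rho=1-2\cdot 2^{1/3}C^{1/3}\delta^{1/3}+\mathcal O(\delta^{2/3}).$$ (ii) If $p_1^+\neq p_2^-$, the asymptotically optimized parameters for small overlap $\delta$ and the associated convergence factor are $$p_1^+=2^{-2/5}C^{2/5}\delta^{-3/5},\qquad p_2^-=2^{-4/5}C^{4/5}\delta^{-1/5},\qquad \rho=1-2\cdot2^{-1/5}C^{1/5}\delta^{1/5}+\mathcal O(\delta^{2/5}).$$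
   Context: The equation is $\Delta u-(\sigma-i\varepsilon)u=f$ with strictly positive constants $\sigma,\varepsilon$, on the union of the rectangles $\Omega_j=(a_j,b_j)\times(0,\hat L)$, $j=1,\dots,J$, $a_j=(j-1)L-\delta/2$, $b_j=jL+\delta/2$, where $\delta$ is the overlap; here $J=2$. The optimized Schwarz method solves at iteration $n$ the equation in $\Omega_j$ with $-\partial_xu_j^n+p_j^-u_j^n=-\partial_xu_{j-1}^{n-1}+p_j^-u_{j-1}^{n-1}$ at $x=a_j$ and $\partial_xu_j^n+p_j^+u_j^n=\partial_xu_{j+1}^{n-1}+p_j^+u_{j+1}^{n-1}$ at $x=b_j$ (with $u_0^{n-1}=u_{J+1}^{n-1}=0$), homogeneous Dirichlet conditions at top and bottom, and real, strictly positive parameters $p_j^\pm$. The outer Robin parameters are fixed: $p_1^-=p_a$ and $p_J^+=p_b$. After a sine expansion in $y$ with frequency $\tilde k$, set $\lambda=\lambda(\tilde k)=\sqrt{\tilde k^2+\sigma-i\varepsilon}$. For $J=2$ the iteration on the Robin traces at the interface has the matrix $$T=\begin{pmatrix}0&\beta_1^+\\ \beta_2^-&0\end{pmatrix},$$ $$\beta_1^+=\frac{(\lambda+p_1^+)(\lambda-p_2^+)e^{-\lambda L}-(\lambda-p_1^+)(\lambda+p_2^+)e^{\lambda L}}{(\lambda+p_2^+)(\lambda+p_2^-)e^{\lambda(L+\delta)}-(\lambda-p_2^+)(\lambda-p_2^-)e^{-\lambda(L+\delta)}},$$ $$\beta_2^-=\frac{(\lambda+p_2^-)(\lambda-p_1^-)e^{-\lambda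 L}-(\lambda-p_2^-)(\lambda+p_1^-)e^{\lambda L}}{(\lambda+p_1^+)(\lambda+p_1^-)e^{\lambda(L+\delta)}-(\lambda-p_1^+)(\lambda-p_1^-)e^{-\lambda(L+\delta)}},$$ and the convergence factor at frequency $\tilde k$ is the spectral radius of $T$, so $\rho^2=|\beta_1^+\beta_2^-|$. The best choice of the interface parameters is the solution of the min-max problem $\min_{p_j^\pm}\max_{\tilde k\in K}\rho(T(\tilde k,p_j^\pm))$ over a numerically relevant frequency range $K=[\tilde k_{\min},\tilde k_{\max}]$, with $\tilde k_{\max}=M\pi/\hat L$, $M\sim 1/h$, $h$ the mesh size. ''Asymptotically optimized'' refers to this min-max problem for small $\delta$: the form of the parameters (powers of $\delta$, equioscillation of the convergence factor) is taken from numerical optimization for small overlap, and the constants are then determined by asymptotic expansion in $\delta$. No existence or uniqueness result for the optimizer is claimed.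
   Formalization: The mesh size h is assumed to be O(δ), so that the mesh resolves the overlap and the frequency range K grows at least like 1/δ; with h fixed as δ → 0 the stated parameters are not optimal, since a constant p keeps the convergence factor bounded away from 1. *)

(* Defs.v *)
From mathcomp Require Import all_boot all_order all_algebra.
From mathcomp Require Import complex.
From mathcomp Require Import all_classical all_reals all_analysis.

Set Implicit Arguments.
Unset Strict Implicit.
Unset Printing Implicit Defensive.

Import Order.TTheory GRing.Theory Num.Theory.
Import numFieldNormedType.Exports.

Local Open Scope classical_set_scope.
Local Open Scope ring_scope.
Local Open Scope complex_scope.

(* =O_(0^'+) does not parse (it clashes with =O_(x \near F)). *)
Notation zero_right := (at_right 0).

Section ComplexAux.
Context {R : realType}.

Definition cexp (z : R[i]) : R[i] :=
  (expR (complex.Re z) * cos (complex.Im z)) +i*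
  (expR (complex.Re z) * sin (complex.Im z)).

Definition spectral_radius n (A : 'M[R[i]]_n) : R :=
  sup [set Normc.normc a | a in [set a : R[i] | eigenvalue A a]].

End ComplexAux.

(* The equation is Delta u - (sigma - i eps) u = f on (a_1, b_2) x (0, Lhat),
   with Omega_1 = (- d/2, L + d/2) x (0, Lhat) and
   Omega_2 = (L - d/2, 2 L + d/2) x (0, Lhat), where d is the overlap.
   p1m, p1p are the Robin parameters of Omega_1 on its left and right sides,
   p2m, p2p those of Omega_2; lam is the symbol at a fixed frequency in y. *)
Section TwoSubdomains.
Context {R : realType}.
Implicit Types (lam : R[i]) (k L sigma eps d pa pb p1m p1p p2m p2p : R).

(* sqrtc is the root with nonnegative real part; the real part is positive
   when sigma > 0. *)
Definition symbol sigma eps k : R[i] :=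
  sqrtc ((k ^+ 2 + sigma) -i* eps).

Definition beta1p L d p1p p2m p2p lam : R[i] :=
  ((lam + p1p%:C) * (lam - p2p%:C) * cexp (- (lam * L%:C))
   - (lam - p1p%:C) * (lam + p2p%:C) * cexp (lam * L%:C))
  / ((lam + p2p%:C) * (lam + p2m%:C) * cexp (lam * (L + d)%:C)
     - (lam - p2p%:C) * (lam - p2m%:C) * cexp (- (lam * (L + d)%:C))).

Definition beta2m L d p1m p1p p2m lam : R[i] :=
  ((lam + p2m%:C) * (lam - p1m%:C) * cexp (- (lam * L%:C))
   - (lam - p2m%:C) * (lam + p1m%:C) * cexp (lam * L%:C))
  / ((lam + p1p%:C) * (lam + p1m%:C) * cexp (lam * (L + d)%:C)
     - (lam - p1p%:C) * (lam - p1m%:C) * cexp (- (lam * (L + d)%:C))).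

Definition iteration_matrix L d p1m p1p p2m p2p lam : 'M[R[i]]_2 :=
  \matrix_(i < 2, j < 2)
    (if (i == 0) && (j == 1) then beta1p L d p1p p2m p2p lam
     else if (i == 1) && (j == 0) then beta2m L d p1m p1p p2m lam
     else 0).

(* q = (p_1^+, p_2^-) are the free interface parameters;
   pa = p_1^- and pb = p_2^+ are the fixed outer ones. *)
Definition convergence_factor L sigma eps pa pb d (q : R * R) k : R :=
  spectral_radius
    (iteration_matrix L d pa q.1 q.2 pb (symbol sigma eps k)).

Definition max_convergence_factor L sigma eps pa pb kmax d (q : R * R) : R :=
  sup [set convergence_factor L sigma eps pa pb d q k
      | k in [set k | 0 <= k <= kmax]].

Definition constC L sigma eps pa pb : R :=
  let s := symbol sigma eps 0 in
  let a := pa%:C in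
  let b := pb%:C in
  complex.Re
    (s * ((b + s) * (a + s) - (s - b) * (s - a) * cexp (- (s * (4 * L)%:C)))
     / (((s - a) * cexp (- (s * (2 * L)%:C)) + s + a)
        * ((s - b) * cexp (- (s * (2 * L)%:C)) + s + b))).

Definition one_sided_parameters : set (R * R) :=
  [set q | 0 < q.1 /\ q.1 = q.2].

Definition two_sided_parameters : set (R * R) :=
  [set q | [/\ 0 < q.1, 0 < q.2 & q.1 <> q.2]].

(* F d q is the maximum over the frequencies of the convergence factor for the
   overlap d and the parameters q. Since the min-max value inf_q F d q tends to
   1 as d -> 0+, comparing values of F to leading order would be vacuous: it is
   the leading terms of 1 - F that are compared. The infimum need not be
   attained. *)
Definition asymptotically_optimized (A : set (R * R)) (F : R -> R * R -> R)
    (q : R -> R * R) : Prop :=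
  (\forall d \near 0^'+, A (q d)) /\
  (fun d : R => 1 - F d (q d)) ~_zero_right
  (fun d : R => 1 - inf [set F d q' | q' in A]).

End TwoSubdomains.

(* Main.v *)
Require Import Defs.
From mathcomp Require Import all_boot all_order all_algebra.
From mathcomp Require Import complex ring lra.
From mathcomp Require Import all_classical all_reals all_analysis.

Set Implicit Arguments.
Unset Strict Implicit.
Unset Printing Implicit Defensive.

Import Order.TTheory GRing.Theory Num.Theory.
Import numFieldNormedType.Exports.

Local Open Scope classical_set_scope.
Local Open Scope ring_scope.

(* Dividing out the Robin reflections [E = (lam - r) / (lam + r) e^(- 2 lam L)]
   turns the entries of the iteration matrix into Moebius factors: up to
   exponentials and corrections [1 + O(d)],
     rho^2 = e^(- 2 Re(lam) d) |(p - B) / (p + A)| |(q - A) / (q + B)|,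
   where [A], [B] are the Dirichlet-to-Neumann symbols of the two subdomains
   without the overlap, and [C] is the real part of their mean at frequency 0.

   Upper bound. With [m = Re(A + B) / 2], the first factor is
   [exp (- 2 p m / (p + m)^2)] up to admissible errors, so that [rho] is at most
   [exp (- (p m / (p + m)^2 + q m / (q + m)^2 + m d))]. This exponent is bounded
   below on [m >= C] by the arithmetic-geometric mean inequality in each of the
   ranges delimited by [p] and [q]. That [m >= C] means that [Re A] and [Re B]
   are smallest at frequency 0. As the product of the real and imaginary parts
   of [lam] does not depend on the frequency, this is the monotonicity of an
   explicit quotient along hyperbolas, whose derivative has as numerator a
   polynomial in the outer Robin parameter with nonnegative coefficients.

   Lower bound. For arbitrary parameters, [rho] is evaluated at frequency 0 and
   at the one or two frequencies where the optimal parameters equioscillate;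
   each factor is monotone in its parameter there, and one of these frequencies
   always gives a value at least [1 - t - O(t^2)].

   All quantities are rational in [t], the leading term of [1 - rho]:
   [d = t^3 / (16 C)], [p = 2 C / t] for one parameter and
   [d = t^5 / (16 C)], [p = 4 C / t^3], [q = C / t] for two. *)

(** * Monotonicity of a hyperbolic-trigonometric quotient *)

Section Calculus.
Context {R : realType}.
Implicit Types (f g : R -> R) (a b t x : R).

Definition cosh x : R := (expR x + expR (- x)) / 2.
Definition sinh x : R := (expR x - expR (- x)) / 2.

(** The rules are stated for explicit abstractions so that the tactic [der] can choose among them by
    the shape of the function body. *)
Lemma derD f g a b x : is_derive x 1 f a -> is_derive x 1 g b ->
  is_derive x 1 (fun t => f t + g t) (a + b).
Proof. by move=> df dg; exact: is_deriveD. Qed.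

Lemma derN f a x : is_derive x 1 f a -> is_derive x 1 (fun t => - f t) (- a).
Proof. by move=> df; exact: is_deriveN. Qed.

Lemma derM f g a b x : is_derive x 1 f a -> is_derive x 1 g b ->
  is_derive x 1 (fun t => f t * g t) (f x * b + g x * a).
Proof. by move=> df dg; exact: is_deriveM. Qed.

Lemma derX f a x n : is_derive x 1 f a ->
  is_derive x 1 (fun t => f t ^+ n) (n%:R * f x ^+ n.-1 * a).
Proof.
move=> df; have -> : (fun t => f t ^+ n) = f ^+ n.
  by apply/funext => t; rewrite !fctE.
exact: is_deriveX.
Qed.

Lemma derV f a x : f x != 0 -> is_derive x 1 f a ->
  is_derive x 1 (fun t => (f t)^-1) (- (f x) ^- 2 * a).
Proof. by move=> fx df; exact: is_deriveV. Qed.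

Lemma derE f a x : is_derive x 1 f a ->
  is_derive x 1 (fun t => expR (f t)) (expR (f x) * a).
Proof.
by move=> df; apply: (@is_derive1_comp _ expR f); exact: is_derive_expR.
Qed.

Lemma derCos f a x : is_derive x 1 f a ->
  is_derive x 1 (fun t => cos (f t)) (- sin (f x) * a).
Proof.
by move=> df; apply: (@is_derive1_comp _ cos f); exact: is_derive_cos.
Qed.

Lemma derSin f a x : is_derive x 1 f a ->
  is_derive x 1 (fun t => sin (f t)) (cos (f x) * a).
Proof.
by move=> df; apply: (@is_derive1_comp _ sin f); exact: is_derive_sin.
Qed.

Lemma derEq f a b x : is_derive x 1 f a -> a = b -> is_derive x 1 f b.
Proof. by move=> df <-. Qed.

Lemma derCosh f a x : is_derive x 1 f a ->
  is_derive x 1 (fun t => cosh (f t)) (sinh (f x) * a).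
Proof.
move=> df; rewrite /cosh; apply: is_derive_eq.
by rewrite /sinh /GRing.scale/=; ring.
Qed.

Lemma derSinh f a x : is_derive x 1 f a ->
  is_derive x 1 (fun t => sinh (f t)) (cosh (f x) * a).
Proof.
move=> df; rewrite /sinh; apply: is_derive_eq.
by rewrite /cosh /GRing.scale/=; ring.
Qed.

(** Mean value theorem. Most of the elementary inequalities below reduce through it to the sign of
    an explicit derivative and to the value at 0. *)
Lemma ge0_derive_le f (df : R -> R) a b : a <= b ->
  (forall x, a <= x <= b -> is_derive x 1 f (df x) /\ 0 <= df x) -> f a <= f b.
Proof.
move=> ab h; have dfE x (xab : a <= x <= b) := (h x xab).1.
have df0 x (xab : a <= x <= b) := (h x xab).2.
have [||c] := @MVT_segment R f df a b ab.
- by move=> x; rewrite in_itv/= => /andP[ax xb]; apply: dfE; rewrite !ltW.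
- apply: derivable_within_continuous => x; rewrite in_itv/= => xab.
  by case: (dfE x xab).
rewrite in_itv/= => cab fE; rewrite -subr_ge0 fE mulr_ge0 ?df0 ?subr_ge0//.
Qed.

End Calculus.

(** The derivative is synthesised from the syntax of the function; the announced value is compared
    with it only afterwards, in the equality left by [derive_to]. *)
Ltac der := lazymatch goal with
 | |- is_derive _ _ (fun t => t) _ => exact: is_derive_id
 | |- is_derive _ _ (fun t => @?f t + @?g t) _ =>
   notypeclasses refine (@derD _ f g _ _ _ _ _); der
 | |- is_derive _ _ (fun t => - @?f t) _ =>
   notypeclasses refine (@derN _ f _ _ _); der
 | |- is_derive _ _ (fun t => @?f t * @?g t) _ =>
   notypeclasses refine (@derM _ f g _ _ _ _ _); der
 | |- is_derive _ _ (fun t => @?f t ^+ _) _ =>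
   notypeclasses refine (@derX _ f _ _ _ _); der
 | |- is_derive _ _ (fun t => expR (@?f t)) _ =>
   notypeclasses refine (@derE _ f _ _ _); der
 | |- is_derive _ _ (fun t => cos (@?f t)) _ =>
   notypeclasses refine (@derCos _ f _ _ _); der
 | |- is_derive _ _ (fun t => sin (@?f t)) _ =>
   notypeclasses refine (@derSin _ f _ _ _); der
 | |- is_derive _ _ (fun t => cosh (@?f t)) _ =>
   notypeclasses refine (@derCosh _ f _ _ _); der
 | |- is_derive _ _ (fun t => sinh (@?f t)) _ =>
   notypeclasses refine (@derSinh _ f _ _ _); der
 | |- is_derive _ _ (fun t => ?c) _ => exact: (is_derive_cst c)
 end.

Ltac derive_to := notypeclasses refine (derEq _ _); [der|cbv beta; cbn [Nat.pred]].

(** * Taylor bounds for hyperbolic and circular functions *)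

Section Trig.
Context {R : realType}.
Implicit Types (a b t x : R).

Lemma cosh0 : cosh 0 = 1 :> R.
Proof. rewrite /cosh oppr0 expR0; lra. Qed.

Lemma sinh0 : sinh 0 = 0 :> R.
Proof. by rewrite /sinh oppr0 expR0 subrr mul0r. Qed.

Lemma cosh2D x : cosh x ^+ 2 = 1 + sinh x ^+ 2 :> R.
Proof.
rewrite /cosh /sinh; have := expRxMexpNx_1 x.
move: (expR x) (expR (- x)) => u v uv.
suff -> : ((u + v) / 2) ^+ 2 = u * v + ((u - v) / 2) ^+ 2 by rewrite uv.
by field.
Qed.

Lemma cosh_ge1 x : 1 <= cosh x :> R.
Proof. have := expR_ge1Dx x; have := expR_ge1Dx (- x); rewrite /cosh; lra. Qed.

(** The Taylor bounds follow one another by integration: [cosh >= 1] gives this one, which gives the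
    next one for [cosh], and so on; likewise for [sin] and [cos]. *)
Lemma sinh_ge x : 0 <= x -> x <= sinh x :> R.
Proof.
move=> x0.
have := @ge0_derive_le R (fun t => sinh t - t) (fun t => cosh t - 1) 0 x x0.
rewrite sinh0 subrr subr_ge0; apply => t _; split; first by derive_to; field.
by rewrite subr_ge0 cosh_ge1.
Qed.

Lemma sinh_le_cosh x : sinh x <= cosh x :> R.
Proof. rewrite /cosh /sinh; have := expR_gt0 (- x); lra. Qed.

Lemma cosh_ge x : 0 <= x -> 1 + x ^+ 2 / 2 <= cosh x :> R.
Proof.
move=> x0.
have := @ge0_derive_le R (fun t => cosh t - t ^+ 2 * 2^-1) (fun t => sinh t - t) 0 x x0.
rewrite cosh0 expr0n/= mul0r subr0 => h; suff: 1 <= cosh x - x ^+ 2 / 2 by lra.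
apply: h => t /andP[t0 _]; split; last by rewrite subr_ge0 sinh_ge.
by derive_to; field.
Qed.

Lemma sinh_ge3 x : 0 <= x -> x + x ^+ 3 / 6 <= sinh x :> R.
Proof.
move=> x0.
have := @ge0_derive_le R (fun t => sinh t - t - t ^+ 3 * 6^-1)
  (fun t => cosh t - 1 - t ^+ 2 / 2) 0 x x0.
rewrite sinh0 expr0n/= mul0r !subr0 => h.
suff: 0 <= sinh x - x - x ^+ 3 / 6 by lra.
apply: h => t /andP[t0 _]; split; last by have := cosh_ge t0; lra.
by derive_to; field.
Qed.

Lemma sin_le x : 0 <= x -> sin x <= x :> R.
Proof.
move=> x0.
have := @ge0_derive_le R (fun t => t - sin t) (fun t => 1 - cos t) 0 x x0.
rewrite sin0 subrr subr_ge0; apply => t _; split; first by derive_to; field.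
by rewrite subr_ge0 cos_le1.
Qed.

Lemma cos_ge x : 0 <= x -> 1 - x ^+ 2 / 2 <= cos x :> R.
Proof.
move=> x0.
have := @ge0_derive_le R (fun t => cos t + t ^+ 2 * 2^-1) (fun t => t - sin t) 0 x x0.
rewrite cos0 expr0n/= mul0r addr0 => h.
suff: 1 <= cos x + x ^+ 2 / 2 by lra.
apply: h => t /andP[t0 _]; split; last by rewrite subr_ge0 sin_le.
by derive_to; field.
Qed.

Lemma sin_ge3 x : 0 <= x -> x - x ^+ 3 / 6 <= sin x :> R.
Proof.
move=> x0.
have := @ge0_derive_le R (fun t => sin t - t + t ^+ 3 * 6^-1)
  (fun t => cos t - 1 + t ^+ 2 / 2) 0 x x0.
rewrite sin0 expr0n/= mul0r !(subr0, addr0) => h.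
suff: 0 <= sin x - x + x ^+ 3 / 6 by lra.
apply: h => t /andP[t0 _]; split; last by have := cos_ge t0; lra.
by derive_to; field.
Qed.

(** Duplication of [cos (3 / 4) >= 23 / 32] shows that [cos (3 / 2)] is positive, while [cos]
    decreases to 0 at [pi / 2]. *)
Lemma pi_gt3 : 3 < pi :> R.
Proof.
have h : 0 < cos (3 / 2) :> R.
  have -> : 3 / 2 = 3 / 4 + 3 / 4 :> R by lra.
  have h1 := @cos_ge (3 / 4); have h2 := cos2Dsin2 (3 / 4 : R).
  rewrite cosD; have {}h1 : 1 - (3 / 4) ^+ 2 / 2 <= cos (3 / 4) :> R by apply: h1; lra.
  nra.
rewrite ltNge; apply/negP => pi3.
have : cos (3 / 2) <= cos (pi / 2) :> R.
  have := @pi_ge2 R => pi2.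
  rewrite leNgt ltr_cos ?in_itv/= -?leNgt; lra.
rewrite cos_pihalf; lra.
Qed.

Lemma sin_xcos x : 0 <= x <= pi -> x * cos x <= sin x :> R.
Proof.
move=> /andP[x0 xpi].
have := @ge0_derive_le R (fun t => sin t - t * cos t) (fun t => t * sin t) 0 x x0.
rewrite sin0 mul0r subrr subr_ge0; apply => t /andP[t0 tx]; split.
  by derive_to; field.
by rewrite mulr_ge0// sin_ge0_pi// t0 (le_trans tx).
Qed.

Lemma cos_le_sin x : 0 <= x <= pi -> x * sin x / 2 <= 1 - cos x :> R.
Proof.
move=> /andP[x0 xpi].
have := @ge0_derive_le R (fun t => 1 - cos t - t * sin t * 2^-1)
   (fun t => (sin t - t * cos t) / 2) 0 x x0.
rewrite cos0 mul0r mul0r !subrr => h.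
suff: 0 <= 1 - cos x - x * sin x / 2 by lra.
apply: h => t /andP[t0 tx]; split; first by derive_to; field.
by rewrite divr_ge0// subr_ge0 sin_xcos// t0 (le_trans tx).
Qed.

Lemma sinh_ge_cosh x : 0 <= x -> cosh x - 1 + x ^+ 2 / 2 <= x * sinh x :> R.
Proof.
move=> x0.
have := @ge0_derive_le R (fun t => t * sinh t - cosh t - t ^+ 2 * 2^-1)
   (fun t => t * (cosh t - 1)) 0 x x0.
rewrite cosh0 !mul0r expr0n/= mul0r => h.
suff: -1 <= x * sinh x - cosh x - x ^+ 2 / 2 by lra.
rewrite sub0r subr0 in h; apply: h => t /andP[t0 tx]; split.
  by derive_to; field.
by rewrite mulr_ge0// subr_ge0 cosh_ge1.
Qed.

(** Modulo [cosh ^ 2 - sinh ^ 2 = 1], the derivative of the difference is visibly nonnegative. The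
    inequality serves for the coefficient of [p ^ 2] in the monotonicity polynomial. *)
Lemma sinh_cosh_ineq x : 0 <= x ->
  2 * (cosh x + 1) * (sinh x - x) <= 5 * sinh x * (cosh x - 1) :> R.
Proof.
move=> x0.
have := @ge0_derive_le R
  (fun t => 5 * sinh t * (cosh t - 1) - 2 * (cosh t + 1) * (sinh t - t))
  (fun t => (6 * cosh t + 1) * (cosh t - 1) + 2 * t * sinh t) 0 x x0.
rewrite cosh0 sinh0 !mulr0 mul0r !subr0 mulr0 subr0 => h.
rewrite -subr_ge0; apply: h => t /andP[t0 tx]; split.
  derive_to.
  have := cosh2D t; move: (cosh t) (sinh t) => c s cs.
  transitivity (3 * c ^+ 2 + 3 * s ^+ 2 - 5 * c + 2 + 2 * t * s); first by ring.
  have -> : s ^+ 2 = c ^+ 2 - 1 by rewrite cs; ring.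
  by ring.
have := cosh_ge1 t; have := sinh_ge t0; move: (cosh t) (sinh t) => c s sc c1.
by apply: addr_ge0; apply: mulr_ge0; lra.
Qed.

End Trig.

(** * Joint inequalities for [0 <= b <= a] *)

Section TrigInequalities.
Context {R : realType}.
Implicit Types (a b t x : R).

Lemma cosh_ge4 x : 0 <= x -> 1 + x ^+ 2 / 2 + x ^+ 4 / 24 <= cosh x :> R.
Proof.
move=> x0.
have := @ge0_derive_le R (fun t => cosh t - t ^+ 2 * 2^-1 - t ^+ 4 * 24^-1)
  (fun t => sinh t - t - t ^+ 3 / 6) 0 x x0.
rewrite cosh0 !expr0n/= !mul0r !subr0 => h.
suff: 1 <= cosh x - x ^+ 2 / 2 - x ^+ 4 / 24 by lra.
apply: h => t /andP[t0 _]; split; last by have := sinh_ge3 t0; lra.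
by derive_to; field.
Qed.

Lemma cos_le4 x : 0 <= x -> cos x <= 1 - x ^+ 2 / 2 + x ^+ 4 / 24 :> R.
Proof.
move=> x0.
have := @ge0_derive_le R (fun t => t ^+ 4 * 24^-1 - t ^+ 2 * 2^-1 - cos t)
  (fun t => sin t - t + t ^+ 3 / 6) 0 x x0.
rewrite cos0 !expr0n/= !mul0r !sub0r => h.
suff: - 0 - 1 <= x ^+ 4 / 24 - x ^+ 2 / 2 - cos x by lra.
apply: h => t /andP[t0 _]; split; last by have := sin_ge3 t0; lra.
by derive_to; field.
Qed.

Lemma sinh_ge5 x : 0 <= x -> x + x ^+ 3 / 6 + x ^+ 5 / 120 <= sinh x :> R.
Proof.
move=> x0.
have := @ge0_derive_le R (fun t => sinh t - t - t ^+ 3 * 6^-1 - t ^+ 5 * 120^-1)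
  (fun t => cosh t - 1 - t ^+ 2 / 2 - t ^+ 4 / 24) 0 x x0.
rewrite sinh0 !expr0n/= !mul0r !subr0 => h.
suff: 0 <= sinh x - x - x ^+ 3 / 6 - x ^+ 5 / 120 by lra.
apply: h => t /andP[t0 _]; split; last by have := cosh_ge4 t0; lra.
by derive_to; field.
Qed.

(** The factor [31 / 10] is below [1 + 9 / 6 + 81 / 120], the fifth-order Taylor bound of
    [sinh a / a] at [a = 3]. It serves the case [b > pi], in which [sin b] may be negative. *)
Lemma sinh_ge_31 a : 3 <= a -> (31 / 10) * a <= sinh a :> R.
Proof.
move=> a3; have a0 : 0 <= a by lra.
apply: le_trans (sinh_ge5 a0).
have h : 9 <= a ^+ 2 by nra.
have -> : a + a ^+ 3 / 6 + a ^+ 5 / 120 = a * (1 + a ^+ 2 / 6 + (a ^+ 2) ^+ 2 / 120) by field.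
rewrite mulrC ler_wpM2l//; nra.
Qed.

Lemma cosh_le_sinhD1 x : 0 <= x -> cosh x <= sinh x + 1 :> R.
Proof.
move=> x0; have : expR (- x) <= 1 by rewrite expR_le1 oppr_le0.
rewrite /cosh /sinh; lra.
Qed.

Lemma exp4_le a b : 0 <= b -> b <= a -> b ^+ 4 <= a ^+ 4.
Proof. by move=> b0 ba; rewrite lerXn2r// nnegrE (le_trans b0). Qed.

(** The quartic term [a ^ 4 / 6] of the first summand absorbs the quartic loss [b ^ 4 / 6] of the
    second. *)
Lemma sinhDsin_ge a b : 0 <= b -> b <= a ->
  a ^+ 2 + b ^+ 2 <= a * sinh a + b * sin b.
Proof.
move=> b0 ba; have a0 := le_trans b0 ba; have b4 := exp4_le b0 ba.
have h1 : a * (a + a ^+ 3 / 6) <= a * sinh a by rewrite ler_wpM2l// sinh_ge3.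
have h2 : b * (b - b ^+ 3 / 6) <= b * sin b by rewrite ler_wpM2l// sin_ge3.
lra.
Qed.

Lemma coshDcos_ge2 a b : 0 <= b -> b <= a -> 2 <= cosh a + cos b.
Proof.
move=> b0 ba; have a0 := le_trans b0 ba.
have : b ^+ 2 <= a ^+ 2 by rewrite lerXn2r.
have := cosh_ge a0; have := cos_ge b0; lra.
Qed.

Lemma coshBcos_ge a b : 0 <= b -> b <= a ->
  (a ^+ 2 + b ^+ 2) / 2 <= cosh a - cos b.
Proof.
move=> b0 ba; have a0 := le_trans b0 ba; have b4 := exp4_le b0 ba.
have := cosh_ge4 a0; have := cos_le4 b0; lra.
Qed.

(** The values of the functions are kept as independent variables, so that the coefficient lemmas
    become polynomial inequalities within reach of linear arithmetic. The last field is the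
    dichotomy between a nonnegative sine and a large [a]. *)
Record trig_bounds (a b ch sh cn sn : R) : Prop := TrigBounds {
  tb_b0 : 0 <= b; tb_ba : b <= a; tb_a0 : 0 <= a; tb_b2a2 : b ^+ 2 <= a ^+ 2;
  tb_b4a4 : b ^+ 4 <= a ^+ 4;
  tb_ch1 : 1 <= ch; tb_sha : a <= sh; tb_sh3 : a + a ^+ 3 / 6 <= sh;
  tb_shch : sh <= ch; tb_chsh : ch <= sh + 1;
  tb_shch5 : 2 * (ch + 1) * (sh - a) <= 5 * sh * (ch - 1);
  tb_cn1 : cn <= 1; tb_cnN1 : -1 <= cn; tb_sn1 : sn <= 1; tb_snN1 : -1 <= sn;
  tb_snb : sn <= b; tb_sn3 : b - b ^+ 3 / 6 <= sn;
  tb_g12 : 2 <= ch + cn; tb_g2D : a ^+ 2 + b ^+ 2 <= a * sh + b * sn;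
  tb_g3D : (a ^+ 2 + b ^+ 2) / 2 <= ch - cn;
  tb_sn_case : 0 <= sn \/ 3 <= a /\ 31 / 10 * a <= sh }.

Lemma trig_boundsP a b : 0 <= b -> b <= a ->
  trig_bounds a b (cosh a) (sinh a) (cos b) (sin b).
Proof.
move=> b0 ba; have a0 := le_trans b0 ba; split=> //; first
  [ by rewrite lerXn2r | exact: exp4_le | exact: cosh_ge1 | exact: sinh_ge
  | exact: sinh_ge3 | exact: sinh_le_cosh | exact: cosh_le_sinhD1
  | exact: sinh_cosh_ineq | exact: cos_le1 | exact: cos_geN1 | exact: sin_le1
  | exact: sin_geN1 | exact: sin_le | exact: sin_ge3 | exact: coshDcos_ge2
  | exact: sinhDsin_ge | exact: coshBcos_ge | idtac ].
have [bpi|bpi] := leP b pi; first by left; rewrite sin_ge0_pi// b0.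
have a3 : 3 <= a by have := @pi_gt3 R; lra.
by right; split => //; exact: sinh_ge_31.
Qed.

(** * Coefficients of the monotonicity polynomial *)

Section Fixed.
Variables a b ch sh cn sn : R.
Hypothesis tb : trig_bounds a b ch sh cn sn.
Local Notation D := (a ^+ 2 + b ^+ 2).
Local Notation E := (a ^+ 2 - b ^+ 2).

(** [monotone_coef0] to [monotone_coef4] concern, up to nonnegative factors, the coefficients of
    [1, p, ..., p ^ 4] in the polynomial of [robin_wronskian_ge0], where [p] is the rescaled outer
    Robin parameter. *)
Lemma monotone_coef0 : 0 <= (ch + cn) * (a * sh + b * sn) + D * (1 + ch * cn).
Proof.
case: tb => b0 ba a0 b2a2 b4a4 ch1 sha sh3 shch chsh shch5 cn1 cnN1 sn1 snN1 snb sn3 g12 g2D g3D sn_case.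
have D0 : 0 <= D by rewrite addr_ge0 ?sqr_ge0.
have E0 : 0 <= E by rewrite subr_ge0.
have sh0 : 0 <= sh by lra.
have h2 : 0 <= ch + cn by lra.
have : (ch + cn) * D <= (ch + cn) * (a * sh + b * sn) by rewrite ler_wpM2l.
have : 0 <= D * ((ch + 1) * (1 + cn)) by rewrite !mulr_ge0//; lra.
lra.
Qed.

Lemma monotone_coef1 :
  0 <= D * (a * sh * cn + b * ch * sn) + 2 * (a * sh + b * sn) ^+ 2.
Proof.
case: tb => b0 ba a0 b2a2 b4a4 ch1 sha sh3 shch chsh shch5 cn1 cnN1 sn1 snN1 snb sn3 g12 g2D g3D sn_case.
have D0 : 0 <= D by rewrite addr_ge0 ?sqr_ge0.
have E0 : 0 <= E by rewrite subr_ge0.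
have sh0 : 0 <= sh by lra.
case: sn_case => [sn0|[a3 sh31]].
  have : D * (a * sh + b * sn) <= (a * sh + b * sn) ^+ 2.
    by rewrite expr2 ler_wpM2r//; lra.
  have : 0 <= D * (a * sh * (2 + cn) + b * sn * (2 + ch)).
    by rewrite mulr_ge0// addr_ge0// !mulr_ge0//; lra.
  lra.
(* The sine may be negative here and is bounded below by -1; the growth of [sh] makes the square
   dominate. *)
have bsn : 0 <= b * (sn + 1) by rewrite mulr_ge0//; lra.
have h1 : a * (sh - 1) <= a * sh + b * sn by lra.
have h2 : (a * (sh - 1)) ^+ 2 <= (a * sh + b * sn) ^+ 2.
  rewrite lerXn2r// nnegrE ?mulr_ge0//; first lra.
  by apply: le_trans g2D.
have h3 : - (a * (sh + ch)) <= a * sh * cn + b * ch * sn.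
  have : - (a * sh) <= a * sh * cn by rewrite -mulrN1 ler_wpM2l// mulr_ge0.
  have : - (b * ch) <= b * ch * sn by rewrite -mulrN1 ler_wpM2l// mulr_ge0//; lra.
  have : b * ch <= a * ch by rewrite ler_wpM2r//; lra.
  lra.
have h4 : D * - (a * (sh + ch)) <= D * (a * sh * cn + b * ch * sn) by rewrite ler_wpM2l.
have h5 : D * (a * (sh + ch)) <= 2 * a ^+ 2 * (a * (sh + ch)).
  by rewrite ler_wpM2r ?mulr_ge0//; lra.
have h6 : 0 <= a ^+ 2 * ((sh - 1) ^+ 2 - a * (sh + ch)).
  rewrite mulr_ge0 ?sqr_ge0//.
  (* [10 / 31] inverts the bound [sh >= 31 / 10 * a], which together with [a >= 3] also gives
     [sh >= 93 / 10]. *)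
  have : a * (sh + ch) <= (10 / 31 * sh) * (2 * sh + 1) by rewrite ler_pM//; lra.
  have : 0 <= sh * (sh - 93 / 10) by rewrite mulr_ge0//; lra.
  lra.
lra.
Qed.

Lemma monotone_coef2 :
  0 <= 5 * D * (a * sh + b * sn) * (ch - cn) + 4 * D * a * b * sh * sn - 2 * D * E
       + 2 * E * (ch + cn) * (a * sh + b * sn) - D * (ch + cn) * (a * sh - b * sn).
Proof.
case: tb => b0 ba a0 b2a2 b4a4 ch1 sha sh3 shch chsh shch5 cn1 cnN1 sn1 snN1 snb sn3 g12 g2D g3D sn_case.
have D0 : 0 <= D by rewrite addr_ge0 ?sqr_ge0.
have E0 : 0 <= E by rewrite subr_ge0.
have sh0 : 0 <= sh by lra.
(* [v] is [a * sh - b * sn] without its leading term [E]; the remainder is of fourth order, which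
   [vle] compares with [sh - a]. *)
set v := a * sh - b * sn - E.
have vle : v <= 2 * a * (sh - a).
  have h1 : a * (a + a ^+ 3 / 6) <= a * sh by rewrite ler_wpM2l.
  have h2 : b * (b - b ^+ 3 / 6) <= b * sn by rewrite ler_wpM2l.
  have := exp4_le b0 ba; rewrite /v; nra.
have gv : (ch + cn) * v <= 2 * a * ((ch + 1) * (sh - a)).
  apply: (@le_trans _ _ ((ch + cn) * (2 * a * (sh - a)))).
    by rewrite ler_wpM2l//; lra.
  have : 0 <= (1 - cn) * (a * (sh - a)) by rewrite !mulr_ge0//; lra.
  lra.
(* The terms left over after [main] is multiplied by [D] are [D * E * (ch + cn - 2)] and [2 * E *
   (ch + cn) * (a * sh + b * sn - D)], both nonnegative. *)
suff main : (ch + cn) * v <= 5 * (a * sh + b * sn) * (ch - cn) + 4 * a * b * sh * sn.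
  have k1 : D * ((ch + cn) * v) <= D * (5 * (a * sh + b * sn) * (ch - cn) + 4 * a * b * sh * sn).
    by rewrite ler_wpM2l.
  have k2 : 0 <= D * E * (ch + cn - 2) by rewrite !mulr_ge0//; lra.
  have k3 : 0 <= E * (ch + cn) * (a * sh + b * sn - D) by rewrite !mulr_ge0//; lra.
  move: k1; rewrite /v; lra.
apply: (le_trans gv).
case: sn_case => [sn0|[a3 sh31]].
  have k1 : 0 <= a * (5 * sh * (ch - 1) - 2 * (ch + 1) * (sh - a)).
    by rewrite mulr_ge0// subr_ge0.
  have k2 : a * sh * (ch - 1) <= (a * sh + b * sn) * (ch - cn).
    rewrite ler_pM ?mulr_ge0//; try lra.
    by rewrite lerDl mulr_ge0.
  have k3 : 0 <= a * b * sh * sn by rewrite !mulr_ge0.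
  lra.
have bsn : 0 <= b * (sn + 1) by rewrite mulr_ge0//; lra.
have k1 : a * (sh - 1) * (ch - 1) <= (a * sh + b * sn) * (ch - cn).
  by rewrite ler_pM ?mulr_ge0//; lra.
have k2 : - (a * a * sh) <= a * b * sh * sn.
  have : 0 <= a * sh * (b * (sn + 1)) by rewrite !mulr_ge0//; lra.
  have : 0 <= a * sh * (a - b) by rewrite !mulr_ge0//; lra.
  lra.
have k3 : 0 <= a * (5 * (sh - 1) * (ch - 1) - 4 * a * sh - 2 * (ch + 1) * (sh - a)).
  rewrite mulr_ge0//.
  have : a * sh <= (10 / 31 * sh) * ch by rewrite ler_pM//; lra.
  have : 0 <= a * (ch + 1) by rewrite mulr_ge0//; lra.
  have : 0 <= ch * (sh - 93 / 10) by rewrite mulr_ge0//; lra.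
  lra.
lra.
Qed.

Lemma monotone_coef3_large : 3 <= a -> 31 / 10 * a <= sh ->
  0 <= D * (ch - cn) ^+ 2 + E * (ch + cn) * (ch - cn) - D * (a * sh * cn - b * ch * sn).
Proof.
case: tb => b0 ba a0 b2a2 b4a4 ch1 sha sh3 shch chsh shch5 cn1 cnN1 sn1 snN1 snb sn3 g12 g2D g3D sn_case.
have D0 : 0 <= D by rewrite addr_ge0 ?sqr_ge0.
have E0 : 0 <= E by rewrite subr_ge0.
have sh0 : 0 <= sh by lra.
move=> a3 sh31.
have k1 : a * sh * cn - b * ch * sn <= a * (sh + ch).
  have : 0 <= a * sh * (1 - cn) by rewrite !mulr_ge0//; lra.
  have : 0 <= b * ch * (1 + sn) by rewrite !mulr_ge0//; lra.
  have : 0 <= (a - b) * ch by rewrite !mulr_ge0//; lra.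
  lra.
have k2 : a * (sh + ch) <= (ch - cn) ^+ 2.
  have k3 : (ch - 1) ^+ 2 <= (ch - cn) ^+ 2 by rewrite lerXn2r// ?nnegrE; lra.
  have : a * (sh + ch) <= (10 / 31 * ch) * (2 * ch) by rewrite ler_pM//; lra.
  have : 0 <= ch * (ch - 93 / 10) by rewrite mulr_ge0//; lra.
  lra.
have : 0 <= D * ((ch - cn) ^+ 2 - (a * sh * cn - b * ch * sn)).
  by rewrite mulr_ge0//; lra.
have : 0 <= E * (ch + cn) * (ch - cn) by rewrite !mulr_ge0//; lra.
lra.
Qed.

Lemma monotone_coef4_large : 3 <= a -> 31 / 10 * a <= sh ->
  0 <= (a * sh - b * sn) * (ch - cn) + D * (1 - ch * cn).
Proof.
case: tb => b0 ba a0 b2a2 b4a4 ch1 sha sh3 shch chsh shch5 cn1 cnN1 sn1 snN1 snb sn3 g12 g2D g3D sn_case.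
have D0 : 0 <= D by rewrite addr_ge0 ?sqr_ge0.
have E0 : 0 <= E by rewrite subr_ge0.
have sh0 : 0 <= sh by lra.
move=> a3 sh31.
have k1 : a * (sh - 1) * (ch - 1) <= (a * sh - b * sn) * (ch - cn).
  have : 0 <= b * (1 - sn) by rewrite mulr_ge0//; lra.
  by move=> ?; rewrite ler_pM ?mulr_ge0//; lra.
have k2 : 0 <= D * ch * (1 - cn) by rewrite !mulr_ge0//; lra.
have k3 : 0 <= (2 * a ^+ 2 - D) * (ch - 1) by rewrite !mulr_ge0//; lra.
have k4 : 0 <= a * (ch - 1) * (sh - 1 - 2 * a) by rewrite !mulr_ge0//; lra.
lra.
Qed.

End Fixed.

(** [(cosh a - 1 / 2) * cos b] is bounded by means of [cos b <= 1 - b * sin b / 2], and [a * sinh a]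
    compensates for the rest. This gives the sign of the derivative in [sinhcos_le3]. *)
Lemma cosh_mulcos_le a b : 0 <= b -> b <= a -> b <= pi ->
  cosh a * cos b <= (cosh a + cos b + a * sinh a - b * sin b) / 2.
Proof.
move=> b0 ba bpi.
have [_ _ a0 b2a2 _ ch1 _ _ _ _ _ _ _ _ _ snb _ _ _ _ _] := trig_boundsP b0 ba.
have sn0 : 0 <= sin b by rewrite sin_ge0_pi// b0.
have h1 : b * sin b / 2 <= 1 - cos b by rewrite cos_le_sin// b0.
have h2 := sinh_ge_cosh a0.
move: snb sn0 h1 h2 ch1; move: (cosh a) (sinh a) (cos b) (sin b) => ch sh cn sn.
move=> snb sn0 h1 h2 ch1.
have k1 : 0 <= (ch - 2^-1) * (1 - b * sn / 2 - cn) by rewrite mulr_ge0//; lra.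
have k2 : 0 <= b * sn by rewrite mulr_ge0.
have k3 : 0 <= b * (b - sn) by rewrite mulr_ge0// subr_ge0.
have k4 : 0 <= (ch - 1) * (b * sn) by rewrite mulr_ge0// subr_ge0.
lra.
Qed.

Lemma sinhcos_le3 a b : 0 <= b -> b <= a -> b <= pi ->
  a * sinh a * cos b - b * cosh a * sin b <=
  (a ^+ 2 + b ^+ 2) ^+ 2 / 4 + (a ^+ 2 - b ^+ 2) * (cosh a + cos b) / 2.
Proof.
move=> b0 ba bpi; have a0 := le_trans b0 ba.
have b2a2 : b ^+ 2 <= a ^+ 2 by rewrite lerXn2r.
set D := a ^+ 2 + b ^+ 2; set E := a ^+ 2 - b ^+ 2.
(* [F t] is the difference of both sides at [(a * t, b * t)] divided by [t]: it vanishes at 0 and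
   increases on [[0, 1]]. The same device is used in [sinhcos_le4] and [monotone_coef4]. *)
pose F (t : R) := t * (D ^+ 2 * t ^+ 2 * 4^-1 + E * (cosh (a * t) + cos (b * t)) * 2^-1)
    - (a * sinh (a * t) * cos (b * t) - b * cosh (a * t) * sin (b * t)).
have F0 : F 0 = 0 by rewrite /F !mulr0 cosh0 sinh0 cos0 sin0; ring.
have F1 : F 1 = D ^+ 2 / 4 + E * (cosh a + cos b) / 2 - (a * sinh a * cos b - b * cosh a * sin b) by rewrite /F !mulr1; field.
rewrite -subr_ge0 -F1 -F0.
apply: (@ge0_derive_le R F
  (fun t => 3 * D ^+ 2 * t ^+ 2 / 4 + 2 * a * b * sinh (a * t) * sin (b * t)
    + E * ((cosh (a * t) + cos (b * t) + (a * t) * sinh (a * t) - (b * t) * sin (b * t)) / 2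
           - cosh (a * t) * cos (b * t))) 0 1 ler01) => t /andP[t0 t1]; split.
  by rewrite /F; derive_to; rewrite /D /E; field.
have bt : b * t <= pi by nra.
have h1 : 0 <= sin (b * t) by rewrite sin_ge0_pi// mulr_ge0.
have h2 : 0 <= sinh (a * t) by apply: le_trans (sinh_ge _); rewrite mulr_ge0.
apply: addr_ge0.
  have : 0 <= D ^+ 2 * t ^+ 2 by rewrite mulr_ge0 ?sqr_ge0.
  have : 0 <= a * b * sinh (a * t) * sin (b * t) by do 3!rewrite mulr_ge0//.
  lra.
rewrite mulr_ge0// ?subr_ge0//.
by apply: cosh_mulcos_le => //; [rewrite mulr_ge0|rewrite ler_wpM2r].
Qed.

(** For [b <= pi], the bound [cosh a - cos b >= (a ^ 2 + b ^ 2) / 2] makes the first two terms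
    dominate the estimate of the third by [sinhcos_le3]. Beyond [pi] crude bounds suffice. *)
Lemma monotone_coef3 a b : 0 <= b -> b <= a ->
  0 <= (a ^+ 2 + b ^+ 2) * (cosh a - cos b) ^+ 2
     + (a ^+ 2 - b ^+ 2) * (cosh a + cos b) * (cosh a - cos b)
     - (a ^+ 2 + b ^+ 2) * (a * sinh a * cos b - b * cosh a * sin b).
Proof.
move=> b0 ba; have tb := trig_boundsP b0 ba.
have [bpi|bpi] := leP b pi; last first.
  have a3 : 3 <= a by have := @pi_gt3 R; lra.
  exact: (monotone_coef3_large tb a3 (sinh_ge_31 a3)).
have h := sinhcos_le3 b0 ba bpi.
case: tb h => _ _ a0 b2a2 _ ch1 _ _ _ _ _ _ _ _ _ _ _ g12 _ g3D _.
move: (cosh a) (sinh a) (cos b) (sin b) g12 g3D => ch sh cn sn g12 g3D h.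
set D := a ^+ 2 + b ^+ 2 in h g3D *; set E := a ^+ 2 - b ^+ 2 in h *.
have D0 : 0 <= D by rewrite addr_ge0 ?sqr_ge0.
have E0 : 0 <= E by rewrite subr_ge0.
have k1 : (D / 2) ^+ 2 <= (ch - cn) ^+ 2 by rewrite lerXn2r// nnegrE; lra.
have k2 : 0 <= D * ((ch - cn) ^+ 2 - D ^+ 2 / 4) by rewrite mulr_ge0//; lra.
have k3 : 0 <= E * (ch + cn) * (ch - cn - D / 2) by rewrite !mulr_ge0//; lra.
have k4 : 0 <= D * (D ^+ 2 / 4 + E * (ch + cn) / 2 - (a * sh * cn - b * ch * sn)).
  by rewrite mulr_ge0// subr_ge0.
lra.
Qed.

Lemma sinhcos_le4 a b : 0 <= b -> b <= a -> b <= pi ->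
  a * sinh a * cos b - b * cosh a * sin b <= a ^+ 2 * cosh a - b ^+ 2 * cos b.
Proof.
move=> b0 ba bpi; have a0 := le_trans b0 ba.
have b2a2 : b ^+ 2 <= a ^+ 2 by rewrite lerXn2r.
pose F (t : R) := t * (a ^+ 2 * cosh (a * t) - b ^+ 2 * cos (b * t))
    - (a * sinh (a * t) * cos (b * t) - b * cosh (a * t) * sin (b * t)).
have F0 : F 0 = 0 by rewrite /F !mulr0 cosh0 sinh0 cos0 sin0; ring.
have F1 : F 1 = a ^+ 2 * cosh a - b ^+ 2 * cos b - (a * sinh a * cos b - b * cosh a * sin b) by rewrite /F !mulr1; field.
rewrite -subr_ge0 -F1 -F0.
apply: (@ge0_derive_le R F
  (fun t => a ^+ 2 * cosh (a * t) * (1 - cos (b * t))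
    + b ^+ 2 * cos (b * t) * (cosh (a * t) - 1)
    + 2 * a * b * sinh (a * t) * sin (b * t)
    + t * (a ^+ 3 * sinh (a * t) + b ^+ 3 * sin (b * t))) 0 1 ler01) => t /andP[t0 t1]; split.
  by rewrite /F; derive_to; field.
have bt : b * t <= pi by nra.
have h1 : 0 <= sin (b * t) by rewrite sin_ge0_pi// mulr_ge0.
have h2 : 0 <= sinh (a * t) by apply: le_trans (sinh_ge _); rewrite mulr_ge0.
have h3 := cosh_ge1 (a * t); have h4 := cos_le1 (b * t); have h5 := cos_geN1 (b * t).
move: h1 h2 h3 h4 h5; move: (cosh _) (sinh _) (cos _) (sin _) => ch sh cn sn.
move=> sn0 sh0 ch1 cn1 cnN1.
have k0 : 0 <= t * (a ^+ 3 * sh + b ^+ 3 * sn).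
  by rewrite mulr_ge0// addr_ge0// mulr_ge0// exprn_ge0.
have k3 : 0 <= a * b * sh * sn by rewrite !mulr_ge0.
have k1 : 0 <= (a ^+ 2 - b ^+ 2) * (ch * (1 - cn)) by rewrite !mulr_ge0//; lra.
have k2 : 0 <= b ^+ 2 * (ch - cn) by rewrite mulr_ge0 ?sqr_ge0//; lra.
lra.
Qed.

Lemma monotone_coef4 a b : 0 <= b -> b <= a ->
  0 <= (a * sinh a - b * sin b) * (cosh a - cos b)
     + (a ^+ 2 + b ^+ 2) * (1 - cosh a * cos b).
Proof.
move=> b0 ba; have tb := trig_boundsP b0 ba.
have [bpi|bpi] := leP b pi; last first.
  have a3 : 3 <= a by have := @pi_gt3 R; lra.
  exact: (monotone_coef4_large tb a3 (sinh_ge_31 a3)).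
have [_ _ a0 b2a2 _ _ _ _ _ _ _ _ _ _ _ _ _ _ _ _ _] := tb.
set D := a ^+ 2 + b ^+ 2.
pose F (t : R) := (a * sinh (a * t) - b * sin (b * t)) * (cosh (a * t) - cos (b * t))
    + D * t * (1 - cosh (a * t) * cos (b * t)).
have F0 : F 0 = 0 by rewrite /F !mulr0 cosh0 sinh0 cos0 sin0; ring.
have F1 : F 1 = (a * sinh a - b * sin b) * (cosh a - cos b) + D * (1 - cosh a * cos b) by rewrite /F !mulr1; field.
rewrite -F1 -F0.
apply: (@ge0_derive_le R F
  (fun t => 2 * (cosh (a * t) - cos (b * t))
       * (a ^+ 2 * cosh (a * t) - b ^+ 2 * cos (b * t))
    - D * t * (a * sinh (a * t) * cos (b * t) - b * cosh (a * t) * sin (b * t))) 0 1 ler01) => t /andP[t0 t1]; split.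
  rewrite /F; derive_to; rewrite /D.
  have := cosh2D (a * t); have := cos2Dsin2 (b * t).
  move: (cosh _) (sinh _) (cos _) (sin _) => ch sh cn sn h1 h2.
  transitivity (2 * (ch - cn) * (a ^+ 2 * ch - b ^+ 2 * cn)
    - D * t * (a * sh * cn - b * ch * sn)
    + a ^+ 2 * (1 + sh ^+ 2 - ch ^+ 2) + b ^+ 2 * (1 - (cn ^+ 2 + sn ^+ 2))).
    by rewrite /D; field.
  by rewrite h1 h2 /D; field.
have bt0 : 0 <= b * t by rewrite mulr_ge0.
have bta : b * t <= a * t by rewrite ler_wpM2r.
have bt : b * t <= pi by nra.
have := coshBcos_ge bt0 bta; have := sinhcos_le4 bt0 bta bt.
have := cosh_ge1 (a * t); have := cos_le1 (b * t).
move: (cosh _) (sinh _) (cos _) (sin _) => ch sh cn sn cn1 ch1 h1 h2.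
have m0 : 0 <= a ^+ 2 * ch - b ^+ 2 * cn.
  have : 0 <= (a ^+ 2 - b ^+ 2) * ch by rewrite mulr_ge0//; lra.
  have : 0 <= b ^+ 2 * (ch - cn) by rewrite mulr_ge0 ?sqr_ge0//; lra.
  lra.
(* [sinhcos_le4] at [(a * t, b * t)] controls the negative term of the derivative, and [coshBcos_ge]
   supplies the factor [D * t ^ 2 / 2] that matches it. *)
have k1 : 0 <= D * (t ^+ 2 * (a ^+ 2 * ch - b ^+ 2 * cn) - t * (a * sh * cn - b * ch * sn)).
  have D0 : 0 <= D by rewrite addr_ge0 ?sqr_ge0.
  by rewrite mulr_ge0//; lra.
have k2 : 0 <= (ch - cn - D * t ^+ 2 / 2) * (a ^+ 2 * ch - b ^+ 2 * cn).
  by rewrite mulr_ge0//; move: h2; rewrite /D; lra.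
lra.
Qed.

End TrigInequalities.

(** * The Robin quotient and its monotonicity along hyperbolas *)

Section RobinQuotient.
Context {R : realType}.
Implicit Types (a b p c s t : R).

(** With [a = 2 l re lam], [b = - 2 l im lam] and [p = 2 l r], the quotient [robin_num / robin_den]
    is [2 l] times the real part of the Dirichlet-to-Neumann symbol [dtn lam r l]; see [re_dtn]. *)
Definition robin_num p a b : R :=
  (a ^+ 2 + b ^+ 2) * (a * sinh a - b * sin b)
  + 2 * p * (a ^+ 2 * cosh a + b ^+ 2 * cos b) + p ^+ 2 * (a * sinh a + b * sin b).

Definition robin_den p a b : R :=
  (a ^+ 2 + b ^+ 2) * (cosh a + cos b)
  + 2 * p * (a * sinh a + b * sin b) + p ^+ 2 * (cosh a - cos b).

Lemma robin_den_gt0 p a b : 0 <= p -> 0 < b -> b <= a -> 0 < robin_den p a b.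
Proof.
move=> p0 b0 ba; rewrite /robin_den.
have [_ _ a0 _ _ _ _ _ _ _ _ _ _ _ _ _ _ g12 g2D g3D _] := trig_boundsP (ltW b0) ba.
have D0 : 0 < a ^+ 2 + b ^+ 2 by rewrite ltr_wpDl ?sqr_ge0// exprn_gt0.
have k1 : 0 < (a ^+ 2 + b ^+ 2) * (cosh a + cos b) by rewrite mulr_gt0//; lra.
have k2 : 0 <= p * (a * sinh a + b * sin b) by rewrite mulr_ge0//; lra.
have k3 : 0 <= p ^+ 2 * (cosh a - cos b) by rewrite mulr_ge0 ?sqr_ge0//; lra.
lra.
Qed.

Lemma robin_num_gt0 p a b : 0 < p -> 0 < b -> b <= a -> 0 < robin_num p a b.
Proof.
move=> p0 b0 ba; rewrite /robin_num.
have [_ _ a0 b2a2 _ ch1 sha _ _ _ _ cn1 _ _ _ snb _ g12 g2D g3D _] :=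
  trig_boundsP (ltW b0) ba.
have D0 : 0 < a ^+ 2 + b ^+ 2 by rewrite ltr_wpDl ?sqr_ge0// exprn_gt0.
have k1 : 0 <= (a ^+ 2 + b ^+ 2) * (a * sinh a - b * sin b).
  rewrite mulr_ge0 ?(ltW D0)// subr_ge0.
  have : a * a <= a * sinh a by rewrite ler_wpM2l.
  have : b * sin b <= b * b by rewrite ler_wpM2l// ltW.
  lra.
have k2 : 0 <= p * (a ^+ 2 * cosh a + b ^+ 2 * cos b).
  have : 0 <= b ^+ 2 * (cosh a + cos b) by rewrite mulr_ge0 ?sqr_ge0//; lra.
  have : 0 <= (a ^+ 2 - b ^+ 2) * cosh a by rewrite mulr_ge0//; lra.
  by move=> ? ?; rewrite mulr_ge0 ?(ltW p0)//; lra.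
have k3 : 0 < p ^+ 2 * (a * sinh a + b * sin b) by rewrite mulr_gt0 ?exprn_gt0//; lra.
lra.
Qed.

(* The left-hand side is the numerator of the logarithmic derivative
   (a d/da - b d/db) of robin_num p / robin_den p. *)
Lemma robin_wronskian_ge0 p a b : 0 <= p -> 0 < b -> b <= a ->
  let D := a ^+ 2 + b ^+ 2 in let E := a ^+ 2 - b ^+ 2 in
  let g2 := a * sinh a + b * sin b in let h1 := a * sinh a - b * sin b in
  let m := a ^+ 2 * cosh a - b ^+ 2 * cos b in
  0 <= (2 * E * h1 + D * (g2 + (a ^+ 2 * cosh a + b ^+ 2 * cos b))
        + 2 * p * (2 * m + (a ^+ 3 * sinh a + b ^+ 3 * sin b)) + p ^+ 2 * (h1 + m))
        * robin_den p a b
     - robin_num p a b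
       * (2 * E * (cosh a + cos b) + D * g2 + 2 * p * (h1 + m) + p ^+ 2 * h1).
Proof.
move=> p0 b0 ba /=; rewrite /robin_num /robin_den.
have tb := trig_boundsP (ltW b0) ba.
have q0 := monotone_coef0 tb; have q1 := monotone_coef1 tb.
have q2 := monotone_coef2 tb; have q3 := monotone_coef3 (ltW b0) ba.
have q4 := monotone_coef4 (ltW b0) ba.
have := cosh2D a; have := cos2Dsin2 b.
move: q0 q1 q2 q3 q4 {tb}; move: (cosh a) (sinh a) (cos b) (sin b) => ch sh cn sn.
set q0 := (X in 0 <= X -> _); set q1 := (X in _ -> 0 <= X -> _).
set q2 := (X in _ -> _ -> 0 <= X -> _); set q3 := (X in _ -> _ -> _ -> 0 <= X -> _).
set q4 := (X in _ -> _ -> _ -> _ -> 0 <= X -> _).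
move=> k0 k1 k2 k3 k4 hcn hch.
have D0 : 0 <= a ^+ 2 + b ^+ 2 by rewrite addr_ge0 ?sqr_ge0.
have h : 0 <= (a ^+ 2 + b ^+ 2) ^+ 2 * q0 + p * (2 * (a ^+ 2 + b ^+ 2) * q1)
  + p ^+ 2 * q2 + p ^+ 3 * (2 * q3) + p ^+ 4 * q4.
  by do 4?[apply: addr_ge0]; rewrite !mulr_ge0// ?exprn_ge0.
apply: (le_trans h); rewrite le_eqVlt; apply/orP; left; apply/eqP.
(* The identity holds modulo [cosh ^ 2 - sinh ^ 2 = 1] and [cos ^ 2 + sin ^ 2 = 1]. Multiples of the
   null terms [P] and [Q], with explicit cofactors, are added so that [ring] closes it. *)
pose P := ch ^+ 2 - (1 + sh ^+ 2); pose Q := cn ^+ 2 + sn ^+ 2 - 1.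
have P0 : P = 0 by rewrite /P hch subrr.
have Q0 : Q = 0 by rewrite /Q hcn subrr.
rewrite -[LHS]addr0 -[X in _ + X = _]addr0.
rewrite -[X in _ + (X + _) = _](mul0r ((a ^+ 2 + b ^+ 2) ^+ 2 * a ^+ 2
  + p * (8 * a ^+ 2 * b ^+ 2) + p ^+ 2 * (2 * (b ^+ 2 - a ^+ 2) * a ^+ 2) + p ^+ 4 * a ^+ 2)).
rewrite -[X in _ + (_ + X) = _](mul0r ((a ^+ 2 + b ^+ 2) ^+ 2 * b ^+ 2
  - p * (8 * a ^+ 2 * b ^+ 2) + p ^+ 2 * (2 * (b ^+ 2 - a ^+ 2) * b ^+ 2) + p ^+ 4 * b ^+ 2)).
rewrite -[X in _ + (X * _ + _) = _]P0 -[X in _ + (_ + X * _) = _]Q0.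
by rewrite /P /Q /q0 /q1 /q2 /q3 /q4; ring.
Qed.

Lemma robin_quotient_le p a b a' b' : 0 <= p -> 0 < b -> b <= a -> a <= a' ->
  a * b = a' * b' -> robin_num p a b / robin_den p a b <=
                    robin_num p a' b' / robin_den p a' b'.
Proof.
move=> p0 b0 ba aa' ab.
have a0 : 0 < a by apply: lt_le_trans ba.
have a'0 : 0 < a' by apply: lt_le_trans aa'.
(* The hyperbola is parametrised by [s], so that differentiation in [s] is the operator
   [a d/da - b d/db]; moving towards [s >= 0] preserves [b <= a]. *)
pose A (s : R) := expR s * a; pose B (s : R) := expR (- s) * b.
have B0 s : 0 < B s by rewrite mulr_gt0// expR_gt0.
have BA s : 0 <= s -> B s <= A s.
  move=> s0; rewrite /A /B ler_pM ?expR_ge0 ?(ltW b0)//.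
  by rewrite ler_expR; lra.
pose N s := robin_num p (A s) (B s); pose M s := robin_den p (A s) (B s).
pose s1 := ln (a' / a).
have e1 : expR s1 = a' / a by rewrite lnK// posrE divr_gt0.
have A1 : A s1 = a' by rewrite /A e1 divfK// gt_eqF.
have B1 : B s1 = b'.
  rewrite /B expRN e1 invf_div; apply: (mulfI (lt0r_neq0 a'0)); rewrite -ab.
  by field; rewrite gt_eqF.
have -> : robin_num p a b / robin_den p a b = N 0 / M 0.
  by rewrite /N /M /A /B oppr0 expR0 !mul1r.
have -> : robin_num p a' b' / robin_den p a' b' = N s1 / M s1.
  by rewrite /N /M A1 B1.
have s10 : 0 <= s1 by rewrite ln_ge0// ler_pdivlMr// mul1r.
(* [dN] and [dM] are the images of [robin_num p] and [robin_den p] under [a d/da - b d/db]. *)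
pose dN a b := 2 * (a ^+ 2 - b ^+ 2) * (a * sinh a - b * sin b)
  + (a ^+ 2 + b ^+ 2) * ((a * sinh a + b * sin b) + (a ^+ 2 * cosh a + b ^+ 2 * cos b))
  + 2 * p * (2 * (a ^+ 2 * cosh a - b ^+ 2 * cos b) + (a ^+ 3 * sinh a + b ^+ 3 * sin b))
  + p ^+ 2 * ((a * sinh a - b * sin b) + (a ^+ 2 * cosh a - b ^+ 2 * cos b)).
pose dM a b := 2 * (a ^+ 2 - b ^+ 2) * (cosh a + cos b)
  + (a ^+ 2 + b ^+ 2) * (a * sinh a + b * sin b)
  + 2 * p * ((a * sinh a - b * sin b) + (a ^+ 2 * cosh a - b ^+ 2 * cos b))
  + p ^+ 2 * (a * sinh a - b * sin b).
have NE s : is_derive s 1 N (dN (A s) (B s)).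
  rewrite /N /robin_num /A /B; derive_to; rewrite /dN.
  move: (cosh _) (sinh _) (cos _) (sin _) => c1 c2 c3 c4.
  by move: (expR s) (expR (- s)) => *; ring.
have ME s : is_derive s 1 M (dM (A s) (B s)).
  rewrite /M /robin_den /A /B; derive_to; rewrite /dM.
  move: (cosh _) (sinh _) (cos _) (sin _) => c1 c2 c3 c4.
  by move: (expR s) (expR (- s)) => *; ring.
apply: (@ge0_derive_le R (fun s => N s / M s) (fun s =>
  (dN (A s) (B s) * M s - N s * dM (A s) (B s)) / M s ^+ 2) 0 s1 s10) => s /andP[s0 _].
have M0 : 0 < M s by rewrite robin_den_gt0// BA.
split; last first.
  by rewrite divr_ge0 ?sqr_ge0//; apply: robin_wronskian_ge0 => //; exact: BA.
notypeclasses refine (derEq (derM (NE s) (derV _ (ME s))) _).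
  by rewrite gt_eqF.
by move: (M s) M0 (dN _ _) (dM _ _) => ms ms0 dn dm; field; rewrite gt_eqF.
Qed.

End RobinQuotient.

(** * Complex exponentials and Dirichlet-to-Neumann symbols *)

Local Open Scope complex_scope.
Local Notation nc := Normc.normc.
Local Notation re := complex.Re.
Local Notation im := complex.Im.

Section ComplexFacts.
Context {R : realType}.
Implicit Types (z w lam : R[i]) (x y r l : R).

Lemma reD z w : re (z + w) = re z + re w. Proof. by case: z w => [a b] [c d]. Qed.
Lemma imD z w : im (z + w) = im z + im w. Proof. by case: z w => [a b] [c d]. Qed.
Lemma reN z : re (- z) = - re z. Proof. by case: z. Qed.
Lemma imN z : im (- z) = - im z. Proof. by case: z. Qed.
Lemma reM z w : re (z * w) = re z * re w - im z * im w.
Proof. by case: z w => [a b] [c d]. Qed.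
Lemma imM z w : im (z * w) = re z * im w + im z * re w.
Proof. by case: z w => [a b] [c d]. Qed.
Lemma re_div z w :
  re (z / w) = (re z * re w + im z * im w) / (re w ^+ 2 + im w ^+ 2).
Proof. by case: z w => [a b] [c d] /=; rewrite mulrN opprK mulrDl !mulrA. Qed.

Definition cplxE := (reD, imD, reN, imN, reM, imM).

Lemma normcE z : nc z = Num.sqrt (re z ^+ 2 + im z ^+ 2).
Proof. by case: z. Qed.

Lemma normc_sqr z : nc z ^+ 2 = re z ^+ 2 + im z ^+ 2.
Proof. by rewrite normcE sqr_sqrtr// addr_ge0 ?sqr_ge0. Qed.

Lemma normc_ge0 z : 0 <= nc z.
Proof. by rewrite normcE sqrtr_ge0. Qed.

Lemma re_le_normc z : re z <= nc z.
Proof.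
rewrite (le_trans (ler_norm _))// -sqrtr_sqr normcE ler_wsqrtr//.
by rewrite lerDl sqr_ge0.
Qed.

Lemma normcB_le z w : nc (z - w) <= nc z + nc w.
Proof. by rewrite (le_trans (le_normcD _ _))// lerD2l normcN. Qed.

Lemma normcD_ge z w : nc z - nc w <= nc (z + w).
Proof. by rewrite lerBlDr -{1}(addrK w z) normcB_le. Qed.

Lemma normc_le z : nc z <= `|re z| + `|im z|.
Proof.
rewrite -(@ler_pXn2r _ 2)// ?nnegrE ?normc_ge0 ?addr_ge0//.
rewrite normc_sqr -(real_normK (num_real (re z))) -(real_normK (num_real (im z))).
have := normr_ge0 (re z); have := normr_ge0 (im z); nra.
Qed.

Lemma normc_real r : nc (r%:C) = `|r|.
Proof. by rewrite /= expr0n/= addr0 sqrtr_sqr. Qed.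

Lemma normc_gt0 z : z != 0 -> 0 < nc z.
Proof.
move=> z0; rewrite lt_neqAle normc_ge0 andbT eq_sym.
by apply: contra z0 => /eqP/Normc.eq0_normc ->.
Qed.

Lemma cexpD z w : cexp (z + w) = cexp z * cexp w.
Proof.
rewrite /cexp reD imD expRD cosD sinD; apply/eqP; rewrite eq_complex/=.
by apply/andP; split; apply/eqP; ring.
Qed.

Lemma cexp0 : cexp 0 = 1 :> R[i].
Proof. by rewrite /cexp/= expR0 cos0 sin0 mul1r mulr0. Qed.

Lemma normc_cexp z : nc (cexp z) = expR (re z).
Proof.
rewrite /cexp /= !exprMn -mulrDr cos2Dsin2 mulr1 sqrtr_sqr ger0_norm// expR_ge0.
Qed.

Lemma cexp_neq0 z : cexp z != 0.
Proof.
apply/negP => /eqP h; have := normc_cexp z; rewrite h Normc.normc0.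
by have := expR_gt0 (re z) => /[swap] <-; rewrite ltxx.
Qed.

Lemma cexpN z : cexp (- z) = (cexp z)^-1.
Proof.
apply: (mulfI (cexp_neq0 z)).
by rewrite -cexpD subrr cexp0 divff ?cexp_neq0.
Qed.

(** Ratio, at distance [l], of the decaying to the growing exponential in a solution of
    [u'' = lam^2 u] with [- u' + r u = 0] at 0. *)
Definition refl lam r l : R[i] :=
  (lam - r%:C) / (lam + r%:C) * cexp (- (lam * (2 * l)%:C)).

(* The Dirichlet-to-Neumann symbol: [u' / u] at the end of an interval of
   length [l] for [u'' = lam^2 u] with the Robin parameter [r] at the other. *)
Definition dtn lam r l : R[i] :=
  lam * (1 - refl lam r l) / (1 + refl lam r l).

(** [lam - r] is no farther from 0 than [lam + r], so only the decay over the round trip of length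
    [2 l] remains. *)
Lemma normc_refl_le lam r l : 0 < re lam -> 0 <= r ->
  nc (refl lam r l) <= expR (- (2 * l * re lam)).
Proof.
move=> x0 r0; rewrite /refl !Normc.normcM Normc.normcV normc_cexp.
have -> : re (- (lam * (2 * l)%:C)) = - (2 * l * re lam).
  by rewrite !cplxE/=; ring.
rewrite ler_piMl ?expR_ge0// ler_pdivrMr; last first.
  by apply: lt_le_trans (re_le_normc _); rewrite cplxE/=; lra.
rewrite mul1r -(@ler_pXn2r _ 2)// ?nnegrE ?normc_ge0// !normc_sqr !cplxE/=.
nra.
Qed.

Lemma re_dtn lam r l : 0 < re lam -> 0 <= r -> 0 < l ->
  1 + refl lam r l != 0 ->
  re (dtn lam r l) =
  robin_num (2 * l * r) (2 * l * re lam) (2 * l * - im lam) /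
  robin_den (2 * l * r) (2 * l * re lam) (2 * l * - im lam) / (2 * l).
Proof.
move=> x0 r0 l0 E0.
have w0 : lam + r%:C != 0.
  by apply/eqP => /(congr1 (fun z => re z)); rewrite cplxE/=; lra.
pose e := cexp (- (lam * (2 * l)%:C)).
have -> : dtn lam r l = lam * (lam + r%:C - (lam - r%:C) * e) / (lam + r%:C + (lam - r%:C) * e).
  rewrite /dtn; move: E0; rewrite /refl -/e => E0.
  have E1 : lam + r%:C + (lam - r%:C) * e != 0.
    apply: contra E0 => /eqP h.
    have -> : 1 + (lam - r%:C) / (lam + r%:C) * e =
              (lam + r%:C + (lam - r%:C) * e) / (lam + r%:C) by field.
    by rewrite h mul0r.
  by field; rewrite E1 w0.
set x := re lam in x0 *; pose y := - im lam; rewrite -/y.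
have imy : im lam = - y by rewrite opprK.
set a := 2 * l * x; set b := 2 * l * y; set p := 2 * l * r.
pose v := expR a; have v0 : 0 < v by exact: expR_gt0.
have ea : re (- (lam * (2 * l)%:C)) = - a by rewrite !cplxE/= /a; ring.
have eb : im (- (lam * (2 * l)%:C)) = b by rewrite !cplxE/= imy /b; ring.
have re_e : re e = v^-1 * cos b by rewrite /e /cexp ea eb /= expRN.
have im_e : im e = v^-1 * sin b by rewrite /e /cexp ea eb /= expRN.
have cs := cos2Dsin2 b.
have ch : cosh a = (v + v^-1) / 2 by rewrite /cosh expRN.
have sh : sinh a = (v - v^-1) / 2 by rewrite /sinh expRN.
set M := lam + r%:C + (lam - r%:C) * e.
set N := lam * (lam + r%:C - (lam - r%:C) * e).
have M2 : re M ^+ 2 + im M ^+ 2 = robin_den p a b / (2 * l ^+ 2 * v).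
  (* The added term is a multiple of [cos ^ 2 + sin ^ 2 - 1 = 0]; with it the claim is a field
     identity in [v = exp a]. *)
  transitivity (robin_den p a b / (2 * l ^+ 2 * v)
     + ((x - r) ^+ 2 + y ^+ 2) * v ^- 2 * (cos b ^+ 2 + sin b ^+ 2 - 1)); last first.
    by rewrite cs subrr mulr0 addr0.
  rewrite /robin_den ch sh /M !cplxE re_e im_e imy -/x /p /a /b /=.
  move: (cos _) (sin _) => cn sn.
  by field; rewrite !gt_eqF.
have NM : re N * re M + im N * im M = robin_num p a b / (4 * l ^+ 3 * v).
  transitivity (robin_num p a b / (4 * l ^+ 3 * v)
     - x * ((x - r) ^+ 2 + y ^+ 2) * v ^- 2 * (cos b ^+ 2 + sin b ^+ 2 - 1)); last first.
    by rewrite cs subrr mulr0 subr0.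
  rewrite /robin_num ch sh /N /M !cplxE re_e im_e imy -/x /p /a /b /=.
  move: (cos _) (sin _) => cn sn.
  by field; rewrite !gt_eqF.
rewrite re_div M2 NM.
(* The inverse of 0 is 0, so both sides vanish in the first case. *)
have [->|d0] := eqVneq (robin_den p a b) 0; first by rewrite !(mul0r, invr0, mulr0).
by field; rewrite d0 !gt_eqF.
Qed.

End ComplexFacts.

Lemma le_of_sqr (R : realType) (x y : R) : 0 <= y -> x ^+ 2 <= y ^+ 2 -> x <= y.
Proof.
move=> y0 xy; have [x0|x0] := lerP 0 x; last by rewrite (le_trans (ltW x0)).
by rewrite -(@ler_pXn2r _ 2) ?nnegrE.
Qed.

Lemma sqrt_parts (R : realType) (x y s e : R) : 0 <= x -> 0 < e ->
  x * x - y * y = s -> x * y + y * x = - e ->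
  [/\ 0 < x, 0 < - y, x ^+ 2 = s + y ^+ 2 & 2 * x * - y = e].
Proof.
move=> x0 e0 h1 h2; have {}x0 : 0 < x.
  rewrite lt_neqAle x0 andbT eq_sym; apply: contraTneq e0 => x00.
  by rewrite -(opprK e) -h2 x00 mul0r mulr0 addr0 oppr0 ltxx.
split=> //; [|lra|lra].
have : 0 < x * - y by lra.
by rewrite pmulr_rgt0.
Qed.

(** * The symbol as a function of the frequency *)

Section Symbol.
Context {R : realType}.
Variables (sigma eps : R).
Hypotheses (sigma0 : 0 < sigma) (eps0 : 0 < eps).
Implicit Types (k : R).

Lemma symbolP k : exists x y : R, [/\ symbol sigma eps k = x -i* y,
  0 < x, 0 < y, x ^+ 2 = k ^+ 2 + sigma + y ^+ 2 & 2 * x * y = eps].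
Proof.
have := sqr_sqrtc ((k ^+ 2 + sigma) -i* eps).
rewrite -/(symbol sigma eps k) expr2.
have : 0 <= re (symbol sigma eps k) by rewrite /symbol /= sqrtr_ge0.
case: (symbol sigma eps k) => x y /= x0 [h e].
have [x1 y1 xy xye] := sqrt_parts x0 eps0 h e.
by exists x, (- y); rewrite opprK sqrrN.
Qed.

Lemma symbol_re_gt0 k : 0 < re (symbol sigma eps k).
Proof. by have [x [y [-> ]]] := symbolP k. Qed.

Lemma symbol_im_lt0 k : 0 < - im (symbol sigma eps k).
Proof. by have [x [y [-> x0 y0 _ _]]] := symbolP k; rewrite /= opprK. Qed.

Lemma symbol_im_le_re k : - im (symbol sigma eps k) <= re (symbol sigma eps k).
Proof.
have sg0 := sigma0; have [x [y [-> x0 y0 h _]]] := symbolP k; rewrite /= opprK.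
by apply: le_of_sqr; [exact: ltW|have := sqr_ge0 k; lra].
Qed.

Lemma symbol_re_ge k : k <= re (symbol sigma eps k).
Proof.
have sg0 := sigma0; have [x [y [-> x0 y0 h _]]] := symbolP k; rewrite /=.
by apply: le_of_sqr; [exact: ltW|have := sqr_ge0 y; lra].
Qed.

Lemma symbol_re_ge_sqrt k : Num.sqrt sigma <= re (symbol sigma eps k).
Proof.
have sg0 := sigma0; have [x [y [-> x0 y0 h _]]] := symbolP k; rewrite /=.
apply: le_of_sqr; first exact: ltW.
rewrite sqr_sqrtr ?(ltW sigma0)//; have := sqr_ge0 k; have := sqr_ge0 y; lra.
Qed.

Lemma symbol_im_bound k :
  - im (symbol sigma eps k) <= eps / (2 * Num.sqrt sigma).
Proof.
have := symbol_re_ge_sqrt k.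
have [x [y [-> x0 y0 _ e]]] := symbolP k; rewrite /= opprK => sx.
have s0 : 0 < Num.sqrt sigma by rewrite sqrtr_gt0.
rewrite ler_pdivlMr ?mulr_gt0// -e.
have : Num.sqrt sigma * y <= x * y by rewrite ler_wpM2r// ltW.
lra.
Qed.

Lemma symbol_re_le k : 0 <= k ->
  re (symbol sigma eps k) <= k + (Num.sqrt sigma + eps / (2 * Num.sqrt sigma)).
Proof.
move=> k0; have := symbol_im_bound k.
have sg0 := sigma0; have [x [y [-> x0 y0 h _]]] := symbolP k; rewrite /= opprK.
have s0 := sqrtr_ge0 sigma.
have s2 : Num.sqrt sigma ^+ 2 = sigma := sqr_sqrtr (ltW sigma0).
move: (eps / _) => Y yY; move: (Num.sqrt sigma) s0 s2 => s s0 s2.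
have Y0 : 0 <= Y by lra.
apply: le_of_sqr; first lra.
have : y ^+ 2 <= Y ^+ 2 by rewrite lerXn2r// ?nnegrE; lra.
have : 0 <= k * (s + Y) by rewrite mulr_ge0// addr_ge0.
have : 0 <= s * Y by rewrite mulr_ge0.
lra.
Qed.

(** The product of the real and imaginary parts is constant, so a smaller real part would force a
    larger imaginary one in modulus, and the difference of the squares, [k ^ 2 + sigma], would drop
    below [sigma]. *)
Lemma symbol_re_mono k : re (symbol sigma eps 0) <= re (symbol sigma eps k).
Proof.
have [x0 [y0 [-> x00 y00 h0 e0]]] := symbolP 0.
have [x [y [-> x1 y1 h e]]] := symbolP k.
rewrite /= leNgt; apply/negP => xx0.
have yy : y0 <= y.
  rewrite -(ler_pM2l x00); apply: (@le_trans _ _ (x * y)); first lra.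
  by rewrite ler_wpM2r// ltW.
have : x ^+ 2 < x0 ^+ 2 by rewrite ltrXn2r// ?nnegrE ltW.
have : y0 ^+ 2 <= y ^+ 2 by rewrite lerXn2r// ?nnegrE ltW.
rewrite expr0n/= in h0; have := sqr_ge0 k; lra.
Qed.

Lemma symbol_re_im_const k : re (symbol sigma eps k) * - im (symbol sigma eps k) = eps / 2.
Proof. by have [x [y [-> _ _ _ <-]]] := symbolP k; rewrite /= opprK; field. Qed.

Lemma normc_refl_lt1 k r l : 0 <= r -> 0 < l -> nc (refl (symbol sigma eps k) r l) < 1.
Proof.
move=> r0 l0; have x0 := symbol_re_gt0 k.
by rewrite (le_lt_trans (normc_refl_le _ x0 r0))// expR_lt1 oppr_lt0 !mulr_gt0.
Qed.

Lemma refl_neqN1 k r l : 0 <= r -> 0 < l -> 1 + refl (symbol sigma eps k) r l != 0.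
Proof.
move=> r0 l0; have := normc_refl_lt1 k r0 l0.
have := normcD_ge 1 (refl (symbol sigma eps k) r l); rewrite Normc.normc1 => h1 h2.
by apply: contraTneq h1 => ->; rewrite Normc.normc0; lra.
Qed.

Lemma re_dtn_gt0 k r l : 0 < r -> 0 < l -> 0 < re (dtn (symbol sigma eps k) r l).
Proof.
move=> r0 l0; have x0 := symbol_re_gt0 k.
rewrite re_dtn ?refl_neqN1 ?(ltW r0)//.
have l20 : 0 < 2 * l by rewrite mulr_gt0.
have y0 : 0 < 2 * l * - im (symbol sigma eps k) by rewrite mulr_gt0// symbol_im_lt0.
have yx : 2 * l * - im (symbol sigma eps k) <= 2 * l * re (symbol sigma eps k).
  by rewrite ler_wpM2l ?(ltW l20)// symbol_im_le_re.
have p0 : 0 < 2 * l * r by rewrite mulr_gt0.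
by rewrite !divr_gt0 ?robin_num_gt0 ?robin_den_gt0 ?(ltW p0).
Qed.

(** Passing from frequency 0 to [k] moves the rescaled parts of the symbol along a hyperbola towards
    a larger real part, where [robin_quotient_le] applies. This yields [m >= C]. *)
Lemma re_dtn_mono k r l : 0 < r -> 0 < l ->
  re (dtn (symbol sigma eps 0) r l) <= re (dtn (symbol sigma eps k) r l).
Proof.
move=> r0 l0; rewrite !re_dtn ?refl_neqN1 ?symbol_re_gt0 ?(ltW r0)//.
have l20 : 0 < 2 * l by rewrite mulr_gt0.
rewrite ler_wpM2r ?invr_ge0 ?(ltW l20)//.
apply: robin_quotient_le.
- by rewrite mulr_ge0 ?(ltW l20) ?(ltW r0).
- by rewrite mulr_gt0// symbol_im_lt0.
- by rewrite ler_wpM2l ?(ltW l20)// symbol_im_le_re.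
- by rewrite ler_wpM2l ?(ltW l20)// symbol_re_mono.
by rewrite mulrACA [RHS]mulrACA !symbol_re_im_const.
Qed.

End Symbol.

(** * Estimates uniform in the frequency *)

Section UniformBounds.
Context {R : realType}.
Implicit Types (k l d r x y u v : R) (lam : R[i]).

Lemma cosB1_le v : 0 <= v -> 1 - cos v <= v.
Proof.
move=> v0; have [v2|v2] := lerP v 2; last by have := cos_geN1 v; lra.
have := cos_ge v0; have : 0 <= v * (2 - v) by rewrite mulr_ge0// subr_ge0.
lra.
Qed.

Lemma normr_sin_le v : 0 <= v -> `|sin v| <= v.
Proof.
move=> v0; rewrite ler_norml sin_le// andbT.
have [v1|v1] := lerP v 1; last by have := sin_geN1 v; lra.
have : 0 <= sin v by rewrite sin_ge0_pi// v0/=; have := @pi_gt3 R; lra.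
lra.
Qed.

Lemma normc_cexpB1 u v : 0 <= u -> 0 <= v ->
  nc (cexp ((- u) +i* v) - 1) <= u + 2 * v.
Proof.
move=> u0 v0; apply: (le_trans (normc_le _)); rewrite !cplxE /cexp /= oppr0 addr0.
have e0 := expR_gt0 (- u); have e1 : expR (- u) <= 1 by rewrite expR_le1 oppr_le0.
have e2 := expR_ge1Dx (- u).
have h1 : `|expR (- u) * cos v - 1| <= u + v.
  have c1 := cosB1_le v0; have c2 := cos_le1 v; rewrite ler_norml.
  have : expR (- u) * (1 - cos v) <= 1 * v by rewrite ler_pM// ?subr_ge0 ?(ltW e0).
  have : 0 <= expR (- u) * (1 - cos v) by rewrite mulr_ge0// ?subr_ge0 ?(ltW e0).
  by move=> ? ?; apply/andP; split; lra.
have h2 : `|expR (- u) * sin v| <= v.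
  rewrite normrM (ger0_norm (ltW e0)).
  have : expR (- u) * `|sin v| <= 1 * v by rewrite ler_pM// ?(ltW e0) ?normr_sin_le.
  lra.
lra.
Qed.

Lemma expRN_le_inv u : 0 < u -> expR (- u) <= u^-1.
Proof.
move=> u0; rewrite expRN lef_pV2 ?posrE ?expR_gt0//.
have := expR_ge1Dx u; lra.
Qed.

Lemma reflD lam r l d : refl lam r (l + d) = refl lam r l * cexp (- (lam * (2 * d)%:C)).
Proof.
rewrite /refl -!mulrA -cexpD; do 2!congr (_ * _); congr cexp.
by rewrite -opprD -mulrDr -rmorphD /= -mulrDr.
Qed.

(** The reflections are at most [q = exp (- 2 L re lam)], which absorbs powers of [lam]: both
    [q |lam|] and [q |lam| ^ 2] are bounded uniformly in [k]. This keeps [dtn] within O(1 / |lam|)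
    of [lam] and makes the effect of the overlap O(d). *)
Lemma dtn_bounds sigma eps L r : 0 < sigma -> 0 < eps -> 0 < L -> 0 < r ->
  exists2 K : R, 1 <= K & forall k d, 0 < d -> let lam := symbol sigma eps k in
  [/\ nc (dtn lam r L - lam) <= K,
      nc (dtn lam r L - lam) * nc lam <= K,
      nc (dtn lam r (L + d) - dtn lam r L) <= K * d,
      nc (1 + refl lam r L) <= (1 + K * d) * nc (1 + refl lam r (L + d)) &
      (1 - K * d) * nc (1 + refl lam r (L + d)) <= nc (1 + refl lam r L)].
Proof.
move=> sigma0 eps0 L0 r0.
pose s := Num.sqrt sigma; pose Y := eps / (2 * s).
have s0 : 0 < s by rewrite sqrtr_gt0.
have Y0 : 0 < Y by rewrite divr_gt0// mulr_gt0.
(* The reflections below have modulus at most [theta < 1], so [g] bounds [1 + E] and [1 + E'] away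
   from 0. *)
pose theta := expR (- (2 * L * s)); pose g := 1 - theta.
have theta0 : 0 < theta by exact: expR_gt0.
have g0 : 0 < g by rewrite subr_gt0 expR_lt1 oppr_lt0 !mulr_gt0.
have g1 : g <= 1 by rewrite /g; lra.
(* [M] bounds [q |lam| ^ 2]: the real part is controlled by [x * exp (- L x) <= 1 / L], the
   imaginary one by [Y]. *)
pose M := L ^- 2 + Y ^+ 2.
have M0 : 0 < M by rewrite addr_gt0 ?invr_gt0 ?exprn_gt0.
have gi : 1 <= g^-1 by rewrite -[1]invr1 lef_pV2 ?posrE.
pose K := 1 + 12 * (1 + M) * g^-1 ^+ 2.
have gi2 : g^-1 <= g^-1 ^+ 2 by rewrite expr2 ler_peMl// ltW// invr_gt0.
have M1 : 0 <= 1 + M by lra.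
have Mgi : 0 <= (1 + M) * (g^-1 ^+ 2 - g^-1) by rewrite mulr_ge0// subr_ge0.
have Mg0 : 0 <= (1 + M) * g^-1 by rewrite mulr_ge0 ?invr_ge0 ?(ltW g0).
have gg0 : 0 <= g^-1 ^+ 2 by rewrite sqr_ge0.
have K1 : 1 <= K by rewrite /K; lra.
exists K => //.
move=> k d d0 lam.
have lamE : lam = re lam +i* im lam by case: (lam).
have x0 : 0 < re lam by exact: symbol_re_gt0.
have sx : s <= re lam by exact: symbol_re_ge_sqrt.
have y0 : 0 < - im lam by exact: symbol_im_lt0.
have yY : - im lam <= Y by exact: symbol_im_bound.
have : nc lam ^+ 2 = re lam ^+ 2 + (- im lam) ^+ 2 by rewrite sqrrN normc_sqr.
have ec : - (lam * (2 * d)%:C) = - (2 * d * re lam) +i* (2 * d * - im lam).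
  by rewrite {1}lamE; apply/eqP; rewrite eq_complex/=; apply/andP; split; apply/eqP; ring.
have n0 : 0 <= nc lam by exact: normc_ge0.
pose x : R := re lam; pose y : R := - im lam; pose n : R := nc lam.
rewrite -/x -/y -/n in sx x0 y0 yY ec n0 * => n2.
have n1 : x <= n by apply: le_of_sqr => //; rewrite n2 lerDl sqr_ge0.
have n1' : y <= n by apply: le_of_sqr => //; rewrite n2 lerDr sqr_ge0.
pose q := expR (- (2 * L * x)).
have q0 : 0 < q by exact: expR_gt0.
have qt : q <= theta by rewrite ler_expR lerN2 ler_wpM2l// mulr_ge0// ltW.
have q1 : q <= 1 by move: g0; rewrite /g; lra.
have xq : x ^+ 2 * q <= L ^- 2.
  have -> : x ^+ 2 * q = (x * expR (- (L * x))) ^+ 2.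
    rewrite /q exprMn; congr (_ * _).
    by rewrite expr2 -expRD; congr expR; ring.
  have Lx : 0 < L * x by rewrite mulr_gt0.
  rewrite -exprVn lerXn2r// ?nnegrE ?invr_ge0 ?(ltW L0)//.
    by rewrite mulr_ge0 ?(ltW x0) ?expR_ge0.
  have : x * expR (- (L * x)) <= x * (L * x)^-1 by rewrite ler_wpM2l ?(ltW x0)// expRN_le_inv.
  by rewrite invfM mulrCA divff ?gt_eqF// mulr1.
have nnq : n ^+ 2 * q <= M.
  rewrite n2 mulrDl /M lerD//.
  rewrite -[leRHS]mulr1 ler_pM ?sqr_ge0 ?(ltW q0)//.
  by rewrite lerXn2r// nnegrE ltW.
have nq : n * q <= 1 + M.
  have : 0 <= (1 + n ^+ 2 - n) * q.
    rewrite mulr_ge0 ?(ltW q0)//; have : 0 <= (n - 1) ^+ 2 by exact: sqr_ge0.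
    have : 0 <= n ^+ 2 by exact: sqr_ge0.
    lra.
  lra.
set E := refl lam r L; set E' := refl lam r (L + d).
have Eq : nc E <= q by exact: normc_refl_le (ltW r0).
have E'q : nc E' <= q.
  apply: (le_trans (normc_refl_le _ _ (ltW r0))) => //.
  rewrite ler_expR lerN2 ler_wpM2r ?(ltW x0)// ler_wpM2l//; lra.
have lb F : nc F <= q -> g <= nc (1 + F).
  by move=> Fq; have := normcD_ge 1 F; rewrite Normc.normc1 /g; lra.
have gE := lb _ Eq; have gE' := lb _ E'q.
(* The overlap multiplies the reflection by [exp (- 2 d lam)], which differs from 1 by at most
   [6 d |lam|]. *)
have dE : nc (E' - E) <= 6 * d * (n * q).
  rewrite /E' reflD -/E -{2}(mulr1 E) -mulrBr Normc.normcM ec.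
  have h := @normc_cexpB1 (2 * d * x) (2 * d * y).
  have {}h : nc (cexp (- (2 * d * x) +i* (2 * d * y)) - 1) <= 6 * d * n.
    apply: (le_trans (h _ _)); rewrite ?mulr_ge0 ?(ltW d0) ?(ltW x0) ?(ltW y0)//.
    have : 0 <= d * (n - x) by rewrite mulr_ge0 ?(ltW d0)// subr_ge0.
    have : 0 <= d * (n - y) by rewrite mulr_ge0 ?(ltW d0)// subr_ge0.
    lra.
  rewrite mulrA [_ * q]mulrC ler_pM ?normc_ge0//.
have E1 : 1 + E != 0 by exact: refl_neqN1 (ltW r0) _.
have E'1 : 1 + E' != 0 by apply: refl_neqN1 => //; [exact: ltW|exact: addr_gt0].
have inv_le F : g <= nc (1 + F) -> (nc (1 + F))^-1 <= g^-1.
  by move=> h; rewrite lef_pV2 ?posrE// (lt_le_trans g0).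
have iE := inv_le _ gE; have iE' := inv_le _ gE'.
have dnq : 0 <= d * (1 + M - n * q) by rewrite mulr_ge0 ?(ltW d0)// subr_ge0.
have Kd : 6 * d * (1 + M) <= K * d * g.
  have -> : K * d * g = d * g + 12 * (d * ((1 + M) * g^-1)).
    by rewrite /K; field; rewrite gt_eqF.
  have : 0 <= d * ((1 + M) * (g^-1 - 1)) by rewrite !mulr_ge0 ?(ltW d0)// subr_ge0.
  have : 0 <= d * g by rewrite mulr_ge0 ?(ltW d0) ?(ltW g0).
  have : 0 <= d * (1 + M) by rewrite mulr_ge0 ?(ltW d0).
  lra.
have Kdg F : g <= nc (1 + F) -> 6 * d * (1 + M) <= K * d * nc (1 + F).
  move=> h; apply: (le_trans Kd); rewrite ler_wpM2l//.
  by rewrite mulr_ge0 ?(ltW d0)//; lra.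
have dA : dtn lam r L - lam = - (lam * (2 * E)) / (1 + E).
  by rewrite /dtn -/E; field.
have nA : nc (dtn lam r L - lam) <= 2 * (n * q) * g^-1.
  rewrite dA Normc.normcM Normc.normcV normcN (Normc.normcM lam) (Normc.normcM 2) -/n.
  have -> : nc (2 : R[i]) = 2 by rewrite -[2]/(2%:R) -(rmorph_nat (real_complex R)) normc_real ger0_norm.
  rewrite ler_pM ?invr_ge0 ?mulr_ge0 ?normc_ge0//.
  have : n * nc E <= n * q by rewrite ler_wpM2l.
  lra.
have gi0 : 0 <= g^-1 by lra.
split.
- apply: (le_trans nA); apply: (@le_trans _ _ (2 * (1 + M) * g^-1)).
    by rewrite ler_wpM2r// ler_wpM2l.
  rewrite /K; lra.
- apply: (@le_trans _ _ (2 * (n * q) * g^-1 * n)); first by rewrite ler_wpM2r.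
  have -> : 2 * (n * q) * g^-1 * n = 2 * (n ^+ 2 * q) * g^-1 by ring.
  apply: (@le_trans _ _ (2 * (1 + M) * g^-1)).
    by rewrite ler_wpM2r// ler_wpM2l//; lra.
  rewrite /K; lra.
- have -> : dtn lam r (L + d) - dtn lam r L = lam * (- 2 * (E' - E)) / (1 + E') / (1 + E).
    by rewrite /dtn -/E -/E'; field; rewrite E1.
  rewrite !Normc.normcM !Normc.normcV normcN -/n.
  have -> : nc (2 : R[i]) = 2 by rewrite -[2]/(2%:R) -(rmorph_nat (real_complex R)) normc_real ger0_norm.
  apply: (@le_trans _ _ (12 * d * (n ^+ 2 * q) * g^-1 ^+ 2)).
    have -> : 12 * d * (n ^+ 2 * q) * g^-1 ^+ 2 = 12 * d * (n ^+ 2 * q) * g^-1 * g^-1.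
      by ring.
    rewrite ler_pM ?invr_ge0 ?mulr_ge0 ?invr_ge0 ?normc_ge0//.
    rewrite ler_pM ?invr_ge0 ?mulr_ge0 ?invr_ge0 ?normc_ge0//.
    have : n * (2 * nc (E' - E)) <= n * (2 * (6 * d * (n * q))) by rewrite ler_wpM2l// ler_wpM2l.
    lra.
  have : 0 <= d * (1 + M - n ^+ 2 * q) * g^-1 ^+ 2.
    by rewrite !mulr_ge0 ?(ltW d0)//; lra.
  rewrite /K; lra.
- have := le_normcD (1 + E') (E - E').
  have -> : 1 + E' + (E - E') = 1 + E by ring.
  have -> : nc (E - E') = nc (E' - E) by rewrite -normcN opprB.
  have := Kdg _ gE'; lra.
- have := le_normcD (1 + E) (E' - E).
  have -> : 1 + E + (E' - E) = 1 + E' by ring.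
  have := Kdg _ gE'; lra.
Qed.

End UniformBounds.

(** * The convergence factor *)

Section ConvergenceFactor.
Context {R : realType}.
Implicit Types (k L d x p q : R) (lam : R[i]).

(** An eigenvector [(u, w)] solves [w c = a u] and [u b = a w]. Conversely [(c, a)] is one when
    [a ^ 2 = b c], and [(0, 1)] replaces it when [c = 0]. *)
Lemma eigenvalue_antidiag (b c a : R[i]) :
  eigenvalue (\matrix_(i < 2, j < 2)
    (if (i == 0) && (j == 1) then b else if (i == 1) && (j == 0) then c else 0)) a
  = (a ^+ 2 == b * c).
Proof.
set A := (X in eigenvalue X _).
have vA (v : 'rV[R[i]]_2) : (v *m A = a *: v) <->
    (v 0 1 * c = a * v 0 0 /\ v 0 0 * b = a * v 0 1).
  have l1 : lift ord0 ord0 = 1 :> 'I_2 by apply/val_inj.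
  have vE j : (v *m A) 0 j = v 0 0 * A 0 j + v 0 1 * A 1 j.
    by rewrite mxE big_ord_recl big_ord1 l1.
  split=> [h|[h0 h1]].
    have := congr1 (fun w : 'rV_2 => w 0 0) h; have := congr1 (fun w : 'rV_2 => w 0 1) h.
    by rewrite !vE !mxE /= !mulr0 addr0 add0r.
  apply/rowP => j; rewrite vE !mxE.
  have [->|->] : j = 0 \/ j = 1.
    by case: j => [[|[|//]] ?]; [left|right]; apply/val_inj.
  - by rewrite /= mulr0 add0r -h0.
  - by rewrite /= mulr0 addr0 -h1.
apply/eigenvalueP/eqP => [[v /vA[h0 h1] v0]|abc].
  have [v00|v00] := eqVneq (v 0 0) 0.
    have v01 : v 0 1 != 0.
      apply: contra v0 => /eqP v01; apply/eqP/rowP => j; rewrite mxE.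
      have [->|->] : j = 0 \/ j = 1 by case: j => [[|[|//]] ?]; [left|right]; apply/val_inj.
        by [].
      by [].
    move: h0 h1; rewrite v00 mulr0 mul0r => h0 h1.
    have -> : c = 0 by apply/eqP; move/eqP: h0; rewrite mulf_eq0 (negbTE v01).
    have -> : a = 0 by apply/eqP; move/esym/eqP: h1; rewrite mulf_eq0 (negbTE v01) orbF.
    by rewrite mulr0 expr0n.
  apply: (mulfI v00); rewrite expr2 mulrA [v 0 0 * a]mulrC -h0.
  by rewrite mulrA h1; ring.
have mk (u w : R[i]) : (u != 0) || (w != 0) -> w * c = a * u -> u * b = a * w ->
    exists2 v : 'rV[R[i]]_2, v *m A = a *: v & v != 0.
  move=> uw h0 h1; exists (\row_j (if j == 0 then u else w)).
    by apply/vA; rewrite !mxE.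
  apply: contraTneq uw => /rowP h.
  by have := h 0; have := h 1; rewrite !mxE /= => -> ->; rewrite eqxx.
have [c0|c0] := eqVneq c 0; last first.
  by apply: (mk c a); rewrite ?c0// -expr2 abc mulrC.
have a0 : a = 0.
  by apply/eqP; move/eqP: abc; rewrite c0 mulr0 expf_eq0.
by apply: (mk 0 1); rewrite ?oner_eq0 ?orbT// ?c0 ?a0 ?mulr0 ?mul0r.
Qed.

(** The eigenvalues are the square roots of [b c] and share one modulus, so the supremum is over a
    singleton. *)
Lemma spectral_radius_antidiag (b c : R[i]) :
  spectral_radius (\matrix_(i < 2, j < 2)
    (if (i == 0) && (j == 1) then b else if (i == 1) && (j == 0) then c else 0))
  = Num.sqrt (nc b * nc c).
Proof.
rewrite /spectral_radius; set S := (X in sup X).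
suff -> : S = [set Num.sqrt (nc b * nc c)] by rewrite sup1.
have nE (a : R[i]) : a ^+ 2 = b * c -> nc a = Num.sqrt (nc b * nc c).
  move=> h; rewrite -Normc.normcM -h expr2 Normc.normcM -expr2.
  by rewrite sqrtr_sqr ger0_norm ?normc_ge0.
apply/seteqP; split => [_ [a /= + <-]|_ ->]; rewrite /S /=.
  by rewrite eigenvalue_antidiag => /eqP /nE.
exists (sqrtc (b * c)); last by apply: nE; exact: sqr_sqrtc.
by rewrite /= eigenvalue_antidiag sqr_sqrtc.
Qed.

(** A reflection of the domain exchanges the two subdomains, so the estimates of [beta1p] also cover
    [beta2m]. *)
Lemma beta2mE L d p1m p1p p2m lam :
  beta2m L d p1m p1p p2m lam = beta1p L d p2m p1p p1m lam.
Proof. by rewrite /beta1p /beta2m; congr (_ / (_ - _)); ring. Qed.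

Lemma beta1pE L d p q r lam : lam + r%:C != 0 ->
  1 + refl lam r L != 0 -> 1 + refl lam r (L + d) != 0 ->
  beta1p L d p q r lam = cexp (- (lam * d%:C)) *
    ((1 + refl lam r L) / (1 + refl lam r (L + d))) *
    ((p%:C - dtn lam r L) / (q%:C + dtn lam r (L + d))).
Proof.
move=> w0 E0 E'0; rewrite /beta1p /dtn.
set E := refl lam r L in E0 *; set E' := refl lam r (L + d) in E'0 *.
pose c := cexp (lam * L%:C); pose g := cexp (lam * d%:C).
have c0 : c != 0 by exact: cexp_neq0.
have g0 : g != 0 by exact: cexp_neq0.
have cg : cexp (lam * (L + d)%:C) = c * g by rewrite -cexpD -mulrDr -rmorphD.
have twoE (t : R) : cexp (- (lam * (2 * t)%:C)) = cexp (lam * t%:C) ^- 2.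
  rewrite cexpN expr2 -cexpD; congr (_^-1); congr cexp.
  by rewrite -mulrDr -rmorphD /=; congr (_ * _%:C); ring.
(* Eliminating [lam - r] in favour of the reflections turns the numerator into a multiple of
   [p - dtn] and the denominator into a multiple of [q + dtn]. *)
have EE : (lam - r%:C) = E * (lam + r%:C) * c ^+ 2.
  by rewrite /E /refl twoE -/c; field; rewrite c0 w0.
have EE' : (lam - r%:C) = E' * (lam + r%:C) * (c * g) ^+ 2.
  by rewrite /E' /refl twoE cg; field; rewrite c0 g0 w0.
rewrite !cexpN cg -/c -/g.
have -> : (lam + p%:C) * (lam - r%:C) * c^-1 - (lam - p%:C) * (lam + r%:C) * c
   = (lam + r%:C) * c * (1 + E) * (p%:C - lam * (1 - E) / (1 + E)).
  by rewrite EE; field; rewrite E0 c0.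
have -> : (lam + r%:C) * (lam + q%:C) * (c * g) - (lam - r%:C) * (lam - q%:C) * (c * g)^-1
   = (lam + r%:C) * (c * g) * (1 + E') * (q%:C + lam * (1 - E') / (1 + E')).
  by rewrite EE'; field; rewrite E'0 c0 g0.
set P := p%:C - _; set Q := q%:C + _.
have [->|Q0] := eqVneq Q 0; first by rewrite mulr0 !invr0 !mulr0.
by field; rewrite Q0 E'0 g0 c0 w0.
Qed.

Lemma normc_beta1p L d p q r lam : lam + r%:C != 0 ->
  1 + refl lam r L != 0 -> 1 + refl lam r (L + d) != 0 ->
  nc (beta1p L d p q r lam) = expR (- (d * re lam)) *
    (nc (1 + refl lam r L) / nc (1 + refl lam r (L + d))) *
    (nc (p%:C - dtn lam r L) / nc (q%:C + dtn lam r (L + d))).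
Proof.
move=> w0 E0 E'0; rewrite beta1pE//.
set E := refl _ _ _; set E' := refl _ _ (L + d); set A := dtn _ _ L; set A' := dtn _ _ _.
rewrite (Normc.normcM _ ((_ - _) / _)) (Normc.normcM _ (_ / _)).
rewrite (Normc.normcM (1 + E)) (Normc.normcM (_ - _)) !Normc.normcV normc_cexp.
by congr (expR _ * _ * _); rewrite !cplxE/=; ring.
Qed.

(** The fraction defining [constC] is half the sum of the two symbols brought to a common
    denominator. *)
Lemma constCE (sigma eps L pa pb : R) : 0 < sigma -> 0 < eps -> 0 < L -> 0 < pa -> 0 < pb ->
  constC L sigma eps pa pb =
  (re (dtn (symbol sigma eps 0) pa L) + re (dtn (symbol sigma eps 0) pb L)) / 2.
Proof.
move=> sigma0 eps0 L0 pa0 pb0; rewrite /constC -reD.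
set s := symbol sigma eps 0.
have s0 : 0 < re s by exact: symbol_re_gt0.
have w (r : R) : 0 < r -> s + r%:C != 0.
  move=> r0; apply/eqP => /(congr1 (fun z => re z)); rewrite cplxE/= => h.
  by have := addr_gt0 s0 r0; rewrite h ltxx.
have wa := w _ pa0; have wb := w _ pb0.
pose e := cexp (- (s * (2 * L)%:C)).
have e4 : cexp (- (s * (4 * L)%:C)) = e * e.
  rewrite -cexpD; congr cexp; rewrite -opprD -mulrDr -rmorphD /=.
  by congr (- (_ * _%:C)); ring.
have Ea : 1 + refl s pa L != 0 by apply: refl_neqN1 => //; exact: ltW.
have Eb : 1 + refl s pb L != 0 by apply: refl_neqN1 => //; exact: ltW.
rewrite e4 -/e -/s in Ea Eb *.
have ma (r : R) : s + r%:C != 0 -> 1 + refl s r L != 0 -> (s - r%:C) * e + s + r%:C != 0.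
  move=> wr; apply: contra => /eqP h; rewrite /refl -/e.
  have -> : 1 + (s - r%:C) / (s + r%:C) * e = ((s - r%:C) * e + s + r%:C) / (s + r%:C).
    by field.
  by rewrite h mul0r.
have dtnE (r : R) : s + r%:C != 0 -> (s - r%:C) * e + s + r%:C != 0 ->
  1 + refl s r L != 0 ->
  dtn s r L = s * (s + r%:C - (s - r%:C) * e) / ((s - r%:C) * e + s + r%:C).
  by move=> wr mr Er; rewrite /dtn /refl -/e in Er *; field; rewrite ?Er ?mr ?wr.
rewrite !dtnE ?ma//.
have half (z : R[i]) : re z / 2 = re (z * (2^-1)%:C) by rewrite cplxE /= mulr0 subr0.
rewrite half; congr (complex.Re _).
have -> : (2^-1)%:C = 2^-1 :> R[i] by rewrite fmorphV rmorph_nat.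
by field; rewrite !ma.
Qed.

End ConvergenceFactor.

(** * Uniform data of the iteration with two subdomains *)

Section SchwarzBounds.
Context {R : realType}.
Implicit Types (k L d x p q : R).

(* [A, B] are the Dirichlet-to-Neumann symbols of the two subdomains without
   the overlap, [A', B'] those with it; [x] is the real part of the symbol. *)
Record schwarz_bounds (K C k d x ka kb : R) (A A' B B' : R[i]) : Prop := SchwarzBounds {
  sb_x : 0 < x <= k + K;
  sb_m : (re A + re B) / 2 <= x + K;
  sb_C : C <= (re A + re B) / 2;
  sb_reA : 0 < re A; sb_reA' : 0 < re A';
  sb_reB : 0 < re B; sb_reB' : 0 < re B';
  sb_dA : nc (A' - A) <= K * d; sb_dB : nc (B' - B) <= K * d;
  sb_A : nc A <= k + K; sb_A' : nc A' <= k + K; sb_geA : k - K <= nc A;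
  sb_B : nc B <= k + K; sb_B' : nc B' <= k + K; sb_geB : k - K <= nc B;
  sb_mA : nc A <= (re A + re B) / 2 + K; sb_mB : nc B <= (re A + re B) / 2 + K;
  sb_AB : `|nc A ^+ 2 - nc B ^+ 2| <= K;
  sb_ka : 1 - K * d <= ka <= 1 + K * d; sb_kb : 1 - K * d <= kb <= 1 + K * d }.

(** [u], [v] and [n] stand for [|A|], [|B|] and [|lam|]. As [u] and [v] are within O(1 / n) of [n],
    their squares stay at bounded distance although each of them grows. *)
Lemma normr_subr_sqr_le (a b n u v K : R) : 0 <= a -> 0 <= b -> 0 <= u -> 0 <= v ->
  a * n <= K -> b * n <= K -> a + b <= K -> u <= n + a -> v <= n + b ->
  `|u - v| <= a + b -> `|u ^+ 2 - v ^+ 2| <= 4 * K + K ^+ 2.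
Proof.
move=> a0 b0 u0 v0 an bn abK una vnb uv.
rewrite subr_sqr normrM (ger0_norm (addr_ge0 u0 v0)).
have ab0 : 0 <= a + b by rewrite addr_ge0.
have h1 : `|u - v| * (u + v) <= (a + b) * (2 * n + (a + b)).
  by apply: ler_pM => //; [exact: addr_ge0|clear -una vnb; lra].
have h2 : (a + b) * (a + b) <= K * K by rewrite ler_pM.
clear -h1 h2 an bn; lra.
Qed.

Lemma schwarz_boundsP (sigma eps L pa pb : R) :
  0 < sigma -> 0 < eps -> 0 < L -> 0 < pa -> 0 < pb ->
  exists2 K : R, 1 <= K & forall k d, 0 <= k -> 0 < d -> d <= 1 ->
  exists x ka kb (A A' B B' : R[i]),
  [/\ schwarz_bounds K (constC L sigma eps pa pb) k d x ka kb A A' B B',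
      k = 0 -> (re A + re B) / 2 = constC L sigma eps pa pb &
      forall p q, convergence_factor L sigma eps pa pb d (p, q) k =
        Num.sqrt (expR (- (2 * d * x)) * (ka * kb) *
          ((nc (p%:C - B) / nc (q%:C + B')) * (nc (q%:C - A) / nc (p%:C + A'))))].
Proof.
move=> sigma0 eps0 L0 pa0 pb0.
have [Ka Ka1 boundA] := dtn_bounds sigma0 eps0 L0 pa0.
have [Kb Kb1 boundB] := dtn_bounds sigma0 eps0 L0 pb0.
pose s : R := Num.sqrt sigma; pose Y := eps / (2 * s).
have s0 : 0 < s by rewrite sqrtr_gt0.
have Y0 : 0 < Y by rewrite divr_gt0// mulr_gt0.
pose K0 := Ka + Kb.
have K01 : 2 <= K0 by rewrite /K0; lra.
(* The terms in [K0] dominate the bound [4 K0 + K0 ^ 2] coming from [normr_subr_sqr_le]. *)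
pose K := s + 2 * Y + 4 * K0 + 4 * K0 ^+ 2.
have K0K0 : 0 <= K0 ^+ 2 by exact: sqr_ge0.
exists K; first by rewrite /K; lra.
move=> k d k0 d0 d1.
have [a1 a2 a3 a4 a5] := boundA k d d0; have [b1 b2 b3 b4 b5] := boundB k d d0.
have L0' : 0 < L + d by rewrite addr_gt0.
set lam := symbol sigma eps k in a1 a2 a3 a4 a5 b1 b2 b3 b4 b5.
have x0 : 0 < re lam by exact: symbol_re_gt0.
have nE (r l : R) : 0 < r -> 0 < l -> 0 < nc (1 + refl lam r l).
  by move=> r0 l0; rewrite normc_gt0// refl_neqN1// ltW.
have w (r : R) : 0 < r -> lam + r%:C != 0.
  move=> r0; apply/eqP => /(congr1 (fun z => re z)); rewrite cplxE/= => h.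
  by have := addr_gt0 x0 r0; rewrite h ltxx.
exists (re lam), (nc (1 + refl lam pa L) / nc (1 + refl lam pa (L + d))),
  (nc (1 + refl lam pb L) / nc (1 + refl lam pb (L + d))),
  (dtn lam pa L), (dtn lam pa (L + d)), (dtn lam pb L), (dtn lam pb (L + d)).
split; last 2 first.
- by rewrite /lam => ->; rewrite constCE.
- move=> p q; rewrite /convergence_factor /iteration_matrix spectral_radius_antidiag.
  rewrite beta2mE !normc_beta1p ?w ?refl_neqN1 ?(ltW pa0) ?(ltW pb0)//= -/lam.
  congr Num.sqrt.
  have -> : - (2 * d * re lam) = - (d * re lam) + - (d * re lam) by ring.
  rewrite expRD; set e := expR _; set a := _ / _; set b := _ / _; set a' := _ / _.
  by set b' := _ / _; clearbody e a b a' b'; clear; ring.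
have kx : k <= re lam by exact: symbol_re_ge.
have xk : re lam <= k + (s + Y) by exact: symbol_re_le.
have y0 : 0 < - im lam by exact: symbol_im_lt0.
have yY : - im lam <= Y by exact: symbol_im_bound.
have xn : re lam <= nc lam by exact: re_le_normc.
have nx : nc lam <= re lam + Y.
  apply: (le_trans (normc_le lam)); rewrite (ger0_norm (ltW x0)) -normrN (ger0_norm (ltW y0)).
  by rewrite lerD2l.
have ratio (r Kr : R) : 0 < r -> Kr <= K0 ->
    nc (1 + refl lam r L) <= (1 + Kr * d) * nc (1 + refl lam r (L + d)) ->
    (1 - Kr * d) * nc (1 + refl lam r (L + d)) <= nc (1 + refl lam r L) ->
    1 - K * d <= nc (1 + refl lam r L) / nc (1 + refl lam r (L + d)) <= 1 + K * d.
  move=> r0 Kr0 h1 h2; have n1 := nE _ _ r0 L0'.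
  have h : Kr * d <= K * d by rewrite ler_wpM2r ?(ltW d0)// /K; lra.
  rewrite ler_pdivlMr// ler_pdivrMr//; apply/andP; split.
    by apply: le_trans h2; rewrite ler_wpM2r ?(ltW n1)//; lra.
  by apply: (le_trans h1); rewrite ler_wpM2r ?(ltW n1)//; lra.
have KaK0 : Ka <= K0 by rewrite /K0; lra.
have KbK0 : Kb <= K0 by rewrite /K0; lra.
have monoA := re_dtn_mono sigma0 eps0 k pa0 L0.
have monoB := re_dtn_mono sigma0 eps0 k pb0 L0.
have rA := ratio _ _ pa0 KaK0 a4 a5; have rB := ratio _ _ pb0 KbK0 b4 b5.
have reA := re_dtn_gt0 sigma0 eps0 k pa0 L0; have reA' := re_dtn_gt0 sigma0 eps0 k pa0 L0'.
have reB := re_dtn_gt0 sigma0 eps0 k pb0 L0; have reB' := re_dtn_gt0 sigma0 eps0 k pb0 L0'.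
have Cle : constC L sigma eps pa pb <= (re (dtn lam pa L) + re (dtn lam pb L)) / 2.
  by rewrite constCE// ler_wpM2r// lerD.
move: reA reA' reB reB' Cle a1 a2 a3 b1 b2 b3 {a4 a5 b4 b5 monoA monoB}.
rewrite -/lam.
move: (dtn lam pa L) (dtn lam pa (L + d)) (dtn lam pb L) (dtn lam pb (L + d)).
move=> A A' B B' reA reA' reB reB' Cle a1 a2 a3 b1 b2 b3.
have n0 := normc_ge0 lam.
have tri (z z' : R[i]) : nc z <= nc z' + nc (z - z').
  by have := le_normcD z' (z - z'); rewrite addrC subrK.
have sym (z z' : R[i]) : nc (z - z') = nc (z' - z) by rewrite -normcN opprB.
have kA := tri A lam; have kA2 := tri lam A; rewrite (sym lam) in kA2.
have kB := tri B lam; have kB2 := tri lam B; rewrite (sym lam) in kB2.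
have kA' := tri A' A; have kB' := tri B' B.
have AB := tri A B; have BA := tri B A; rewrite (sym B) in BA.
have ABl : nc (A - B) <= nc (A - lam) + nc (B - lam).
  by have := normcB_le (A - lam) (B - lam); rewrite opprB addrA subrK.
have rAl : `|re A - re lam| <= nc (A - lam).
  rewrite -reN -reD ler_norml re_le_normc andbT lerNl -reN -[leRHS]normcN.
  exact: re_le_normc.
have rBl : `|re B - re lam| <= nc (B - lam).
  rewrite -reN -reD ler_norml re_le_normc andbT lerNl -reN -[leRHS]normcN.
  exact: re_le_normc.
move: rAl rBl; rewrite !ler_norml => /andP[rA1 rA2] /andP[rB1 rB2].
have ab0 := normc_ge0 (A - lam); have bb0 := normc_ge0 (B - lam).
have nA0 := normc_ge0 A; have nB0 := normc_ge0 B; have nAB0 := normc_ge0 (A - B).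
have Ka0 : 0 <= Ka by clear -Ka1; lra.
have Kb0 : 0 <= Kb by clear -Kb1; lra.
have KaK : Ka <= K by rewrite /K; clear -KaK0 K01 K0K0 s0 Y0; lra.
have KbK : Kb <= K by rewrite /K; clear -KbK0 K01 K0K0 s0 Y0; lra.
have Kd1 : Ka * d <= Ka by rewrite ler_piMr.
have Kd2 : Kb * d <= Kb by rewrite ler_piMr.
have Kd3 : Ka * d <= K * d by rewrite ler_wpM2r ?(ltW d0).
have Kd4 : Kb * d <= K * d by rewrite ler_wpM2r ?(ltW d0).
have KabK : s + 2 * Y + 2 * (Ka + Kb) <= K.
  by rewrite -/K0 /K; clear -K01 K0K0; lra.
have nAB : `|nc A ^+ 2 - nc B ^+ 2| <= K.
  have h1 : `|nc A - nc B| <= nc (A - lam) + nc (B - lam).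
    rewrite ler_norml; apply/andP; clear -AB BA ABl; split; lra.
  apply: (le_trans (normr_subr_sqr_le (K := K0) ab0 bb0 nA0 nB0 _ _ _ kA kB h1)).
  - exact: le_trans KaK0.
  - exact: le_trans KbK0.
  - exact: lerD.
  - rewrite /K; clear -s0 Y0 K0K0; lra.
split => //.
- by apply/andP; split=> //; clear -xk KabK Ka1 Kb1 Y0; lra.
- by clear -rA2 rB2 a1 b1 KabK Ka1 Kb1 s0 Y0; lra.
- by clear -a3 Kd3; lra.
- by clear -b3 Kd4; lra.
- by clear -kA nx xk a1 KabK Ka1 Kb1 s0 Y0; lra.
- by clear -kA' a3 Kd1 kA nx xk a1 KabK Ka1 Kb1 s0 Y0; lra.
- by clear -kA2 a1 kx xn KabK Ka1 Kb1 s0 Y0; lra.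
- by clear -kB nx xk b1 KabK Ka1 Kb1 s0 Y0; lra.
- by clear -kB' b3 Kd2 kB nx xk b1 KabK Ka1 Kb1 s0 Y0; lra.
- by clear -kB2 b1 kx xn KabK Ka1 Kb1 s0 Y0; lra.
- by clear -rA1 rB1 kA nx a1 b1 KabK Ka1 Kb1 s0 Y0; lra.
- by clear -rA1 rB1 kB nx a1 b1 KabK Ka1 Kb1 s0 Y0; lra.
Qed.

End SchwarzBounds.

(** * Estimates of a single Moebius factor *)

Section Factors.
Context {R : realType}.
Implicit Types (k K L d m p q u v x : R) (A B : R[i]).

(** If [u] or [v] is at least 1, the left-hand side is nonpositive; otherwise the product of the two
    lower bounds is expanded. *)
Lemma mul_ge1B a b u v : 0 <= a -> 0 <= b -> 0 <= u -> 0 <= v ->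
  1 - u <= a -> 1 - v <= b -> 1 - (u + v) <= a * b :> R.
Proof.
move=> a0 b0 u0 v0 ua vb; have ab0 : 0 <= a * b by rewrite mulr_ge0.
have [u1|u1] := lerP 1 u; first by lra.
have [v1|v1] := lerP 1 v; first by lra.
have : (1 - u) * (1 - v) <= a * b by rewrite ler_pM//; lra.
have : 0 <= u * v by rewrite mulr_ge0.
lra.
Qed.

Lemma ratio_ge1B (P kappa N D : R) : 0 < P -> 0 <= kappa -> 0 <= N -> 0 < D ->
  P - kappa <= N -> D <= P + kappa -> 1 - 2 * kappa / P <= N / D.
Proof.
move=> P0 k0 N0 D0 PN DP; rewrite ler_pdivlMr//.
set t := 2 * kappa / P; have tP : t * P = 2 * kappa by rewrite /t divfK ?gt_eqF.
have t0 : 0 <= t by rewrite divr_ge0 ?mulr_ge0 ?(ltW P0).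
have [t1|t1] := lerP 1 t.
  have : 0 <= (t - 1) * D by rewrite mulr_ge0 ?(ltW D0) ?subr_ge0.
  lra.
have : (1 - t) * D <= (1 - t) * (P + kappa) by rewrite ler_wpM2l// subr_ge0 ltW.
have : 0 <= t * kappa by rewrite mulr_ge0.
lra.
Qed.

Lemma normc_realD p A : nc (p%:C + A) ^+ 2 = p ^+ 2 + 2 * p * re A + nc A ^+ 2.
Proof. rewrite !normc_sqr !cplxE /=; ring. Qed.

Lemma normc_realB p A : nc (p%:C - A) ^+ 2 = p ^+ 2 - 2 * p * re A + nc A ^+ 2.
Proof. by rewrite normc_realD normcN reN mulrN. Qed.

Lemma normc_realD_ge p A : 0 < re A -> p <= nc (p%:C + A).
Proof.
move=> A0; apply: le_trans (re_le_normc _); rewrite cplxE /=.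
by rewrite lerDl ltW.
Qed.

Section OneFactor.
Variables (K d m p : R) (A A' B : R[i]).
Hypotheses (K1 : 1 <= K) (d0 : 0 < d) (Kd : K * d <= 1 / 2) (p1 : 1 <= p).
Hypotheses (A0 : 0 < re A) (dA : nc (A' - A) <= K * d).
Hypothesis AB : `|nc A ^+ 2 - nc B ^+ 2| <= K.
Hypothesis mE : re A + re B = 2 * m.

Let P : R := nc (p%:C + A).
Let P' : R := nc (p%:C + A').
Let N : R := nc (p%:C - B).

Let pP : p <= P. Proof. exact: normc_realD_ge. Qed.

Let PP' : P - K * d <= P' <= P + K * d.
Proof.
have h1 := le_normcD (p%:C + A) (A' - A); have h2 := normcD_ge (p%:C + A) (A' - A).
have e : p%:C + A + (A' - A) = p%:C + A' by ring.
rewrite e in h1 h2; rewrite -/P -/P' in h1 h2; move: dA => ?.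
by apply/andP; split; lra.
Qed.

(** The identity [|p - B| ^ 2 = |p + A| ^ 2 - 4 p m + |B| ^ 2 - |A| ^ 2] is behind both estimates of
    the factor; the last difference is at most [K] in modulus. *)
Let N2 : `|N ^+ 2 - (P ^+ 2 - 4 * p * m)| <= K.
Proof.
have -> : N ^+ 2 - (P ^+ 2 - 4 * p * m) = - (nc A ^+ 2 - nc B ^+ 2).
  rewrite /N /P normc_realB normc_realD.
  have -> : 4 * p * m = 2 * p * (re A + re B) by rewrite mE; ring.
  by ring.
by rewrite normrN.
Qed.

(** By [N2] and [p <= P <= p + m + K], the square of [N / P] is at most
    [1 + K / p ^ 2 - 4 p m / (p + m + K) ^ 2], hence the exponential. Passing from [P] to [P'] costs
    the factor [exp (4 K d)]. *)
Lemma factor_sqr_le : 0 <= m -> nc A <= m + K ->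
  (N / P') ^+ 2 <= expR (4 * K * d + K / p ^+ 2 - 4 * (p * m / (p + m + K) ^+ 2)).
Proof.
move=> m0 Am; have := N2; rewrite ler_norml => /andP[_ N2'].
move: K1 d0 Kd p1 pP PP' => K1' d0' Kd' p1' pP' /andP[PP1 PP2].
have p0 : 0 < p by lra.
have P0 : 0 < P by lra.
have Kd0 : 0 <= K * d by rewrite mulr_ge0//; lra.
have Ppm : P <= p + m + K.
  have := le_normcD p%:C A; rewrite normc_real ger0_norm; last lra.
  by rewrite -/P; lra.
have iP' : P'^-1 <= expR (2 * K * d) * P^-1.
  have h1 : (1 - K * d) * P <= P'.
    have : 0 <= K * d * (P - 1) by rewrite mulr_ge0//; lra.
    lra.
  have P'0 : 0 < P' by apply: lt_le_trans h1; rewrite mulr_gt0//; lra.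
  rewrite ler_pdivlMr// mulrC ler_pdivrMr//.
  have h2 : 1 + 2 * (K * d) <= expR (2 * K * d) by have := expR_ge1Dx (2 * K * d); lra.
  apply: (@le_trans _ _ ((1 + 2 * (K * d)) * ((1 - K * d) * P))).
    have : 0 <= P * (K * d * (1 - 2 * (K * d))) by rewrite !mulr_ge0//; lra.
    lra.
  by rewrite ler_pM ?mulr_ge0//; lra.
have N0 : 0 <= N by exact: normc_ge0.
have P'0 : 0 <= P' by exact: normc_ge0.
have h1 : N / P' <= expR (2 * K * d) * (N / P).
  by rewrite mulrCA ler_wpM2l.
have h2 : (N / P') ^+ 2 <= (expR (2 * K * d) * (N / P)) ^+ 2.
  by rewrite lerXn2r// nnegrE ?mulr_ge0 ?invr_ge0 ?expR_ge0 ?(ltW P0).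
apply: (le_trans h2); rewrite exprMn -expRM_natl.
have -> : 4 * K * d + K / p ^+ 2 - 4 * (p * m / (p + m + K) ^+ 2) =
  2%:R * (2 * K * d) + (K / p ^+ 2 - 4 * (p * m / (p + m + K) ^+ 2)) by ring.
rewrite expRD ler_wpM2l ?expR_ge0//.
apply: le_trans (expR_ge1Dx _).
rewrite expr_div_n ler_pdivrMr ?exprn_gt0//.
have i1 : K <= K / p ^+ 2 * P ^+ 2.
  rewrite mulrAC ler_pdivlMr ?exprn_gt0// ler_wpM2l//; first lra.
  by rewrite lerXn2r// nnegrE ltW.
have pmK0 : 0 < p + m + K by lra.
have pm0 : 0 <= p * m by rewrite mulr_ge0 ?(ltW p0).
have i2 : p * m / (p + m + K) ^+ 2 * P ^+ 2 <= p * m.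
  rewrite mulrAC ler_pdivrMr ?exprn_gt0// ler_wpM2l//.
  by rewrite lerXn2r// nnegrE ltW.
lra.
Qed.

Lemma factor_sqr_ge : 0 <= m ->
  1 - (2 * K * d + (4 * m / p + K / p ^+ 2)) <= (N / P') ^+ 2.
Proof.
move=> m0; have := N2; rewrite ler_norml => /andP[N2' _].
move: K1 d0 Kd p1 pP PP' => K1' d0' Kd' p1' pP' /andP[PP1 PP2].
have p0 : 0 < p by lra.
have P0 : 0 < P by lra.
have Kd0 : 0 <= K * d by rewrite mulr_ge0//; lra.
have N0 : 0 <= N by exact: normc_ge0.
have P'0 : 0 < P' by lra.
have iP' : (1 - K * d) * P^-1 <= P'^-1.
  rewrite ler_pdivrMr// [_^-1 * _]mulrC ler_pdivlMr//.
  have : (1 - K * d) * P' <= (1 - K * d) * ((1 + K * d) * P).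
    rewrite ler_wpM2l//; first lra.
    have : 0 <= K * d * (P - 1) by rewrite mulr_ge0//; lra.
    lra.
  have : 0 <= (K * d) ^+ 2 * P by rewrite mulr_ge0 ?sqr_ge0 ?(ltW P0).
  lra.
have h1 : (1 - K * d) * (N / P) <= N / P' by rewrite mulrCA ler_wpM2l.
have h2 : ((1 - K * d) * (N / P)) ^+ 2 <= (N / P') ^+ 2.
  rewrite lerXn2r// nnegrE ?mulr_ge0 ?invr_ge0 ?(ltW P0) ?(ltW P'0)//; lra.
apply: le_trans h2; rewrite exprMn.
have Kp0 : 0 <= 4 * m / p + K / p ^+ 2.
  by rewrite addr_ge0// divr_ge0 ?mulr_ge0 ?exprn_ge0 ?(ltW p0)//; lra.
apply: mul_ge1B; rewrite ?sqr_ge0//; first by rewrite -mulrA mulr_ge0.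
  have : 0 <= (K * d) ^+ 2 by exact: sqr_ge0.
  lra.
rewrite expr_div_n ler_pdivlMr ?exprn_gt0//.
have i1 : K <= K / p ^+ 2 * P ^+ 2.
  rewrite mulrAC ler_pdivlMr ?exprn_gt0// ler_wpM2l//; first lra.
  by rewrite lerXn2r// nnegrE ltW.
have i2 : 4 * p * m <= 4 * m / p * P ^+ 2.
  rewrite [leRHS]mulrAC ler_pdivlMr//.
  have : 4 * m * p ^+ 2 <= 4 * m * P ^+ 2.
    by rewrite ler_wpM2l ?mulr_ge0// lerXn2r// nnegrE ltW.
  lra.
lra.
Qed.

End OneFactor.

(** The factor is close to 1 as soon as one of [p] and [k] dominates the other; the two values of
    [v] measure the deviation in these two regimes. *)
Lemma factor_ge (K k p v : R) (A' B : R[i]) : 0 <= K -> 0 < k -> 0 < p -> 0 < re A' ->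
  nc A' <= k + K -> nc B <= k + K -> k - K <= nc B ->
  v = 2 * (k + K) / p \/ v = 2 * (p + K) / k ->
  0 <= v /\ 1 - v <= nc (p%:C - B) / nc (p%:C + A').
Proof.
move=> K0 k0 p0 A'0 A'k Bk kB vE.
have D0 : 0 < nc (p%:C + A') by apply: lt_le_trans (normc_realD_ge _ A'0).
have Dle : nc (p%:C + A') <= p + nc A'.
  by have := le_normcD p%:C A'; rewrite normc_real gtr0_norm.
have N1 : p - nc B <= nc (p%:C - B).
  by have := normcD_ge p%:C (- B); rewrite normc_real gtr0_norm// normcN.
have N2 : nc B - p <= nc (p%:C - B).
  have := normcD_ge (- B) p%:C; rewrite normc_real gtr0_norm// normcN.
  by rewrite [- B + _]addrC.
have N0 := normc_ge0 (p%:C - B).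
case: vE => ->; split.
- by rewrite divr_ge0 ?(ltW p0)// mulr_ge0// addr_ge0// ltW.
- by apply: ratio_ge1B => //; lra.
- by rewrite divr_ge0 ?(ltW k0)// mulr_ge0// addr_ge0// ltW.
- by apply: ratio_ge1B => //; lra.
Qed.

(** A crude bound, by which the convergence factor is bounded on the frequency range. *)
Lemma factor_le (K k p : R) (A' B : R[i]) : 0 < p -> 0 < re A' -> nc B <= k + K ->
  nc (p%:C - B) / nc (p%:C + A') <= (p + (k + K)) / p.
Proof.
move=> p0 A'0 Bk; have D0 := normc_realD_ge p A'0.
have N1 : nc (p%:C - B) <= p + (k + K).
  have := normcB_le p%:C B; rewrite normc_real gtr0_norm//; lra.
by rewrite ler_pM ?normc_ge0 ?invr_ge0 ?normc_ge0// lef_pV2 ?posrE// (lt_le_trans p0).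
Qed.

End Factors.

(** * The convergence factor at a fixed frequency *)

Section Assembly.
Context {R : realType}.
Implicit Types (k d m p q v w x : R).

Lemma le_of_sqr_sqr (u W T : R) : 0 <= u -> W ^+ 2 = u -> u <= expR (4 * T) -> Num.sqrt W <= expR T.
Proof.
move=> u0 Wu uT; apply: le_of_sqr; first exact: expR_ge0.
have [W0|W0] := lerP 0 W; last by rewrite ltr0_sqrtr// expr0n sqr_ge0.
rewrite sqr_sqrtr//; apply: le_of_sqr; first exact: sqr_ge0.
by rewrite Wu (le_trans uT)// -exprM -expRM_natl.
Qed.

(** The four estimates serve in turn for the boundedness over the frequency range, the upper bound,
    the lower bound at frequency 0 and the lower bound at positive frequencies. The third concerns
    [rho ^ 4] because [factor_sqr_ge] estimates the squares of the factors of [rho ^ 2]. *)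
Lemma convergence_factor_bounds (sigma eps L pa pb : R) :
  0 < sigma -> 0 < eps -> 0 < L -> 0 < pa -> 0 < pb ->
  let C := constC L sigma eps pa pb in
  let rho := convergence_factor L sigma eps pa pb in
  exists2 K : R, 1 <= K & forall k d, 0 <= k -> 0 < d -> K * d <= 1 / 2 ->
  exists m, [/\ C <= m, (k = 0 -> m = C) & forall p q, 0 < p -> 0 < q ->
  [/\ 0 <= rho d (p, q) k <= 1 + 4 * ((p + (k + K)) / p * ((q + (k + K)) / q)),
      1 <= p -> 1 <= q -> rho d (p, q) k <=
        expR (4 * K * d + K / p ^+ 2 + K / q ^+ 2
              - (p * m / (p + m + K) ^+ 2 + q * m / (q + m + K) ^+ 2 + m * d)),
      1 <= p -> 1 <= q ->
        1 - (4 * d * (k + K) + 8 * K * d + 4 * m / p + 4 * m / q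
             + K / p ^+ 2 + K / q ^+ 2) <= rho d (p, q) k ^+ 4
    & forall v w, 0 < k -> v = 2 * (k + K) / p \/ v = 2 * (p + K) / k ->
        w = 2 * (k + K) / q \/ w = 2 * (q + K) / k ->
        1 - (2 * d * (k + K) + 2 * K * d + v + w) <= rho d (p, q) k ^+ 2]].
Proof.
move=> sigma0 eps0 L0 pa0 pb0 C rho.
have [K K1 HK] := schwarz_boundsP sigma0 eps0 L0 pa0 pb0.
exists K => // k d k0 d0 Kd.
have d1 : d <= 1 by have : 0 <= (K - 1) * d; [rewrite mulr_ge0 ?subr_ge0 ?(ltW d0)|lra].
have [x [ka [kb [A [A' [B [B' [sb kC rhoE]]]]]]]] := HK k d k0 d0 d1.
case: sb => /andP[x0 xk] mx mC A0 A'0 B0 B'0 dA dB Ak A'k kA Bk B'k kB mA mB AB.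
move=> /andP[ka1 ka2] /andP[kb1 kb2].
have K0 : 0 <= K by lra.
have Kd0 : 0 <= K * d by rewrite mulr_ge0// ltW.
have dx0 : 0 <= d * x by rewrite mulr_ge0 ?ltW.
have dxk : d * x <= d * (k + K) by rewrite ler_wpM2l// ltW.
exists ((re A + re B) / 2); split => // p q p0 q0.
have m0 : 0 <= (re A + re B) / 2 by rewrite divr_ge0 ?addr_ge0 ?(ltW A0) ?(ltW B0).
have f1le := factor_le p0 A'0 Bk; have f2le := factor_le q0 B'0 Ak.
have f10 : 0 <= nc (p%:C - B) / nc (p%:C + A') by rewrite divr_ge0 ?normc_ge0.
have f20 : 0 <= nc (q%:C - A) / nc (q%:C + B') by rewrite divr_ge0 ?normc_ge0.
pose f1 : R := nc (p%:C - B) / nc (p%:C + A').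
pose f2 : R := nc (q%:C - A) / nc (q%:C + B').
pose e : R := expR (- (2 * d * x)).
have e0 : 0 < e by exact: expR_gt0.
have e1 : e <= 1 by rewrite expR_le1 oppr_le0; lra.
have e2 : 1 - 2 * d * x <= e by exact: expR_ge1Dx.
have ka0 : 0 <= ka by lra.
have kb0 : 0 <= kb by lra.
pose W := e * (ka * kb) * (f1 * f2).
have W0 : 0 <= W.
  by apply: mulr_ge0; apply: mulr_ge0 => //; [exact: ltW|exact: mulr_ge0].
have rhoW : rho d (p, q) k = Num.sqrt W.
  by rewrite /rho rhoE /W /f1 /f2 -/e; congr (Num.sqrt (_ * _)); rewrite mulrACA [in RHS]mulrACA; congr (_ * _); rewrite mulrC.
have rho2 : rho d (p, q) k ^+ 2 = W by rewrite rhoW sqr_sqrtr.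
have kab : 1 - (K * d + K * d) <= ka * kb by apply: mul_ge1B.
have e0' := ltW e0.
have kk0 : 0 <= ka * kb by exact: mulr_ge0.
have ddx0 : 0 <= 2 * d * x by rewrite -mulrA mulr_ge0.
have dx2 := addr_ge0 ddx0 ddx0.
have Kd2 := addr_ge0 Kd0 Kd0; have Kd4 := addr_ge0 Kd2 Kd2.
have m2 : re A + re B = 2 * ((re A + re B) / 2) by rewrite mulrC divfK// pnatr_eq0.
have m2' : re B + re A = 2 * ((re A + re B) / 2) by rewrite addrC.
have BA : `|nc B ^+ 2 - nc A ^+ 2| <= K by rewrite distrC.
have sU1 (p1 : 1 <= p) := factor_sqr_le K1 d0 Kd p1 A0 dA AB m2 m0 mA.
have sU2 (q1 : 1 <= q) := factor_sqr_le K1 d0 Kd q1 B0 dB BA m2' m0 mB.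
have sL1 (p1 : 1 <= p) := factor_sqr_ge K1 d0 Kd p1 A0 dA AB m2 m0.
have sL2 (q1 : 1 <= q) := factor_sqr_ge K1 d0 Kd q1 B0 dB BA m2' m0.
have sV1 v (kp : 0 < k) := @factor_ge _ K k p v A' B K0 kp p0 A'0 A'k Bk kB.
have sV2 v (kp : 0 < k) := @factor_ge _ K k q v B' A K0 kp q0 B'0 B'k Ak kA.
have eE : e ^+ 2 = expR (- (4 * d * x)).
  by rewrite /e -expRM_natl; congr expR; ring.
rewrite -/f1 -/f2 in f10 f20 f1le f2le sU1 sU2 sL1 sL2 sV1 sV2.
clear rhoE HK; clearbody e f1 f2.
split.
- rewrite rhoW sqrtr_ge0 /=; apply: le_of_sqr.
    by rewrite addr_ge0// !mulr_ge0 ?invr_ge0 ?addr_ge0 ?(ltW p0) ?(ltW q0).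
  rewrite sqr_sqrtr//.
  set U := 4 * _.
  have WU : W <= U.
    rewrite /W /U ler_pM ?mulr_ge0 ?(ltW e0)//; last by rewrite ler_pM.
    have k4 : ka * kb <= 2 * 2.
      have Kd1 : 1 + K * d <= 2 by lra.
      by rewrite ler_pM// (le_trans _ Kd1).
    have : e * (ka * kb) <= 1 * (2 * 2) by rewrite ler_pM ?mulr_ge0 ?(ltW e0).
    by clear; lra.
  have := sqr_ge0 U; clear -WU W0; lra.
- move=> p1 q1; rewrite rhoW; apply: (@le_of_sqr_sqr (W ^+ 2)); rewrite ?sqr_ge0//.
  have s1 := sU1 p1; have s2 := sU2 q1.
  have -> : W ^+ 2 = e ^+ 2 * (ka * kb) ^+ 2 * (f1 ^+ 2 * f2 ^+ 2) by rewrite /W; ring.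
  have kE (t : R) : 0 <= t -> t <= 1 + K * d -> t ^+ 2 <= expR (2 * K * d).
    move=> t0 t1; have -> : 2 * K * d = 2%:R * (K * d) by ring.
    rewrite expRM_natl lerXn2r// ?nnegrE ?expR_ge0//.
    by apply: (le_trans t1); exact: expR_ge1Dx.
  have k2 : (ka * kb) ^+ 2 <= expR (2 * K * d) * expR (2 * K * d).
    by rewrite exprMn ler_pM ?sqr_ge0// kE.
  have ff : f1 ^+ 2 * f2 ^+ 2 <= _ := ler_pM (sqr_ge0 _) (sqr_ge0 _) s1 s2.
  have ek := ler_wpM2l (sqr_ge0 e) k2.
  apply: (le_trans (ler_pM _ _ ek ff)); [exact: mulr_ge0 (sqr_ge0 _) (sqr_ge0 _)..|].
  rewrite eE -!expRD ler_expR.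
  (* [m <= x + K] trades the decay in [x] for decay in [m], at the cost of [4 K d] in the
     exponent. *)
  have : 0 <= d * (x + K - (re A + re B) / 2) by rewrite mulr_ge0 ?(ltW d0) ?subr_ge0.
  have : 0 <= K / p ^+ 2 by rewrite divr_ge0 ?sqr_ge0.
  have : 0 <= K / q ^+ 2 by rewrite divr_ge0 ?sqr_ge0.
  clear; set a := p * _ / _; set b := q * _ / _; set m := (re A + re B) / 2.
  set a' := K / _; set b' := K / _.
  by clearbody a b m a' b'; lra.
- move=> p1 q1.
  have s1 := sL1 p1; have s2 := sL2 q1.
  have -> : rho d (p, q) k ^+ 4 = e * e * ((ka * kb) * (ka * kb)) * (f1 ^+ 2 * f2 ^+ 2).
    by rewrite (exprM _ 2 2) rho2 /W; ring.
  have cK (t : R) : 0 < t -> 0 <= 2 * K * d + (4 * ((re A + re B) / 2) / t + K / t ^+ 2).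
    move=> t0; apply: addr_ge0; first by rewrite -mulrA mulr_ge0.
    apply: addr_ge0; last by rewrite divr_ge0 ?sqr_ge0.
    by apply: divr_ge0; [exact: mulr_ge0|exact: ltW].
  have u1 : 1 - ((2 * d * x + 2 * d * x) + ((K * d + K * d) + (K * d + K * d)))
      <= e * e * ((ka * kb) * (ka * kb)).
    have ee : 1 - (2 * d * x + 2 * d * x) <= e * e.
      exact: mul_ge1B.
    have kk : 1 - ((K * d + K * d) + (K * d + K * d)) <= (ka * kb) * (ka * kb).
      exact: mul_ge1B.
    by apply: mul_ge1B => //; exact: mulr_ge0.
  have u2 := mul_ge1B (sqr_ge0 f1) (sqr_ge0 f2) (cK _ p0) (cK _ q0) s1 s2.
  have u3 := mul_ge1B _ _ _ _ u1 u2.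
  apply: le_trans (u3 _ _ _ _); first last.
  + by rewrite addr_ge0 ?cK.
  + exact: addr_ge0.
  + exact: mulr_ge0 (sqr_ge0 _) (sqr_ge0 _).
  + by apply: mulr_ge0; exact: mulr_ge0.
  have := dxk; clear.
  set a := _ / p; set b := _ / q; set a' := K / _; set b' := K / _.
  by clearbody a b a' b'; lra.
- move=> v w kp vE wE; rewrite rho2 /W.
  have [v0 s1] := sV1 _ kp vE; have [w0 s2] := sV2 _ kp wE.
  have u1 : 1 - (2 * d * x + (K * d + K * d)) <= e * (ka * kb).
    exact: mul_ge1B.
  have u2 : 1 - (v + w) <= f1 * f2 by exact: mul_ge1B.
  apply: (@le_trans _ _ (1 - ((2 * d * x + (K * d + K * d)) + (v + w)))).
    by have := dxk; clear; lra.
  by apply: mul_ge1B => //; [exact: mulr_ge0..|exact: addr_ge0|exact: addr_ge0].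
Qed.

End Assembly.

Local Close Scope complex_scope.

(** * Asymptotics of the min-max problem *)

Section Equioscillation.
Context {R : realType}.
Implicit Types (a b c d k m p q t u v w x K C : R) (r : R -> R).

Lemma expRN_le t : 0 <= t -> expR (- t) <= 1 - t + t ^+ 2.
Proof.
move=> t0; rewrite expRN; have t1 : 0 < 1 + t by lra.
apply: (@le_trans _ _ (1 + t)^-1).
  by rewrite lef_pV2 ?posrE ?expR_gt0// expR_ge1Dx.
rewrite -[leLHS]mul1r ler_pdivrMr//.
have : 0 <= t ^+ 3 by rewrite exprn_ge0.
lra.
Qed.

Lemma amgm_le s u t : 0 <= s -> 0 <= u -> 0 <= t -> s * u = t ^+ 2 / 4 -> t <= s + u :> R.
Proof.
move=> s0 u0 t0 su; apply: le_of_sqr; first exact: addr_ge0.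
have : 0 <= (s - u) ^+ 2 by exact: sqr_ge0.
lra.
Qed.

(** In terms of [u = b / a <= 1] the expression is [u / (1 + u + K / a) ^ 2]: it is at least [u] up
    to a quadratic error when [u] is O(t), and at least [t] otherwise. *)
Lemma mobius_ge a b K K1 t : 0 < b -> b <= a -> 0 <= K -> K <= a -> 0 < t ->
  K / a <= K1 * t -> t <= a * b / (a + b + K) ^+ 2 \/
  b / a - (162 + 18 * K1) * t ^+ 2 <= a * b / (a + b + K) ^+ 2.
Proof.
move=> b0 ba K0 Ka t0; have a0 : 0 < a by exact: lt_le_trans ba.
have -> : a * b / (a + b + K) ^+ 2 = b / a / (1 + (b / a + K / a)) ^+ 2.
  by field; rewrite !gt_eqF//; lra.
set u := b / a; set z := K / a => zt.
have u0 : 0 < u by rewrite divr_gt0.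
have u1 : u <= 1 by rewrite ler_pdivrMr// mul1r.
have z0 : 0 <= z by rewrite divr_ge0// ltW.
have z1 : z <= 1 by rewrite ler_pdivrMr// mul1r.
clearbody u z.
have w0 : 0 < (1 + (u + z)) ^+ 2 by rewrite exprn_gt0//; lra.
(* The denominator is at most [3 ^ 2], whence the threshold [9 t]; below it [2 u ^ 2] and [2 u z]
   are at most [162 t ^ 2] and [18 K1 t ^ 2]. *)
have [ut|ut] := lerP (9 * t) u.
  left; rewrite ler_pdivlMr//.
  have h : (1 + (u + z)) ^+ 2 <= 3 ^+ 2 by rewrite lerXn2r ?nnegrE//; lra.
  have : t * (1 + (u + z)) ^+ 2 <= t * 3 ^+ 2 by rewrite ler_wpM2l// ltW.
  lra.
right; rewrite ler_pdivlMr//.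
have h1 : u * u <= (9 * t) * (9 * t) by rewrite ler_pM ?(ltW u0) ?(ltW ut).
have h2 : u * z <= (9 * t) * (K1 * t) by rewrite ler_pM ?(ltW u0) ?(ltW ut).
have h3 : u - (162 + 18 * K1) * t ^+ 2 <= u * (1 - 2 * (u + z)) by lra.
apply: (@le_trans _ _ (u * (1 - 2 * (u + z)) * (1 + (u + z)) ^+ 2)).
  by rewrite ler_wpM2r// ltW.
rewrite -mulrA ler_piMr ?(ltW u0)//.
set w := u + z; have wp : 0 <= w by rewrite addr_ge0 ?(ltW u0).
have : 0 <= w ^+ 2 by exact: sqr_ge0.
have : 0 <= w ^+ 3 by rewrite exprn_ge0.
lra.
Qed.

(** For [m <= p] each quotient is about [m / p >= C / p = t / 2]. For [m > p] the sum is about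
    [2 p / m + m d], whose terms have product [2 p d = t ^ 2 / 4]. Thus [p] balances the two ranges
    at the common minimum [t]. *)
Lemma mobius_sum_ge1 p d C K m t : 0 < C -> 0 < t -> 0 <= K -> 0 < p -> K <= p -> C <= m ->
  0 <= d -> C / p = t / 2 -> p * d = t ^+ 2 / 8 ->
  t - 2 * (162 + 18 * (K / (2 * C))) * t ^+ 2 <=
  p * m / (p + m + K) ^+ 2 + p * m / (p + m + K) ^+ 2 + m * d.
Proof.
move=> C0 t0 K0 p0 Kp Cm d0 Cp pd; have m0 : 0 < m by exact: lt_le_trans Cm.
have KpE : K / p = K / (2 * C) * t.
  have -> : t = 2 * (C / p) by rewrite Cp mulrC divfK.
  by field; rewrite !gt_eqF.
have md0 : 0 <= m * d by rewrite mulr_ge0 ?(ltW m0).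
have K1 : 0 <= K / (2 * C) by rewrite divr_ge0 ?mulr_ge0 ?(ltW C0).
move: (K / (2 * C)) KpE K1 => K1 KpE K10.
have KK : 0 <= K1 * t ^+ 2 by rewrite mulr_ge0 ?sqr_ge0.
have tt : 0 <= t ^+ 2 by exact: sqr_ge0.
have [mp|pm] := lerP m p.
  have u : t / 2 <= m / p by rewrite -Cp ler_wpM2r ?invr_ge0 ?(ltW p0).
  have := @mobius_ge p m K K1 t m0 mp K0 Kp t0; rewrite KpE => /(_ (lexx _)).
  by case; lra.
have Km : K / m <= K1 * t.
  by rewrite -KpE ler_wpM2l// lef_pV2 ?posrE// ltW.
have := @mobius_ge m p K K1 t p0 (ltW pm) K0 (le_trans Kp (ltW pm)) t0 Km.
have -> : m * p / (m + p + K) ^+ 2 = p * m / (p + m + K) ^+ 2 by rewrite (mulrC m) (addrC m).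
have u : t <= 2 * (p / m) + m * d.
  have pm0 : 0 <= p / m by rewrite divr_ge0 ?(ltW p0) ?(ltW m0).
  apply: amgm_le; [exact: mulr_ge0|exact: md0|exact: ltW|].
  have -> : 2 * (p / m) * (m * d) = 2 * (p * d) by field; rewrite gt_eqF.
  by rewrite pd; field.
by case; lra.
Qed.

(** The leading part of the sum is [m / q] for [m <= q], then [m / p + q / m] up to [m = p], then
    [p / m + m d]. The first is at least [C / q = t], and the terms of the other two have product
    [t ^ 2 / 4]. *)
Lemma mobius_sum_ge2 p q d C K m t : 0 < C -> 0 < t -> 0 <= K -> 0 < q -> q <= p -> K <= q ->
  C <= m -> 0 <= d -> C / q = t -> q / p = t ^+ 2 / 4 -> p * d = t ^+ 2 / 4 ->
  t - 2 * (162 + 18 * (K / C)) * t ^+ 2 <=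
  p * m / (p + m + K) ^+ 2 + q * m / (q + m + K) ^+ 2 + m * d.
Proof.
move=> C0 t0 K0 q0 qp Kq Cm d0 Cq qpt pd; have m0 : 0 < m by exact: lt_le_trans Cm.
have p0 : 0 < p by exact: lt_le_trans qp.
have KqE : K / q = K / C * t by rewrite -Cq; field; rewrite !gt_eqF.
have md0 : 0 <= m * d by rewrite mulr_ge0 ?(ltW m0).
have K1 : 0 <= K / C by rewrite divr_ge0 ?(ltW C0).
move: (K / C) KqE K1 => K1 KqE K10.
have KK : 0 <= K1 * t ^+ 2 by rewrite mulr_ge0 ?sqr_ge0.
have tt : 0 <= t ^+ 2 by exact: sqr_ge0.
have Ka a : q <= a -> K / a <= K1 * t.
  by move=> qa; rewrite -KqE ler_wpM2l// lef_pV2 ?posrE// (lt_le_trans q0).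
have X0 a b : 0 < a -> 0 < b -> 0 <= a * b / (a + b + K) ^+ 2.
  move=> a0 b0; apply: divr_ge0; last exact: sqr_ge0.
  by rewrite mulr_ge0 ?(ltW a0) ?(ltW b0).
have comm a b : a * b / (a + b + K) ^+ 2 = b * a / (b + a + K) ^+ 2.
  by rewrite (mulrC a) (addrC a).
have P0 := X0 p m p0 m0; have Q0 := X0 q m q0 m0.
have [mq|qm] := lerP m q.
  have u : t <= m / q by rewrite -Cq ler_wpM2r ?invr_ge0 ?(ltW q0).
  by have [] := @mobius_ge q m K K1 t m0 mq K0 Kq t0 (Ka _ (lexx _)); lra.
have Km := Ka _ (ltW qm); have Kqm := le_trans Kq (ltW qm).
have Hq := @mobius_ge m q K K1 t q0 (ltW qm) K0 Kqm t0 Km.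
rewrite comm in Hq.
have [mp|pm] := lerP m p.
  have Hp := @mobius_ge p m K K1 t m0 mp K0 (le_trans Kq qp) t0 (Ka _ qp).
  have u : t <= m / p + q / m.
    apply: amgm_le => //; rewrite ?divr_ge0 ?(ltW p0) ?(ltW m0) ?(ltW q0) ?(ltW t0)//.
    by rewrite -qpt; field; rewrite !gt_eqF.
  by case: Hp; case: Hq; lra.
have Hp := @mobius_ge m p K K1 t p0 (ltW pm) K0 Kqm t0 Km.
rewrite comm in Hp.
have u : t <= p / m + m * d.
  apply: amgm_le => //; rewrite ?divr_ge0 ?(ltW p0) ?(ltW m0) ?(ltW t0)//.
  by rewrite -pd; field; rewrite gt_eqF.
by case: Hp; lra.
Qed.

(** For [w] in [[0, 1]] the square root of [1 - w] is at least [1 - w / 2 - w ^ 2 / 2]; for larger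
    [w] this bound is negative. *)
Lemma sqrt_lower c a t x : 0 <= c -> 0 <= a -> 0 < t -> t <= 1 -> 0 <= x ->
  1 - (2 * c * t + a * t ^+ 2) <= x ^+ 2 ->
  1 - (c * t + (a / 2 + (2 * c + a) ^+ 2 / 2) * t ^+ 2) <= x.
Proof.
move=> c0 a0 t0 t1 x0 h.
set w := 2 * c * t + a * t ^+ 2 in h.
have tt : t ^+ 2 <= t by rewrite expr2 ler_piMr// ltW.
have w0 : 0 <= w by rewrite addr_ge0 ?mulr_ge0 ?sqr_ge0 ?(ltW t0).
have wt : w <= (2 * c + a) * t.
  have : 0 <= a * (t - t ^+ 2) by rewrite mulr_ge0// subr_ge0.
  by rewrite /w; lra.
have ww : w ^+ 2 <= ((2 * c + a) * t) ^+ 2.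
  by rewrite lerXn2r// nnegrE (le_trans w0).
apply: (@le_trans _ _ (1 - (w / 2 + w ^+ 2 / 2))).
  by rewrite exprMn in ww; rewrite {1}/w; lra.
have [w1|w1] := lerP w 1; last first.
  have : 1 * 1 <= w * w by rewrite ler_pM// ltW.
  lra.
apply: le_of_sqr => //; apply: le_trans h.
have z0 : 0 <= w / 2 + w ^+ 2 / 2 by have := sqr_ge0 w; lra.
have zw : w / 2 + w ^+ 2 / 2 <= w.
  have : w * w <= w * 1 by rewrite ler_wpM2l.
  lra.
have : (w / 2 + w ^+ 2 / 2) ^+ 2 <= w ^+ 2 by rewrite lerXn2r.
lra.
Qed.

(** Second-order constant after two applications of [sqrt_lower], with [c = 2] and then [c = 1]. *)
Definition root4_const a := (a / 2 + (4 + a) ^+ 2 / 2) / 2 + (2 + (a / 2 + (4 + a) ^+ 2 / 2)) ^+ 2 / 2.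

Lemma root4_lower a t x : 0 <= a -> 0 < t -> t <= 1 -> 0 <= x ->
  1 - (4 * t + a * t ^+ 2) <= x ^+ 4 -> 1 - (t + root4_const a * t ^+ 2) <= x.
Proof.
move=> a0 t0 t1 x0 h.
have h1 := @sqrt_lower 2 a t (x ^+ 2) _ a0 t0 t1 (sqr_ge0 _) _.
have {}h1 : 1 - (2 * t + (a / 2 + (4 + a) ^+ 2 / 2) * t ^+ 2) <= x ^+ 2.
  have -> : 4 + a = 2 * 2 + a by lra.
  by apply: h1; [lra|rewrite -exprM; have -> : 2 * 2 * t = 4 * t by lra].
have b0 : 0 <= a / 2 + (4 + a) ^+ 2 / 2.
  by have : 0 <= (4 + a) ^+ 2; [exact: sqr_ge0|lra].
have := @sqrt_lower 1 _ t x ler01 b0 t0 t1 x0.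
by rewrite !mulr1 mul1r; exact.
Qed.

End Equioscillation.

(** * Second-order bounds in terms of the leading term [t] *)

Section Asymptotics.
Context {R : realType}.
Variables (C K : R) (rho : R -> R * R -> R -> R).
Hypotheses (C0 : 0 < C) (K1 : 1 <= K).
Hypothesis H : forall k d, 0 <= k -> 0 < d -> K * d <= 1 / 2 ->
  exists m, [/\ C <= m, (k = 0 -> m = C) & forall p q, 0 < p -> 0 < q ->
  [/\ 0 <= rho d (p, q) k <= 1 + 4 * ((p + (k + K)) / p * ((q + (k + K)) / q)),
      1 <= p -> 1 <= q -> rho d (p, q) k <=
        expR (4 * K * d + K / p ^+ 2 + K / q ^+ 2
              - (p * m / (p + m + K) ^+ 2 + q * m / (q + m + K) ^+ 2 + m * d)),
      1 <= p -> 1 <= q ->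
        1 - (4 * d * (k + K) + 8 * K * d + 4 * m / p + 4 * m / q
             + K / p ^+ 2 + K / q ^+ 2) <= rho d (p, q) k ^+ 4
    & forall v w, 0 < k -> v = 2 * (k + K) / p \/ v = 2 * (p + K) / k ->
        w = 2 * (k + K) / q \/ w = 2 * (q + K) / k ->
        1 - (2 * d * (k + K) + 2 * K * d + v + w) <= rho d (p, q) k ^+ 2]].
Implicit Types (d k m p q t u v w x : R).

Lemma le_1B_of_expR a t x e : 0 <= a -> 0 < t -> a * t <= 1 -> e <= expR (- x) ->
  t - a * t ^+ 2 <= x -> e <= 1 - t + (a + 1) * t ^+ 2 :> R.
Proof.
move=> a0 t0 at1 ex tx.
set v := t - a * t ^+ 2.
have at0 : 0 <= a * t ^+ 2 by rewrite mulr_ge0 ?sqr_ge0.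
have v0 : 0 <= v.
  have : 0 <= t * (1 - a * t) by rewrite mulr_ge0 ?(ltW t0) ?subr_ge0.
  by rewrite /v; lra.
have vt : v <= t by rewrite /v; lra.
apply: (le_trans ex); apply: (@le_trans _ _ (expR (- v))).
  by rewrite ler_expR lerN2.
apply: (le_trans (expRN_le v0)).
have vv : v ^+ 2 <= t ^+ 2 by rewrite lerXn2r// nnegrE (le_trans v0).
by rewrite {1}/v; lra.
Qed.

Lemma overlap_small t d : 0 < t -> t <= 1 -> K * t <= C -> d <= t / (16 * C) ->
  K * d <= 1 / 2.
Proof.
move=> t0 t1 Kt dt; have K0 : 0 <= K by move: K1 => ?; lra.
have h : K * d <= K * (t / (16 * C)) by rewrite ler_wpM2l.
apply: (le_trans h).
by rewrite mulrA ler_pdivrMr ?mulr_gt0 ?C0//; move: C0 => ?; lra.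
Qed.

Lemma pow_le1 t n : 0 < t -> t <= 1 -> t ^+ n.+1 <= t.
Proof. by move=> t0 t1; rewrite exprS ler_piMr ?(ltW t0)// exprn_ile1 ?(ltW t0). Qed.

Lemma pow_le2 t n : 0 < t -> t <= 1 -> t ^+ n.+2 <= t ^+ 2.
Proof.
move=> t0 t1; rewrite -addn2 exprD ler_piMl ?sqr_ge0//.
by rewrite exprn_ile1 ?(ltW t0).
Qed.

(** The summands are the second-order errors from [mobius_sum_ge1], from [4 K d] and from the two
    terms [K / p ^ 2] at the optimal [p]. *)
Definition upper_const1 := 2 * (162 + 18 * (K / (2 * C))) + K / (4 * C) + K / (2 * C ^+ 2).

Lemma one_sided_upper t k : 0 < t -> t <= 1 -> K * t <= C -> upper_const1 * t <= 1 ->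
  0 <= k -> rho (t ^+ 3 / (16 * C)) (2 * C / t, 2 * C / t) k
    <= 1 - t + (upper_const1 + 1) * t ^+ 2.
Proof.
move=> t0 t1 Kt at1 k0; have K0 : 0 < K by move: K1 => ?; lra.
have C0' := C0; have K1' := K1.
set d := t ^+ 3 / (16 * C); set p := 2 * C / t.
have d0 : 0 < d by rewrite divr_gt0 ?exprn_gt0 ?mulr_gt0.
have dt : d <= t / (16 * C) by rewrite ler_wpM2r ?pow_le1// invr_ge0 mulr_ge0 ?(ltW C0).
have p0 : 0 < p by rewrite divr_gt0 ?mulr_gt0.
have Kp : K <= p by rewrite ler_pdivlMr//; lra.
have [m [Cm _ /(_ p p p0 p0)[_ up _ _]]] := H k0 d0 (overlap_small t0 t1 Kt dt).
have p1 : 1 <= p by lra.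
have {}up := up p1 p1.
have Cp : C / p = t / 2 by rewrite /p; field; rewrite !gt_eqF.
have pd : p * d = t ^+ 2 / 8 by rewrite /p /d; field; rewrite !gt_eqF.
have S := mobius_sum_ge1 C0 t0 (ltW K0) p0 Kp Cm (ltW d0) Cp pd.
have a0 : 0 <= upper_const1.
  rewrite /upper_const1; have := divr_ge0 (ltW K0) (ltW (mulr_gt0 (ltr0n R 2) C0)).
  have := divr_ge0 (ltW K0) (ltW (mulr_gt0 (ltr0n R 4) C0)).
  have := divr_ge0 (ltW K0) (ltW (mulr_gt0 (ltr0n R 2) (exprn_gt0 2 C0))).
  lra.
set X := p * m / _ + _ + _ in up S.
apply: (@le_1B_of_expR upper_const1 t (X - (4 * K * d + K / p ^+ 2 + K / p ^+ 2))) => //.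
  by rewrite opprB.
have e1 : 4 * K * d <= K / (4 * C) * t ^+ 2.
  have -> : 4 * K * d = K / (4 * C) * t ^+ 3 by rewrite /d; field; rewrite !gt_eqF.
  by rewrite ler_wpM2l ?pow_le2// divr_ge0 ?mulr_ge0 ?(ltW K0) ?(ltW C0).
have e2 : K / p ^+ 2 = K / (2 * C ^+ 2) * t ^+ 2 / 2.
  by rewrite /p; field; rewrite !gt_eqF.
rewrite /upper_const1; move: S e1; rewrite e2; clearbody X d.
set a := K / (2 * C); set b := K / (4 * C); set c := K / (2 * _).
by clearbody a b c; lra.
Qed.

Definition upper_const2 := 2 * (162 + 18 * (K / C)) + K / (4 * C) + 2 * (K / C ^+ 2).

Lemma two_sided_upper t k : 0 < t -> t <= 1 -> K * t <= C -> upper_const2 * t <= 1 ->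
  0 <= k -> rho (t ^+ 5 / (16 * C)) (4 * C / t ^+ 3, C / t) k
    <= 1 - t + (upper_const2 + 1) * t ^+ 2.
Proof.
move=> t0 t1 Kt at1 k0; have K0 : 0 < K by move: K1 => ?; lra.
have C0' := C0; have K1' := K1.
set d := t ^+ 5 / (16 * C); set p := 4 * C / t ^+ 3; set q := C / t.
have d0 : 0 < d by rewrite divr_gt0 ?exprn_gt0 ?mulr_gt0.
have dt : d <= t / (16 * C) by rewrite ler_wpM2r ?pow_le1// invr_ge0 mulr_ge0 ?(ltW C0).
have p0 : 0 < p by rewrite divr_gt0 ?exprn_gt0 ?mulr_gt0.
have q0 : 0 < q by rewrite divr_gt0.
have Kq : K <= q by rewrite ler_pdivlMr.
have qp : q <= p.
  have -> : p = q * (4 / t ^+ 2) by rewrite /p /q; field; rewrite !gt_eqF.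
  rewrite ler_peMr ?(ltW q0)// ler_pdivlMr ?exprn_gt0// mul1r.
  by have := pow_le1 1 t0 t1; lra.
have [m [Cm _ /(_ p q p0 q0)[_ up _ _]]] := H k0 d0 (overlap_small t0 t1 Kt dt).
have q1 : 1 <= q by lra.
have p1 : 1 <= p by lra.
have {}up := up p1 q1.
have Cq : C / q = t by rewrite /q; field; rewrite !gt_eqF.
have qpt : q / p = t ^+ 2 / 4 by rewrite /p /q; field; rewrite !gt_eqF.
have pd : p * d = t ^+ 2 / 4 by rewrite /p /d; field; rewrite !gt_eqF.
have S := mobius_sum_ge2 C0 t0 (ltW K0) q0 qp Kq Cm (ltW d0) Cq qpt pd.
have a0 : 0 <= upper_const2.
  rewrite /upper_const2; have := divr_ge0 (ltW K0) (ltW C0).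
  have := divr_ge0 (ltW K0) (ltW (mulr_gt0 (ltr0n R 4) C0)).
  have := divr_ge0 (ltW K0) (ltW (exprn_gt0 2 C0)).
  lra.
set X := p * m / _ + _ + _ in up S.
apply: (@le_1B_of_expR upper_const2 t (X - (4 * K * d + K / p ^+ 2 + K / q ^+ 2))) => //.
  by rewrite opprB.
have e1 : 4 * K * d <= K / (4 * C) * t ^+ 2.
  have -> : 4 * K * d = K / (4 * C) * t ^+ 5 by rewrite /d; field; rewrite !gt_eqF.
  by rewrite ler_wpM2l ?pow_le2// divr_ge0 ?mulr_ge0 ?(ltW K0) ?(ltW C0).
have e2 : K / q ^+ 2 = K / C ^+ 2 * t ^+ 2 by rewrite /q; field; rewrite !gt_eqF.
have e3 : K / p ^+ 2 <= K / q ^+ 2.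
  by rewrite ler_wpM2l ?(ltW K0)// lef_pV2 ?posrE ?exprn_gt0// lerXn2r// nnegrE ltW.
rewrite /upper_const2; move: S e1 e3; rewrite e2; clearbody X d.
set a := K / C; set b := K / (4 * C); set c := K / _ ^+ 2; set c' := K / p ^+ 2.
by clearbody a b c c'; lra.
Qed.

(** These constants collect the second-order terms of all cases below, so that a single [low_const]
    serves for one and two parameters and at every test frequency. *)
Definition low_const4 := K / C + 1 + 2 * (K / C ^+ 2) + 8 * C + 2 * K.
Definition low_const2 := 1 + C^-1 + 3 * (K / C).
Definition low_const := root4_const low_const4
  + (low_const2 / 2 + (2 + low_const2) ^+ 2 / 2).

Lemma low_from_power4 t x w : 0 < t -> t <= 1 -> 0 <= x -> 1 - w <= x ^+ 4 ->
  w <= 4 * t + low_const4 * t ^+ 2 -> 1 - (t + low_const * t ^+ 2) <= x.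
Proof.
move=> t0 t1 x0 xw wt; have K0 : 0 < K by move: K1 => ?; lra.
have a0 : 0 <= low_const4.
  rewrite /low_const4; have := divr_ge0 (ltW K0) (ltW C0).
  have := divr_ge0 (ltW K0) (ltW (exprn_gt0 2 C0)).
  have C0' := C0; lra.
have b0 : 0 <= (2 + low_const2) ^+ 2 by exact: sqr_ge0.
have b1 : 0 <= low_const2.
  rewrite /low_const2; have := divr_ge0 (ltW K0) (ltW C0).
  have : 0 <= C^-1 by rewrite invr_ge0 (ltW C0).
  lra.
have h : 1 - (t + root4_const low_const4 * t ^+ 2) <= x.
  by apply: root4_lower => //; lra.
have : 0 <= (low_const2 / 2 + (2 + low_const2) ^+ 2 / 2) * t ^+ 2.
  by rewrite mulr_ge0 ?sqr_ge0//; lra.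
by rewrite /low_const; lra.
Qed.

Lemma low_from_square t x w : 0 < t -> t <= 1 -> 0 <= x -> 1 - w <= x ^+ 2 ->
  w <= 2 * t + low_const2 * t ^+ 2 -> 1 - (t + low_const * t ^+ 2) <= x.
Proof.
move=> t0 t1 x0 xw wt; have K0 : 0 < K by move: K1 => ?; lra.
have b1 : 0 <= low_const2.
  rewrite /low_const2; have := divr_ge0 (ltW K0) (ltW C0).
  have : 0 <= C^-1 by rewrite invr_ge0 (ltW C0).
  lra.
have h : 1 - (1 * t + (low_const2 / 2 + (2 * 1 + low_const2) ^+ 2 / 2) * t ^+ 2) <= x.
  by apply: sqrt_lower => //; lra.
rewrite !mulr1 !mul1r in h.
have r0 : 0 <= root4_const low_const4.
  rewrite /root4_const.
  have a0 : 0 <= low_const4.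
    rewrite /low_const4; have := divr_ge0 (ltW K0) (ltW C0).
    have := divr_ge0 (ltW K0) (ltW (exprn_gt0 2 C0)).
    have C0' := C0; lra.
  have := sqr_ge0 (2 + (low_const4 / 2 + (4 + low_const4) ^+ 2 / 2)).
  have := sqr_ge0 (4 + low_const4).
  by set u := (4 + _) ^+ 2; set u' := (2 + _) ^+ 2; clearbody u u'; lra.
have : 0 <= root4_const low_const4 * t ^+ 2 by rewrite mulr_ge0 ?sqr_ge0.
by rewrite /low_const; lra.
Qed.

Lemma div_le_cross a b c p : 0 < p -> 0 < b -> 0 <= a -> b <= p -> a / b = c -> a / p <= c :> R.
Proof. by move=> p0 b0 a0 bp <-; rewrite ler_wpM2l// lef_pV2 ?posrE. Qed.

Lemma Kt_le t n : 0 < t -> t <= 1 -> K / C * t ^+ n.+2 <= K / C * t ^+ 2.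
Proof.
move=> t0 t1; rewrite ler_wpM2l ?pow_le2// divr_ge0 ?(ltW C0)//.
by move: K1 => ?; lra.
Qed.

Lemma one_sided_lower t p : 0 < t -> t <= 1 -> K * t <= C -> 0 < p ->
  exists2 k, 0 <= k <= 8 * C / t ^+ 2 &
    1 - (t + low_const * t ^+ 2) <= rho (t ^+ 3 / (16 * C)) (p, p) k.
Proof.
move=> t0 t1 Kt p0; have K0 : 0 < K by move: K1 => ?; lra.
have C0' := C0; have K1' := K1.
set d := t ^+ 3 / (16 * C).
have d0 : 0 < d by rewrite divr_gt0 ?exprn_gt0 ?mulr_gt0.
have dt : d <= t / (16 * C) by rewrite ler_wpM2r ?pow_le1// invr_ge0 mulr_ge0 ?(ltW C0).
have Kd := overlap_small t0 t1 Kt dt.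
have KC0 : 0 < K / C by rewrite divr_gt0.
have Kt3 := Kt_le 1 t0 t1.
have KdE : K * d = K / C * t ^+ 3 / 16 by rewrite /d; field; rewrite gt_eqF.
have KC0t : 0 <= K / C * t ^+ 2 by rewrite mulr_ge0 ?sqr_ge0 ?(ltW KC0).
have tt0 : 0 <= t ^+ 2 by exact: sqr_ge0.
have k80 : 0 < 8 * C / t ^+ 2 by rewrite divr_gt0 ?exprn_gt0 ?mulr_gt0.
have KCC : 0 <= K / C ^+ 2 * t ^+ 2 by rewrite mulr_ge0 ?sqr_ge0// divr_ge0 ?sqr_ge0 ?(ltW K0).
have Ct0 : 0 <= C * t ^+ 2 by rewrite mulr_ge0 ?sqr_ge0 ?(ltW C0).
have Ktt0 : 0 <= K * t ^+ 2 by rewrite mulr_ge0 ?sqr_ge0 ?(ltW K0).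
have Cit : 0 <= C^-1 * t ^+ 2 by rewrite mulr_ge0 ?sqr_ge0// invr_ge0 (ltW C0).
(* If [p] is at least its optimal value, frequency 0 is tested, where [m = C] and each of the two
   terms [4 m / p] is at most [2 t]. *)
have [pp|pp] := lerP (2 * C / t) p.
  exists 0; first by rewrite lexx/= ltW.
  have [m [_ /(_ erefl) -> /(_ p p p0 p0)[/andP[r0 _] _ low _]]] := H (lexx 0) d0 Kd.
  have P0 : 0 < 2 * C / t by rewrite divr_gt0 ?mulr_gt0.
  have Kp : K <= 2 * C / t by rewrite ler_pdivlMr//; lra.
  have p1 : 1 <= p by lra.
  apply: (low_from_power4 t0 t1 r0 (low p1 p1)).
  have i1 : 4 * C / p <= 2 * t.
    by apply: (div_le_cross p0 P0) => //; [lra|field; rewrite !gt_eqF].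
  have i2 : K / p ^+ 2 <= K / C ^+ 2 * t ^+ 2 / 4.
    apply: (@div_le_cross _ ((2 * C / t) ^+ 2)); rewrite ?exprn_gt0 ?(ltW K0)//.
      by rewrite lerXn2r// nnegrE ltW.
    by field; rewrite !gt_eqF.
  rewrite /low_const4; move: KdE Kt3 i1 i2 KC0t KCC Ct0 Ktt0 tt0; rewrite add0r.
  set a := 4 * C / p; set b := K / p ^+ 2; set e := K / C; set f := K / C ^+ 2.
  have -> : 4 * d * K = 4 * (K * d) by ring.
  have -> : 8 * K * d = 8 * (K * d) by ring.
  by clearbody a b e f => ->; lra.
(* For smaller [p] the test frequency is the minimiser of [2 p / m + m d] at the optimal [p]. To
   leading order the overlap contributes [t] there and each factor at most [t / 2]. *)
exists (8 * C / t ^+ 2); first by rewrite lexx ltW.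
set k := 8 * C / t ^+ 2 in k80 *.
have [m [_ _ /(_ p p p0 p0)[/andP[r0 _] _ _ low]]] := H (ltW k80) d0 Kd.
apply: (low_from_square t0 t1 r0 (low _ _ k80 (or_intror erefl) (or_intror erefl))).
have i1 : 2 * (p + K) / k <= t / 2 + K / C * t ^+ 2 / 4.
  apply: (@le_trans _ _ (2 * (2 * C / t + K) / k)).
    by rewrite ler_wpM2r ?invr_ge0 ?(ltW k80)//; lra.
  by rewrite /k le_eqVlt; apply/orP; left; apply/eqP; field; rewrite !gt_eqF.
have i2 : 2 * d * (k + K) = t + 2 * (K * d).
  by rewrite /k /d; field; rewrite !gt_eqF.
rewrite /low_const2 i2; move: KdE Kt3 i1 KC0t tt0 Cit.
have -> : 2 * K * d = 2 * (K * d) by ring.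
set a := 2 * _ / k; set e := K / C; set g := C^-1.
by clearbody a e g => ->; lra.
Qed.

(** The factor is abstracted as a function [r] of the frequency alone, so that the lemma applies
    after an exchange of [p] and [q]. *)
Lemma two_sided_lower_core t p q r : 0 < t -> t <= 1 -> K * t <= C -> 0 < q -> q <= p ->
  (forall k, 0 <= k -> 0 <= r k) ->
  let d := t ^+ 5 / (16 * C) in
  (1 <= p -> 1 <= q -> 1 - (4 * d * (0 + K) + 8 * K * d + 4 * C / p + 4 * C / q
     + K / p ^+ 2 + K / q ^+ 2) <= r 0 ^+ 4) ->
  (forall k v w, 0 < k -> v = 2 * (k + K) / p \/ v = 2 * (p + K) / k ->
     w = 2 * (k + K) / q \/ w = 2 * (q + K) / k ->
     1 - (2 * d * (k + K) + 2 * K * d + v + w) <= r k ^+ 2) ->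
  exists2 k, 0 <= k <= 8 * C / t ^+ 4 & 1 - (t + low_const * t ^+ 2) <= r k.
Proof.
move=> t0 t1 Kt q0 qp r0 d low4 low2; have K0 : 0 < K by move: K1 => ?; lra.
have C0' := C0; have K1' := K1; have p0 : 0 < p by exact: lt_le_trans qp.
have d0 : 0 < d by rewrite divr_gt0 ?exprn_gt0 ?mulr_gt0.
have KC0 : 0 < K / C by rewrite divr_gt0.
have Kt5 := Kt_le 3 t0 t1; have Kt4 := Kt_le 2 t0 t1; have Kt3 := Kt_le 1 t0 t1.
have KdE : K * d = K / C * t ^+ 5 / 16 by rewrite /d; field; rewrite gt_eqF.
have KC0t : 0 <= K / C * t ^+ 2 by rewrite mulr_ge0 ?sqr_ge0 ?(ltW KC0).
have tt0 : 0 <= t ^+ 2 by exact: sqr_ge0.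
have t2le1 : t ^+ 2 <= 1 by rewrite exprn_ile1 ?(ltW t0).
have k80 : 0 < 8 * C / t ^+ 4 by rewrite divr_gt0 ?exprn_gt0 ?mulr_gt0.
have KCC : 0 <= K / C ^+ 2 * t ^+ 2 by rewrite mulr_ge0 ?sqr_ge0// divr_ge0 ?sqr_ge0 ?(ltW K0).
have Ct0 : 0 <= C * t ^+ 2 by rewrite mulr_ge0 ?sqr_ge0 ?(ltW C0).
have Ktt0 : 0 <= K * t ^+ 2 by rewrite mulr_ge0 ?sqr_ge0 ?(ltW K0).
have Cit : 0 <= C^-1 * t ^+ 2 by rewrite mulr_ge0 ?sqr_ge0// invr_ge0 (ltW C0).
have t3 := pow_le2 1 t0 t1; have t4 := pow_le2 2 t0 t1.
have at0 a b : 4 * C / p <= a -> 4 * C / q <= b -> 1 <= q ->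
    K / p ^+ 2 <= K / q ^+ 2 -> a + b + 2 * (K / q ^+ 2) <=
    4 * t + (1 + 2 * (K / C ^+ 2) + 8 * C + 2 * K) * t ^+ 2 ->
    exists2 k, 0 <= k <= 8 * C / t ^+ 4 & 1 - (t + low_const * t ^+ 2) <= r k.
  move=> pa qb q1 pq abt; exists 0; first by rewrite lexx/= ltW.
  apply: (low_from_power4 t0 t1 (r0 _ (lexx 0)) (low4 (le_trans q1 qp) q1)).
  rewrite /low_const4; move: KdE Kt5 pa qb pq abt KC0t; rewrite add0r.
  have -> : 4 * d * K = 4 * (K * d) by ring.
  have -> : 8 * K * d = 8 * (K * d) by ring.
  set a' := 4 * C / p; set b' := 4 * C / q; set e := K / C; set f := K / C ^+ 2.
  set g := K / p ^+ 2; set h := K / q ^+ 2.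
  by clearbody a' b' e f g h => ->; lra.
have pq2 : K / p ^+ 2 <= K / q ^+ 2.
  by rewrite ler_wpM2l ?(ltW K0)// lef_pV2 ?posrE ?exprn_gt0// lerXn2r// nnegrE ltW.
have kcase k v w V W : 0 < k -> k <= 8 * C / t ^+ 4 ->
    v = 2 * (k + K) / p \/ v = 2 * (p + K) / k ->
    w = 2 * (k + K) / q \/ w = 2 * (q + K) / k -> v <= V -> w <= W ->
    2 * d * k + V + W <= 2 * t + (1 + C^-1 + 2 * (K / C)) * t ^+ 2 ->
    exists2 k, 0 <= k <= 8 * C / t ^+ 4 & 1 - (t + low_const * t ^+ 2) <= r k.
  move=> k0 kle vE wE vV wW VW; exists k; first by rewrite ltW.
  apply: (low_from_square t0 t1 (r0 _ (ltW k0)) (low2 _ _ _ k0 vE wE)).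
  rewrite /low_const2; move: KdE Kt5 vV wW VW KC0t.
  have -> : 2 * d * (k + K) = 2 * d * k + 2 * (K * d) by ring.
  have -> : 2 * K * d = 2 * (K * d) by ring.
  set e := K / C; set g := C^-1; set dk := 2 * d * k.
  by clearbody e g dk => ->; lra.
have Q0 : 0 < C / t by rewrite divr_gt0.
have [pp|pp] := lerP (4 * C / t ^+ 3) p.
  have P0 : 0 < 4 * C / t ^+ 3 by rewrite divr_gt0 ?exprn_gt0 ?mulr_gt0.
  have [qq|qq] := lerP (C / t) q.
    have Kq : K <= C / t by rewrite ler_pdivlMr.
    apply: (at0 (t ^+ 3) (4 * t)) => //.
    - by apply: (div_le_cross p0 P0) => //; [lra|field; rewrite !gt_eqF].
    - by apply: (div_le_cross q0 Q0) => //; [lra|field; rewrite !gt_eqF].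
    - by lra.
    have : K / q ^+ 2 <= K / C ^+ 2 * t ^+ 2.
      apply: (@div_le_cross _ ((C / t) ^+ 2)); rewrite ?exprn_gt0 ?(ltW K0)//.
        by rewrite lerXn2r// nnegrE ltW.
      by field; rewrite !gt_eqF.
    move: t3 Ct0 Ktt0; set g := K / q ^+ 2; set f := K / C ^+ 2.
    by clearbody f g; lra.
  (* With [p] large enough but [q] too small, the test frequency is the geometric mean of the two
     optimal parameters; each factor deviates from 1 by at most [t] to leading order. *)
  have k0 : 0 < 2 * C / t ^+ 2 by rewrite divr_gt0 ?exprn_gt0 ?mulr_gt0.
  set k := 2 * C / t ^+ 2 in k0.
  have kE : k = 2 * C * t ^+ 2 / t ^+ 4 by rewrite /k; field; rewrite !gt_eqF.
  have kle : k <= 8 * C / t ^+ 4.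
    rewrite kE ler_wpM2r ?invr_ge0 ?exprn_ge0 ?(ltW t0)//.
    have : C * t ^+ 2 <= C * 1 by rewrite ler_wpM2l ?(ltW C0).
    lra.
  apply: (kcase k _ _ (t + K / C * t ^+ 3 / 2) (t + K / C * t ^+ 2) k0 kle
    (or_introl erefl) (or_intror erefl)).
  - apply: (div_le_cross p0 P0) => //; first lra.
    by rewrite /k; field; rewrite !gt_eqF.
  - apply: (@le_trans _ _ (2 * (C / t + K) / k)).
      by rewrite ler_wpM2r ?invr_ge0 ?(ltW k0)//; lra.
    by rewrite /k le_eqVlt; apply/orP; left; apply/eqP; field; rewrite !gt_eqF.
  have -> : 2 * d * k = t ^+ 3 / 4 by rewrite /d /k; field; rewrite !gt_eqF.
  move: t3 Kt3 Cit KC0t tt0; set e := K / C; set g := C^-1.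
  by clearbody e g; lra.
(* [t ^- 2] is of intermediate order between the optimal [q] and [p]. For [q] below it, the test
   frequency minimises [p / m + m d] at the optimal [p], and [q] contributes only O(t ^ 2). *)
have [qq|qq] := lerP q (t ^- 2).
  set k := 8 * C / t ^+ 4 in k80.
  apply: (kcase k _ _ (t + K / C * t ^+ 4 / 4) (C^-1 * t ^+ 2 / 4 + K / C * t ^+ 4 / 4) k80 (lexx _)
    (or_intror erefl) (or_intror erefl)).
  - apply: (@le_trans _ _ (2 * (4 * C / t ^+ 3 + K) / k)).
      by rewrite ler_wpM2r ?invr_ge0 ?(ltW k80)//; lra.
    by rewrite /k le_eqVlt; apply/orP; left; apply/eqP; field; rewrite !gt_eqF.
  - apply: (@le_trans _ _ (2 * (t ^- 2 + K) / k)).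
      by rewrite ler_wpM2r ?invr_ge0 ?(ltW k80)//; lra.
    by rewrite /k le_eqVlt; apply/orP; left; apply/eqP; field; rewrite !gt_eqF.
  have -> : 2 * d * k = t by rewrite /d /k; field; rewrite !gt_eqF.
  move: Kt4 Cit KC0t tt0; set e := K / C; set g := C^-1.
  by clearbody e g; lra.
(* Otherwise [p] and [q] both exceed [t ^- 2], and at frequency 0 the factor is already
   [1 - O(t ^ 2)]. *)
have T0 : 0 < t ^- 2 by rewrite invr_gt0 exprn_gt0.
have T1 : 1 <= t ^- 2 by rewrite -[1]invr1 lef_pV2 ?posrE ?exprn_gt0.
apply: (at0 (4 * C * t ^+ 2) (4 * C * t ^+ 2)) => //.
- apply: (div_le_cross p0 T0); rewrite ?invrK//; first lra.
  by apply: le_trans qp; exact: ltW.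
- by apply: (div_le_cross q0 T0); rewrite ?invrK ?(ltW qq)//; lra.
- by lra.
have : K / q ^+ 2 <= K * t ^+ 4.
  apply: (@div_le_cross _ (t ^- 2 ^+ 2)); rewrite ?exprn_gt0 ?(ltW K0)//.
    by rewrite lerXn2r ?nnegrE ?(ltW T0) ?(ltW q0) ?(ltW qq).
  by field; rewrite gt_eqF.
have : K * t ^+ 4 <= K * t ^+ 2 by rewrite ler_wpM2l ?(ltW K0).
move: tt0 KCC t0; set g := K / q ^+ 2; set f := K / C ^+ 2.
by clearbody f g; lra.
Qed.

(** The estimates are symmetric in [p] and [q], which reduces the claim to [q <= p]. *)
Lemma two_sided_lower t p q : 0 < t -> t <= 1 -> K * t <= C -> 0 < p -> 0 < q ->
  exists2 k, 0 <= k <= 8 * C / t ^+ 4 &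
    1 - (t + low_const * t ^+ 2) <= rho (t ^+ 5 / (16 * C)) (p, q) k.
Proof.
move=> t0 t1 Kt p0 q0; have K0 : 0 < K by move: K1 => ?; lra.
set d := t ^+ 5 / (16 * C).
have d0 : 0 < d by rewrite divr_gt0 ?exprn_gt0 ?mulr_gt0 ?C0.
have dt : d <= t / (16 * C) by rewrite ler_wpM2r ?pow_le1// invr_ge0 mulr_ge0 ?(ltW C0).
have Kd := overlap_small t0 t1 Kt dt.
have r0 k (k0 : 0 <= k) : 0 <= rho d (p, q) k.
  by have [m [_ _ /(_ p q p0 q0)[/andP[]]]] := H k0 d0 Kd.
have low2 k v w (k0 : 0 < k) := let: ex_intro m (And3 _ _ h) := H (ltW k0) d0 Kd in
  let: And4 _ _ _ l := h p q p0 q0 in l v w k0.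
have [m [_ /(_ erefl) -> /(_ p q p0 q0)[_ _ low4 _]]] := H (lexx 0) d0 Kd.
have [qp|pq] := lerP q p.
  exact: (two_sided_lower_core t0 t1 Kt q0 qp r0 low4 low2).
apply: (two_sided_lower_core t0 t1 Kt p0 (ltW pq) r0) => [q1 p1|k v w k0 hv hw].
  rewrite -/d; apply: le_trans (low4 p1 q1); rewrite le_eqVlt; apply/orP; left.
  by apply/eqP; ring.
rewrite -/d; apply: le_trans (low2 k w v k0 hw hv); rewrite le_eqVlt; apply/orP; left.
by apply/eqP; ring.
Qed.

End Asymptotics.

(** * From two-sided bounds to asymptotic optimality *)

Section MinMax.
Context {R : realType}.
Implicit Types (A : set (R * R)) (F : R -> R * R -> R) (q : R -> R * R) (tau : R -> R).

(** The two bounds pin both [F d (q d)] and the infimum to [1 - tau + O(tau ^ 2)], so their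
    difference is negligible against [1 - inf], which is of order [tau]. *)
Lemma optimized_of_bounds A F q tau (g : R -> R) (b c : R) : 0 <= c ->
  (forall d, 0 < d -> tau d ^+ 2 = b * g d) -> (forall d, 0 <= g d) ->
  (forall e : R, 0 < e -> \forall d \near 0^'+, 0 < tau d < e) ->
  (\forall d \near 0^'+, [/\ A (q d), F d (q d) <= 1 - tau d + c * tau d ^+ 2 &
     forall w, A w -> 1 - (tau d + c * tau d ^+ 2) <= F d w]) ->
  asymptotically_optimized A F q /\
  (fun d => F d (q d)) = (fun d => 1 - tau d) +O_zero_right g.
Proof.
move=> c0 tg g0 tau0 H; split; last first.
  apply/eqaddOP; near=> k; near=> d.
  have [Aq up low] : [/\ A (q d), F d (q d) <= 1 - tau d + c * tau d ^+ 2 &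
     forall w, A w -> 1 - (tau d + c * tau d ^+ 2) <= F d w] by near: d; exact: H.
  have low' := low _ Aq.
  have d0 : 0 < d by near: d; exact: nbhs_right_gt.
  rewrite /= (ger0_norm (g0 d)).
  apply: (@le_trans _ _ (c * tau d ^+ 2)).
    by rewrite -[X in `|X|]/(F d (q d) - (1 - tau d)) ler_norml; apply/andP; split; lra.
  by rewrite tg// mulrA ler_wpM2r//; near: k; apply: nbhs_pinfty_ge; exact: num_real.
split; first by apply: filterS H => d [].
apply/eqaddoP => e e0; near=> d.
have [Aq up low] : [/\ A (q d), F d (q d) <= 1 - tau d + c * tau d ^+ 2 &
   forall w, A w -> 1 - (tau d + c * tau d ^+ 2) <= F d w] by near: d; exact: H.
(* This threshold yields [key]; the summand 1 keeps the denominator positive when [c = 0]. *)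
have /andP[t0 te] : 0 < tau d < e / (2 * c * (1 + e) + 1).
  by near: d; apply: tau0; rewrite divr_gt0//; have := mulr_ge0 c0 (ltW e0); lra.
have low' := low _ Aq.
set I := inf [set F d w | w in A].
have Ile : I <= F d (q d).
  apply: ge_inf; last by exists (q d).
  by exists (1 - (tau d + c * tau d ^+ 2)) => _ [w Aw <-]; exact: low.
have Ige : 1 - (tau d + c * tau d ^+ 2) <= I.
  by apply: lb_le_inf => [|_ [w Aw <-]]; [exists (F d (q d)), (q d)|exact: low].
rewrite -[X in `|X| <= _]/(1 - F d (q d) - (1 - I)) -[X in _ * `|X|]/(1 - I).
have -> : 1 - F d (q d) - (1 - I) = I - F d (q d) by ring.
have key : 2 * c * tau d ^+ 2 <= e * (tau d - c * tau d ^+ 2).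
  have te' : tau d * (2 * c * (1 + e) + 1) < e.
    by rewrite -ltr_pdivlMr//; have := mulr_ge0 c0 (ltW e0); lra.
  have h1 : 0 <= c * e * tau d by rewrite !mulr_ge0// ltW.
  have h2 : 0 <= tau d * (e - 2 * c * tau d - c * e * tau d).
    by rewrite mulr_ge0 ?(ltW t0)//; lra.
  lra.
have It : tau d - c * tau d ^+ 2 <= 1 - I by lra.
apply: (@le_trans _ _ (2 * c * tau d ^+ 2)).
  by rewrite ler_norml; apply/andP; split; lra.
apply: (le_trans key); rewrite ler_wpM2l ?(ltW e0)//.
exact: le_trans It (ler_norm _).
Unshelve. all: by end_near. Qed.

(** The largest frequency is at least of order [1 / h], hence of order [1 / d]. The test
    frequencies, of orders [d ^ (- 2 / 3)] and [d ^ (- 4 / 5)], therefore lie in the range for small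
    [d]. *)
Lemma mesh_frequency (Lhat : R) (h M : R -> R) : 0 < Lhat ->
  (forall d : R, 0 < d -> 0 < h d) -> (forall d : R, 0 < d -> 0 < M d) ->
  h =O_zero_right (fun d : R => d) -> M =Theta_zero_right (fun d : R => (h d)^-1) ->
  exists2 c : R, 0 < c & \forall d \near 0^'+, c / d <= M d * pi / Lhat.
Proof.
move=> Lhat0 h0 M0 /eqO_exP[k k0 hO]; rewrite eqThetaE qualifE => /asboolP.
move=> [[k1 k2] /= /andP[k10 k20] MT].
exists (k1 / k * pi / Lhat).
  by apply: divr_gt0 => //; apply: mulr_gt0; [exact: divr_gt0|exact: pi_gt0].
near=> d.
have d0 : 0 < d by near: d; exact: nbhs_right_gt.
have : `|h d| <= k * `|d| by near: d; exact: hO.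
rewrite (gtr0_norm (h0 _ d0)) (gtr0_norm d0) => hk.
have [+ _] : k1 * `|(h d)^-1| <= `|M d| /\ `|M d| <= k2 * `|(h d)^-1| by near: d; exact: MT.
rewrite (gtr0_norm (M0 _ d0)) gtr0_norm ?invr_gt0 ?h0// => Mh.
have -> : k1 / k * pi / Lhat / d = k1 / (k * d) * pi / Lhat.
  by field; rewrite !gt_eqF.
rewrite ler_wpM2r ?invr_ge0 ?(ltW Lhat0)// ler_wpM2r ?pi_ge0//.
apply: le_trans Mh; rewrite ler_wpM2l ?(ltW k10)//.
by rewrite lef_pV2 ?posrE ?mulr_gt0 ?h0.
Unshelve. all: by end_near. Qed.

Lemma powR_near (c a e : R) : 0 < c -> 0 < a -> 0 < e ->
  \forall d \near 0^'+, 0 < c * d `^ a < e.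
Proof.
move=> c0 a0 e0; near=> d.
have d0 : 0 < d by near: d; exact: nbhs_right_gt.
rewrite mulr_gt0 ?powR_gt0//= mulrC -ltr_pdivlMr//.
by near: d; apply: (cvgr_lt 0 (powR_cvg0 a0)); rewrite divr_gt0.
Unshelve. all: by end_near. Qed.

Lemma powR_inv_natX (x : R) (n m : nat) : 0 <= x ->
  (x `^ (1 / n.+1%:R)) ^+ m = x `^ (m%:R / n.+1%:R).
Proof.
by move=> x0; rewrite -powR_mulrn ?powR_ge0// -powRrM mul1r mulrC.
Qed.

End MinMax.

Section MaxFactor.
Context {R : realType}.
Variables (L sigma eps pa pb : R).
Local Notation rho := (convergence_factor L sigma eps pa pb).

Lemma max_convergence_factor_le (kmax d U : R) (q : R * R) : 0 <= kmax ->
  (forall k, 0 <= k -> rho d q k <= U) ->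
  max_convergence_factor L sigma eps pa pb kmax d q <= U.
Proof.
move=> k0 H; apply: ge_sup => [|_ [k /= /andP[k0' _] <-]]; last exact: H.
by exists (rho d q 0), 0 => //=; rewrite lexx.
Qed.

(** The bound [U] makes [sup] a genuine supremum rather than a default value. *)
Lemma max_convergence_factor_ge (kmax d U k : R) (q : R * R) : 0 <= k <= kmax ->
  (forall k, 0 <= k <= kmax -> rho d q k <= U) ->
  rho d q k <= max_convergence_factor L sigma eps pa pb kmax d q.
Proof.
move=> kk H; apply: ub_le_sup; last by exists k.
by exists U => _ [k' /= k'0 <-]; exact: H.
Qed.

End MaxFactor.

(** * Powers of the overlap and conclusion *)

Section Main.
Context {R : realType}.

Lemma exp_powR (x : R) (n : nat) : 0 < x -> (x `^ (1 / n.+1%:R)) ^+ n.+1 = x.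
Proof. by move=> x0; rewrite powR_inv_natX ?(ltW x0)// divff// powRr1// ltW. Qed.

(** Written in the cube roots [a], [b], [e] of 2, [C] and [d], the claims are rational identities
    modulo [a ^ 3 = 2], [b ^ 3 = C] and [e ^ 3 = d]. *)
Lemma one_sided_parametersE (C d : R) : 0 < C -> 0 < d ->
  let t := 2 * 2 `^ (1 / 3) * C `^ (1 / 3) * d `^ (1 / 3) in
  [/\ 0 < t, t ^+ 3 / (16 * C) = d,
      2 `^ (- (1 / 3)) * C `^ (2 / 3) * d `^ (- (1 / 3)) = 2 * C / t &
      t ^+ 2 = 4 * (2 `^ (1 / 3)) ^+ 2 * (C `^ (1 / 3)) ^+ 2 * d `^ (2 / 3)].
Proof.
move=> C0 d0; have a3 := @exp_powR 2 2 (ltr0n R 2); have b3 := @exp_powR C 2 C0.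
have e3 := @exp_powR d 2 d0.
rewrite !powRN -(powR_inv_natX 2 2 (ltW C0)) -(powR_inv_natX 2 2 (ltW d0)).
have := powR_gt0 (1 / 3) (ltr0n R 2); have := powR_gt0 (1 / 3) C0; have := powR_gt0 (1 / 3) d0.
move: (2 `^ _) (C `^ _) (d `^ _) a3 b3 e3 => a b e a3 b3 e3 e0 b0 a0 t.
split; first by rewrite /t !mulr_gt0.
- have -> : t ^+ 3 = 8 * a ^+ 3 * b ^+ 3 * e ^+ 3 by rewrite /t; ring.
  by rewrite a3 b3 e3; field; rewrite gt_eqF.
- by rewrite /t -[in RHS]b3; field; rewrite !gt_eqF.
- by rewrite /t; ring.
Qed.

Lemma two_sided_parametersE (C d : R) : 0 < C -> 0 < d ->
  let t := 2 * 2 `^ (- (1 / 5)) * C `^ (1 / 5) * d `^ (1 / 5) in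
  [/\ 0 < t, t ^+ 5 / (16 * C) = d,
      2 `^ (- (2 / 5)) * C `^ (2 / 5) * d `^ (- (3 / 5)) = 4 * C / t ^+ 3,
      2 `^ (- (4 / 5)) * C `^ (4 / 5) * d `^ (- (1 / 5)) = C / t &
      t ^+ 2 = 4 * (2 `^ (- (1 / 5))) ^+ 2 * (C `^ (1 / 5)) ^+ 2 * d `^ (2 / 5)].
Proof.
move=> C0 d0; have a5 := @exp_powR 2 4 (ltr0n R 2); have b5 := @exp_powR C 4 C0.
have e5 := @exp_powR d 4 d0.
rewrite !powRN -(powR_inv_natX 4 2 (ler0n R 2)) -(powR_inv_natX 4 4 (ler0n R 2)).
rewrite -(powR_inv_natX 4 2 (ltW C0)) -(powR_inv_natX 4 4 (ltW C0)).
rewrite -(powR_inv_natX 4 2 (ltW d0)) -(powR_inv_natX 4 3 (ltW d0)).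
have := powR_gt0 (1 / 5) (ltr0n R 2); have := powR_gt0 (1 / 5) C0; have := powR_gt0 (1 / 5) d0.
move: (2 `^ _) (C `^ _) (d `^ _) a5 b5 e5 => a b e a5 b5 e5 e0 b0 a0 t.
(* [a ^ 5 = 2] turns the negative powers of [a] into positive ones. *)
have a2 : (a ^+ 2)^-1 = a ^+ 3 / 2 by rewrite -a5; field; rewrite gt_eqF.
have a4 : (a ^+ 4)^-1 = a / 2 by rewrite -a5; field; rewrite gt_eqF.
split; first by rewrite /t !mulr_gt0 ?invr_gt0.
- have -> : t ^+ 5 = 32 * (a ^+ 5)^-1 * b ^+ 5 * e ^+ 5 by rewrite /t; field; rewrite gt_eqF.
  by rewrite a5 b5 e5; field; rewrite gt_eqF.
- by rewrite a2 /t -[in RHS]b5; field; rewrite !gt_eqF.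
- by rewrite a4 /t -[in RHS]b5; field; rewrite !gt_eqF.
- by rewrite /t; ring.
Qed.

End Main.

Theorem theorem1 (R : realType) (L Lhat sigma eps pa pb : R)
    (hL : 0 < L) (hLhat : 0 < Lhat) (hsigma : 0 < sigma) (heps : 0 < eps)
    (hpa : 0 < pa) (hpb : 0 < pb)
    (h M : R -> R)
    (h_gt0 : forall d : R, 0 < d -> 0 < h d)
    (M_gt0 : forall d : R, 0 < d -> 0 < M d)
    (h_overlap : h =O_zero_right (fun d : R => d))
    (M_mesh : M =Theta_zero_right (fun d : R => (h d)^-1)) :
  let C := constC L sigma eps pa pb in
  let rho := fun (d : R) (q : R * R) =>
    max_convergence_factor L sigma eps pa pb (M d * pi / Lhat) d q in
  let p := fun d : R => 2 `^ (- (1 / 3)) * C `^ (2 / 3) * d `^ (- (1 / 3)) in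
  let p1 := fun d : R => 2 `^ (- (2 / 5)) * C `^ (2 / 5) * d `^ (- (3 / 5)) in
  let p2 := fun d : R => 2 `^ (- (4 / 5)) * C `^ (4 / 5) * d `^ (- (1 / 5)) in
  (asymptotically_optimized one_sided_parameters rho (fun d => (p d, p d)) /\
   (fun d : R => rho d (p d, p d)) =
   (fun d : R => 1 - 2 * 2 `^ (1 / 3) * C `^ (1 / 3) * d `^ (1 / 3))
     +O_zero_right (fun d : R => d `^ (2 / 3))) /\
  (asymptotically_optimized two_sided_parameters rho (fun d => (p1 d, p2 d)) /\
   (fun d : R => rho d (p1 d, p2 d)) =
   (fun d : R => 1 - 2 * 2 `^ (- (1 / 5)) * C `^ (1 / 5) * d `^ (1 / 5))
     +O_zero_right (fun d : R => d `^ (2 / 5))).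
Proof.
move=> C rho p p1 p2.
have [K K1 H] := convergence_factor_bounds hsigma heps hL hpa hpb.
rewrite -/C in H.
have C0 : 0 < C.
  by rewrite /C constCE// divr_gt0// addr_gt0// re_dtn_gt0.
have K0 : 0 < K by lra.
have [c c0 mesh] := mesh_frequency hLhat h_gt0 M_gt0 h_overlap M_mesh.
(* The crude estimate is increasing in the frequency, so its value at [kmax] bounds the whole
   range. *)
have bounded d q1 q2 k : 0 < d -> K * d <= 1 / 2 -> 0 < q1 -> 0 < q2 ->
    0 <= k <= M d * pi / Lhat ->
    convergence_factor L sigma eps pa pb d (q1, q2) k <= rho d (q1, q2).
  move=> d0 Kd q10 q20 hk; set kmax := M d * pi / Lhat in hk *.
  apply: (max_convergence_factor_ge
    (U := 1 + 4 * ((q1 + (kmax + K)) / q1 * ((q2 + (kmax + K)) / q2))) hk).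
  move=> k' /andP[k'0 k'max].
  have [m [_ _ /(_ q1 q2 q10 q20)[/andP[_ le] _ _ _]]] := H k' d k'0 d0 Kd.
  apply: (le_trans le); rewrite lerD2l ler_wpM2l//.
  have f q : 0 < q -> (q + (k' + K)) / q <= (q + (kmax + K)) / q.
    by move=> q0; rewrite ler_wpM2r ?invr_ge0 ?(ltW q0)// !lerD2l lerD2r.
  have g q : 0 < q -> 0 <= (q + (k' + K)) / q.
    by move=> q0; rewrite divr_ge0 ?(ltW q0)// !addr_ge0 ?(ltW q0) ?(ltW K0).
  by rewrite ler_pM ?f ?g.
have kmax0 d : 0 < d -> 0 <= M d * pi / Lhat.
  move=> d0; apply: divr_ge0; last exact: ltW.
  by apply: mulr_ge0; [exact/ltW/M_gt0|exact: pi_ge0].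
have weaken (a b t : R) : a <= `|b| -> a * t ^+ 2 <= `|b| * t ^+ 2.
  by move=> ab; rewrite ler_wpM2r ?sqr_ge0.
have smallE (a t : R) : 0 < t -> t < (`|a| + 1)^-1 -> a * t <= 1.
  move=> t0 ta; have a0 := normr_ge0 a; have a1 := ler_norm a.
  have t1 : t * (`|a| + 1) < 1.
    by rewrite -ltr_pdivlMr ?div1r//; lra.
  have : a * t <= `|a| * t by rewrite ler_wpM2r// ltW.
  lra.
have inv0 (a : R) : 0 < (`|a| + 1)^-1 by rewrite invr_gt0; have := normr_ge0 a; lra.
split.
- pose uc := upper_const1 C K; pose lc := low_const C K.
  pose tau (d : R) := 2 * 2 `^ (1 / 3) * C `^ (1 / 3) * d `^ (1 / 3).
  have tau_small e : 0 < e -> \forall d \near 0^'+, 0 < tau d < e.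
    by move=> e0; apply: powR_near => //; rewrite !mulr_gt0 ?powR_gt0.
  apply: (@optimized_of_bounds _ _ _ _ tau _ _ (`|uc + 1| + `|lc|)) => //.
  + by move=> d d0; have [_ _ _ ->] := one_sided_parametersE C0 d0.
  + by move=> d; exact: powR_ge0.
  near=> d.
  have d0 : 0 < d by near: d; exact: nbhs_right_gt.
  have /andP[t0 tlt1] : 0 < tau d < 1 by near: d; exact: tau_small.
  have /andP[_ tK] : 0 < tau d < C / K by near: d; apply: tau_small; rewrite divr_gt0.
  have /andP[_ tuc] : 0 < tau d < (`|uc| + 1)^-1 by near: d; exact: tau_small.
  (* [tau d < 2 c] places the test frequency below [c / d], since [c / d] is that frequency times
     [2 c / t]. *)
  have /andP[_ tc] : 0 < tau d < 2 * c by near: d; apply: tau_small; rewrite mulr_gt0.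
  have meshd : c / d <= M d * pi / Lhat by near: d; exact: mesh.
  have [_ dE pE _] := one_sided_parametersE C0 d0.
  rewrite -/(tau d) in dE pE; move: (tau d) t0 tlt1 tK tuc tc dE pE => t t0 tlt1 tK tuc tc dE pE.
  have t1 := ltW tlt1.
  have Kt : K * t <= C by rewrite mulrC -ler_pdivlMr// ltW.
  have Kd : K * d <= 1 / 2.
    by apply: (overlap_small C0 K1 t0 t1 Kt); rewrite -dE ler_wpM2r ?pow_le1// invr_ge0 mulr_ge0 ?(ltW C0).
  have uct := smallE _ _ t0 tuc.
  have p0 : 0 < p d by rewrite /p pE divr_gt0 ?mulr_gt0.
  split; first by split.
  + apply: (@le_trans _ _ (1 - t + (uc + 1) * t ^+ 2)).
      apply: max_convergence_factor_le => [|k k0]; first exact: kmax0.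
      by rewrite /p pE -{1}dE; exact: (one_sided_upper C0 K1 H).
    rewrite lerD2l ler_wpM2r ?sqr_ge0//.
    by have := ler_norm (uc + 1); have := normr_ge0 lc; lra.
  move=> [q1 q2] [/= q10 /= <-].
  have [k /andP[k0 kle] low] := one_sided_lower C0 K1 H t0 t1 Kt q10.
  rewrite dE in low.
  have kk : 0 <= k <= M d * pi / Lhat.
    rewrite k0 (le_trans kle)// (le_trans _ meshd)// -dE.
    have -> : c / (t ^+ 3 / (16 * C)) = 8 * C / t ^+ 2 * (2 * c / t).
      by field; rewrite !gt_eqF.
    have C80 : 0 <= 8 * C by rewrite mulr_ge0 ?(ltW C0).
    rewrite ler_peMr ?(divr_ge0 C80) ?sqr_ge0//.
    by rewrite ler_pdivlMr// mul1r ltW.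
  apply: le_trans (bounded d q1 q1 k d0 Kd q10 q10 kk); apply: le_trans low.
  have : lc * t ^+ 2 <= `|lc| * t ^+ 2 by apply: weaken; exact: ler_norm.
  have : 0 <= `|uc + 1| * t ^+ 2 by rewrite mulr_ge0 ?sqr_ge0.
  by rewrite /lc; lra.
- pose uc := upper_const2 C K; pose lc := low_const C K.
  pose tau (d : R) := 2 * 2 `^ (- (1 / 5)) * C `^ (1 / 5) * d `^ (1 / 5).
  have tau_small e : 0 < e -> \forall d \near 0^'+, 0 < tau d < e.
    by move=> e0; apply: powR_near => //; rewrite !mulr_gt0 ?powR_gt0.
  apply: (@optimized_of_bounds _ _ _ _ tau _ _ (`|uc + 1| + `|lc|)) => //.
  + by move=> d d0; have [_ _ _ _ ->] := two_sided_parametersE C0 d0.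
  + by move=> d; exact: powR_ge0.
  near=> d.
  have d0 : 0 < d by near: d; exact: nbhs_right_gt.
  have /andP[t0 tlt1] : 0 < tau d < 1 by near: d; exact: tau_small.
  have /andP[_ tK] : 0 < tau d < C / K by near: d; apply: tau_small; rewrite divr_gt0.
  have /andP[_ tuc] : 0 < tau d < (`|uc| + 1)^-1 by near: d; exact: tau_small.
  have /andP[_ tc] : 0 < tau d < 2 * c by near: d; apply: tau_small; rewrite mulr_gt0.
  have meshd : c / d <= M d * pi / Lhat by near: d; exact: mesh.
  have [_ dE pE qE _] := two_sided_parametersE C0 d0.
  rewrite -/(tau d) in dE pE qE.
  move: (tau d) t0 tlt1 tK tuc tc dE pE qE => t t0 tlt1 tK tuc tc dE pE qE.
  have t1 := ltW tlt1.
  have Kt : K * t <= C by rewrite mulrC -ler_pdivlMr// ltW.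
  have Kd : K * d <= 1 / 2.
    by apply: (overlap_small C0 K1 t0 t1 Kt); rewrite -dE ler_wpM2r ?pow_le1// invr_ge0 mulr_ge0 ?(ltW C0).
  have uct := smallE _ _ t0 tuc.
  have p10 : 0 < p1 d by rewrite /p1 pE divr_gt0 ?mulr_gt0 ?exprn_gt0.
  have p20 : 0 < p2 d by rewrite /p2 qE divr_gt0.
  (* The strict inequality ensures that the two parameters are distinct, as [two_sided_parameters]
     demands; it amounts to [t ^ 2 < 4]. *)
  have p12 : p2 d < p1 d.
    rewrite /p1 /p2 pE qE.
    have -> : 4 * C / t ^+ 3 = C / t * (4 / t ^+ 2) by field; rewrite gt_eqF.
    rewrite ltr_pMr ?divr_gt0// ltr_pdivlMr ?exprn_gt0// mul1r.
    by have := pow_le1 1 t0 t1; lra.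
  split.
  + by split => //=; apply/eqP; rewrite gt_eqF.
  + apply: (@le_trans _ _ (1 - t + (uc + 1) * t ^+ 2)).
      apply: max_convergence_factor_le => [|k k0]; first exact: kmax0.
      by rewrite /p1 /p2 pE qE -{1}dE; exact: (two_sided_upper C0 K1 H).
    rewrite lerD2l ler_wpM2r ?sqr_ge0//.
    by have := ler_norm (uc + 1); have := normr_ge0 lc; lra.
  move=> [q1 q2] /= [q10 q20 _].
  have [k /andP[k0 kle] low] := two_sided_lower C0 K1 H t0 t1 Kt q10 q20.
  rewrite dE in low.
  have kk : 0 <= k <= M d * pi / Lhat.
    rewrite k0 (le_trans kle)// (le_trans _ meshd)// -dE.
    have -> : c / (t ^+ 5 / (16 * C)) = 8 * C / t ^+ 4 * (2 * c / t).
      by field; rewrite !gt_eqF.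
    have C80 : 0 <= 8 * C by rewrite mulr_ge0 ?(ltW C0).
    rewrite ler_peMr ?(divr_ge0 C80) ?exprn_ge0 ?(ltW t0)//.
    by rewrite ler_pdivlMr// mul1r ltW.
  apply: le_trans (bounded d q1 q2 k d0 Kd q10 q20 kk); apply: le_trans low.
  have : lc * t ^+ 2 <= `|lc| * t ^+ 2 by apply: weaken; exact: ler_norm.
  have : 0 <= `|uc + 1| * t ^+ 2 by rewrite mulr_ge0 ?sqr_ge0.
  by rewrite /lc; lra.
Unshelve. all: by end_near. Qed.
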